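(* Let $\mathcal X\subset\mathcal X'\times\mathcal X''$ be a subset of a product of two spaces of homogeneous type satisfying conditions (a) and (b) of the context. Let $p,q\in(1,\infty)$, $K_0\ge1$, $w_1=w_1(x')\in A_p(\mu_1)$, $w_2=w_2(x'')\in A_q(\mu_2)$, $[w_1]_{A_p}\le K_0$, $[w_2]_{A_q}\le K_0$, and $w=w(x)=w_1(x')w_2(x'')$. Then for any $f\in L_{p,q}(w\,d\mu)$ we have $$\|\mathcal Mf\|_{L_{p,q}(w\,d\mu)}\le N\|f\|_{L_{p,q}(w\,d\mu)},$$ where $N=N(K_1,K_2,p,q,K_0)>0$.
   Context: Space of homogeneous type $(\mathcal X,\rho,\mu)$: $\rho$ is a quasi-metric, i.e. a nonnegative symmetric function with $\rho(x,y)=0$ iff $x=y$ and $\rho(x,y)\le K_1(\rho(x,z)+\rho(z,y))$; $B_r(x)=\{y:\rho(x,y)<r\}$; balls are assumed open; $\mu$ is a complete Borel measure on a $\sigma$-algebra containing all balls, with $0<\mu(B_{2r}(x))\le K_2\mu(B_r(x))<\infty$; the Lebesgue differentiation theorem is assumed to hold. $K_1,K_2$ denote the constants in these two inequalities for the spaces of homogeneous type involved. For $p\in(1,\infty)$, $A_p(\mu)$ is the set of nonnegative measurable $w$ with $$[w]_{A_p}=\sup_{x_0,\,r>0}\Big(\frac1{\mu(B_r(x_0))}\int_{B_r(x_0)}w\,d\mu\Big)\Big(\frac1{\mu(B_r(x_0))}\int_{B_r(x_0)}w^{-1/(p-1)}\,d\mu\Big)^{p-1}<\infty.$$ Product setting: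 $(\mathcal X',\rho_1,\mu_1)$ and $(\mathcal X'',\rho_2,\mu_2)$ are spaces of homogeneous type; points are $x=(x',x'')$; $\mu$ is the completion of the product measure on $\mathcal X'\times\mathcal X''$ (and also denotes its restriction to $\mathcal X$) and $\rho((x',x''),(y',y''))=\rho_1(x',y')+\rho_2(x'',y'')$. $\mathcal X\subset\mathcal X'\times\mathcal X''$ satisfies: (a) $(\mathcal X,\rho|_{\mathcal X\times\mathcal X},\mu|_{\mathcal X})$ is of homogeneous type; (b) for any $p\in(1,\infty)$, $w_1=w_1(x')\in A_p(\mu_1)$ and $w_2=w_2(x'')\in A_p(\mu_2)$, the function $w(x)=w_1(x')w_2(x'')$ is an $A_p$ weight on $(\mathcal X,\rho|_{\mathcal X\times\mathcal X},\mu|_{\mathcal X})$. Mixed norm: for $w=w_1(x')w_2(x'')$, $$\|f\|_{L_{p,q}(w\,d\mu)}=\Big(\int_{\mathcal X''}\Big(\int_{\mathcal X'}|f|^pI_{\mathcal X}\,w_1(x')\,\mu_1(dx')\Big)^{q/p}w_2(x'')\,\mu_2(dx'')\Big)^{1/q}.$$ Maximal function on $\mathcal X$: $\mathcal Mf(x)=\sup_{B_r(x^* )\ni x}\frac1{\mu(B_r(x^* ))}\int_{B_r(x^* )}|f|\,d\mu$, the supremum over all balls of $\mathcal X$ containing $x$.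
   Formalization: Condition (b) is quantitative: [w1],[w2] ≤ K give [w1w2]_{A_s} ≤ Phi(s,K) on X, and N may also depend on Phi. With the qualitative (b), no N(K1,K2,p,q,K0) exists: on strips |x'-x''| ≤ e, w1=w2=|t|^(-2/3), p=q=2, the norm of M blows up as e→0. *)

(* Defs.v *)
From HB Require Import structures.
From mathcomp Require Import all_boot all_order all_algebra.
From mathcomp Require Import all_classical all_reals all_analysis.

Set Implicit Arguments.
Unset Strict Implicit.
Unset Printing Implicit Defensive.

Import Order.TTheory GRing.Theory Num.Theory.
Import numFieldNormedType.Exports.

Local Open Scope classical_set_scope.
Local Open Scope ring_scope.

(* A space of homogeneous type is presented as a subset [D] of an ambient
   measurable space [T]; all points and balls are relative to [D], so that
   [D = setT] is the whole space and [D = X] is the subspace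
   (X, rho|_(X * X), mu|_X). *)
Section HomogeneousType.
Context {R : realType} {d : measure_display} {T : measurableType d}.
Variables (D : set T) (rho : T -> T -> R) (mu : {measure set T -> \bar R}).

Record quasi_metric (K1 : R) : Prop := QuasiMetric {
  quasi_metric_ge0 : forall x y, D x -> D y -> 0 <= rho x y ;
  quasi_metric_eq0 : forall x y, D x -> D y -> rho x y = 0 <-> x = y ;
  quasi_metric_sym : forall x y, D x -> D y -> rho x y = rho y x ;
  quasi_metric_triangle : forall x y z, D x -> D y -> D z ->
    rho x y <= K1 * (rho x z + rho z y) }.

Definition qball (x : T) (r : R) : set T := [set y | D y /\ rho x y < r].

Definition qopen (A : set T) : Prop :=
  A `<=` D /\ forall x, A x -> exists2 r : R, 0 < r & qball x r `<=` A.

Definition ball_average_cvg_ae : Prop :=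
  forall f : T -> R,
    (forall x r, D x -> 0 < r -> mu.-integrable (qball x r) (EFin \o f)) ->
    {ae mu, forall x, D x ->
      (fine (mu (qball x r)))^-1 * \int[mu]_(y in qball x r) f y
        @[r --> 0^'+] --> f x}.

Record homogeneous_type (K1 K2 : R) : Prop := HomogeneousType {
  homogeneous_measurable : measurable D ;
  homogeneous_quasi_metric : quasi_metric K1 ;
  homogeneous_ball_open : forall x r, D x -> 0 < r -> qopen (qball x r) ;
  homogeneous_borel : forall A, qopen A -> measurable A ;
  homogeneous_complete : forall A, A `<=` D -> mu.-negligible A -> measurable A ;
  homogeneous_doubling : forall x r, D x -> 0 < r ->
    [/\ (0 < mu (qball x (2 * r)))%E,
        (mu (qball x (2 * r)) <= K2%:E * mu (qball x r))%E &
        (K2%:E * mu (qball x r) < +oo)%E] ;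
  homogeneous_lebesgue : ball_average_cvg_ae }.

Definition average (A : set T) (f : T -> \bar R) : \bar R :=
  ((mu A)^-1 * \int[mu]_(y in A) f y)%E.

(* Extended-real operations are used so that w^(-1/(p-1)) = +oo where w = 0
   (the real-valued power would give 0 there). *)
Definition Ap_const (p : R) (w : T -> R) : \bar R :=
  ereal_sup [set a | exists x r, [/\ D x, 0 < r &
    a = (average (qball x r) (fun y => (w y)%:E) *
         average (qball x r) (fun y => ((w y)%:E `^ (p - 1)^-1)^-1) `^ (p - 1))%E]].

Definition Ap_weight (p : R) (w : T -> R) : Prop :=
  [/\ forall x, D x -> 0 <= w x, measurable_fun D w & (Ap_const p w < +oo)%E].

Definition maximal_function (f : T -> R) (x : T) : \bar R :=
  ereal_sup [set a | exists y r, [/\ D y, 0 < r, qball y r x &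
    a = average (qball y r) (fun z => `|f z|%:E)]].

End HomogeneousType.

Section Product.
Context {R : realType} {d1 d2 : measure_display}.
Context {T1 : measurableType d1} {T2 : measurableType d2}.
Variables (rho1 : T1 -> T1 -> R) (rho2 : T2 -> T2 -> R).

Definition sum_metric (x y : T1 * T2) : R := rho1 x.1 y.1 + rho2 x.2 y.2.

Definition product_weight (w1 : T1 -> R) (w2 : T2 -> R) (x : T1 * T2) : R :=
  w1 x.1 * w2 x.2.

(* A measure that is finite on balls is sigma-finite; asking for the sigma-finite
   structure only serves to form [mu1 \x mu2]. *)
Variables (mu1 : {sigma_finite_measure set T1 -> \bar R})
          (mu2 : {sigma_finite_measure set T2 -> \bar R}).

Definition product_measure : {measure set (T1 * T2) -> \bar R} :=
  (mu1 \x mu2)%E.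

(* T1 * T2 with the Caratheodory sigma-algebra of the product measure; as the
   product measure is sigma-finite, this is its completed sigma-algebra. *)
Definition completed_prod := caratheodory_type (product_measure^*)%mu.

Definition completed_product_measure :
    {measure set completed_prod -> \bar R} :=
  completed_measure_extension (mu := product_measure).

(* The [A_s] constant of a product weight is controlled by [s] and by a common
   bound on the constants of the factors; taking K := max([w1], [w2]) shows that
   every product weight is in A_s. The control [Phi] is part of the data on which
   the bound for the maximal function depends. It cannot be dropped: for the
   strips |x' - x''| <= e, |x'| <= 1 of R * R and w1 = w2 = |t|^(-2/3), the
   homogeneous type constants do not depend on e and every product weight is in
   A_s for each e, but the A_2 constant of w1 w2, hence the norm of the maximal
   function on L_2(w1 w2), blows up as e tends to 0. *)
Definition product_Ap (X : set completed_prod) (Phi : R -> R -> R) : Prop :=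
  forall (s K : R) (w1 : T1 -> R) (w2 : T2 -> R),
    1 < s ->
    Ap_weight setT rho1 mu1 s w1 -> Ap_weight setT rho2 mu2 s w2 ->
    (Ap_const setT rho1 mu1 s w1 <= K%:E)%E ->
    (Ap_const setT rho2 mu2 s w2 <= K%:E)%E ->
    Ap_weight X sum_metric completed_product_measure s (product_weight w1 w2) /\
    (Ap_const X sum_metric completed_product_measure s (product_weight w1 w2)
      <= (Phi s K)%:E)%E.

Definition mixed_norm (X : set (T1 * T2)) (p q : R) (w1 : T1 -> R)
    (w2 : T2 -> R) (f : T1 * T2 -> \bar R) : \bar R :=
  ((\int[mu2]_x2
      ((\int[mu1]_x1 (`|f (x1, x2)| `^ p * (\1_X (x1, x2) * w1 x1)%:E))
         `^ (q / p) * (w2 x2)%:E)) `^ q^-1)%E.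

Definition mixed_Lpq (X : set completed_prod) (p q : R) (w1 : T1 -> R)
    (w2 : T2 -> R) (f : completed_prod -> R) : Prop :=
  measurable_fun X f /\ (mixed_norm X p q w1 w2 (EFin \o f) < +oo)%E.

End Product.

(* Main.v *)
Require Import Defs.
From HB Require Import structures.
From mathcomp Require Import all_boot all_order all_algebra.
From mathcomp Require Import all_classical all_reals all_analysis.
From mathcomp Require Import measurable_realfun.
From mathcomp Require Import ring lra.

Set Implicit Arguments.
Unset Strict Implicit.
Unset Printing Implicit Defensive.

Import Order.TTheory GRing.Theory Num.Theory.
Import numFieldNormedType.Exports.

Local Open Scope classical_set_scope.
Local Open Scope ring_scope.

(** By Fubini, the mixed norm of [h] is the weighted L^(q/p)(w2) norm of
   [H x'' = \int_X' |h|^p I_X w1 dmu1]. For every [v] in A_p(mu2) the product [w1 v]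
   is an A_p weight on X, so Muckenhoupt's theorem on X gives [\int G v <= C \int F v]
   for the functions [G], [F] attached to [M f] and [f], with [C] depending on [v] only
   through its A_p constant. Extrapolation on X'' turns this family of inequalities
   into [\int G^(q/p) w2 <= C' \int F^(q/p) w2] for [w2] in A_q.

   Muckenhoupt's theorem follows Lerner: [(M F)^(p-1)] is at most [K] times
   [M_w ((M_s F)^(p-1))], where [s = w^(-1/(p-1))] and [M_w], [M_s] are the maximal
   operators of the doubling measures [w dmu], [s dmu], which are bounded on L^r, r > 1,
   by Vitali covering.

   Extrapolation uses [v = U1 U2^(1-p)], where [U1], [U2] are A_1 majorants of
   [G^((q-1)/p) w2] in L^q'(w2^(1-q')) and of [F^(1/p)] in L^q(w2). Then
   [G^(1/p) <= U2 + G U2^(1-p)] and [F v <= U1 U2], and Young's inequality for [U1 U2]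
   absorbs [\int G^(q/p) w2]. *)

(** [M] on [X] mixes the two variables, so a slice of [M f] cannot be estimated for fixed [x'']:
    only integrals of slices against a weight [v] in [x''] are accessible, and only with the
    exponent [p] shared by [w1] and [v]. The passage from [p] to [q] is therefore made for an
    arbitrary pair [F], [G] of functions of [x''], and a single weight [v] tailored to that pair
    treats [q < p] and [q > p] alike.

    [N] is fixed before the spaces and the weights, so every constant is an explicit function of
    earlier ones. This favours an argument that uses only doubling and the A_p inequality itself,
    without the self-improvement of A_p.

    Three obstacles shape the rest. Absorbing an integral requires it to be finite, and majorants
    used with negative powers must be positive; both are arranged by approximation. Weights may
    vanish, where the dual weight is infinite; such a weight is zero almost everywhere or positive
    almost everywhere. Finally, in the completed product a section is measurable only for almost
    every [x''], and completeness of the factors has to repair this. *)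

Lemma ge0_integral_bigcup_le d (T : measurableType d) (R : realType)
    (mu : {measure set T -> \bar R}) (F : (set T)^nat) (f : T -> \bar R) :
  (forall k, measurable (F k)) -> measurable_fun (\bigcup_k F k) f ->
  (forall x, (\bigcup_k F k) x -> (0 <= f x)%E) ->
  (\int[mu]_(x in \bigcup_k F k) f x <=
   \sum_(k <oo) \int[mu]_(x in F k) f x)%E.
Proof.
move=> mF mf f0.
have mD k : measurable (seqDU F k).
  by apply: measurableD => //; exact: bigsetU_measurable.
rewrite {1}seqDU_bigcup_eq ge0_integral_bigcup//.
- apply: lee_nneseries => k _.
    by move=> _; apply: integral_ge0 => x [Fx _]; apply: f0; exists k.
  apply: ge0_subset_integral => //.
  + by apply: measurable_funS mf => //; [exact: bigcup_measurable|exact: bigcup_sup].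
  + by move=> x Fx; apply: f0; exists k.
  + exact: subDsetl.
- by rewrite -seqDU_bigcup_eq.
- by rewrite -seqDU_bigcup_eq.
Qed.

Lemma ge0_integral_gt0 d (T : measurableType d) (R : realType)
    (mu : {measure set T -> \bar R}) (A : set T) (f : T -> \bar R) :
  measurable A -> measurable_fun A f -> (forall x, A x -> (0 < f x)%E) ->
  (0 < mu A)%E -> (0 < \int[mu]_(x in A) f x)%E.
Proof.
move=> mA mf f0 A0; rewrite lt_def integral_ge0 ?andbT; last first.
  by move=> x /f0 /ltW.
apply/eqP => I0.
have : (\int[mu]_(x in A) `|f x| = 0)%E.
  rewrite -I0; apply: eq_integral => x /set_mem /f0 fx.
  by rewrite gee0_abs// ltW.
move/(ae_eq_integral_abs _ mA mf) => [N [mN N0 sN]].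
suff : (mu A <= mu N)%E by rewrite N0 leNgt A0.
apply: le_measure; rewrite ?inE//.
by apply: subset_trans sN => x Ax /= /(_ Ax) fx; have := f0 _ Ax; rewrite fx ltxx.
Qed.

(** For each [n], only finitely many of the disjoint [B i] can carry more than [1/(n+1)] of a finite
    integral. In the covering argument this stands in for separability of the space. *)
Lemma countable_disjoint_pos (I : choiceType) (d : measure_display)
    (T : measurableType d) (R : realType) (mu : {measure set T -> \bar R})
    (D : set T) (f : T -> \bar R) (G : set I) (B : I -> set T) :
  measurable D -> measurable_fun D f -> (forall x, D x -> (0 <= f x)%E) ->
  (\int[mu]_(x in D) f x < +oo)%E ->
  (forall i, G i -> measurable (B i) /\ B i `<=` D) -> trivIset G B ->
  (forall i, G i -> (0 < \int[mu]_(x in B i) f x)%E) -> countable G.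
Proof.
move=> mD mf f0 foo mB tB posB.
pose S n := [set i | G i /\ (n.+1%:R^-1%:E < \int[mu]_(x in B i) f x)%E].
have -> : G = \bigcup_n S n.
  apply/seteqP; split => [i Gi|i [n _ [//]]].
  have := posB _ Gi; case e : (\int[mu]_(x in B i) f x)%E => [r| |]//.
  - rewrite lte_fin => r0; exists (Num.truncn r^-1) => //; split=> //; rewrite e lte_fin.
    rewrite invf_plt ?posrE// truncnS_gt//.
  - by move=> _; exists 0%N => //; split=> //; rewrite e ltry.
apply: bigcup_countable => // n _.
apply/finite_set_countable; apply: contrapT => infS.
have I0 : (0 <= \int[mu]_(x in D) f x)%E by exact: integral_ge0.
have Ifin : (\int[mu]_(x in D) f x)%E \is a fin_num by rewrite ge0_fin_numE.
pose M := fine (\int[mu]_(x in D) f x)%E.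
(* More than [M (n+1)] disjoint sets, each of integral above [1/(n+1)], would exceed the total
   [M]. *)
have [F FS Fc] := infinite_set_fset (Num.truncn (M * n.+1%:R)).+1 infS.
have mBs i : i \in finmap.enum_fset F -> measurable (B i) /\ B i `<=` D.
  by move=> iF; apply: mB; have [] := FS i iF.
suff : (\int[mu]_(x in D) f x < \int[mu]_(x in D) f x)%E by rewrite ltxx.
pose B' i := if i \in finmap.enum_fset F then B i else set0.
have mB' i : measurable (B' i).
  by rewrite /B'; case: ifPn => // /mBs[].
have UD : \big[setU/set0]_(i <- finmap.enum_fset F) B' i `<=` D.
  rewrite -bigcup_seq => x [i /= iF]; rewrite /B' iF => Bx.
  by have [_] := mBs _ iF; apply.
have mU : measurable (\big[setU/set0]_(i <- finmap.enum_fset F) B' i).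
  exact: bigsetU_measurable.
apply: (@lt_le_trans _ _ (\int[mu]_(x in \big[setU/set0]_(i <- finmap.enum_fset F) B' i) f x)%E).
  rewrite ge0_integral_bigsetU//; last 3 first.
  - move=> i j iF jF; rewrite /B' iF jF.
    by apply: tB; [have [] := FS i iF|have [] := FS j jF].
  - exact: measurable_funS mf.
  - by move=> x /UD; exact: f0.
  apply: (@lt_le_trans _ _ (\sum_(i <- finmap.enum_fset F) n.+1%:R^-1%:E)%E); last first.
    rewrite big_seq [leRHS]big_seq; apply: lee_sum => i iF.
    by rewrite /B' iF ltW//; have [] := FS i iF.
  rewrite sumEFin big_const_seq count_predT iter_addr addr0 -(fineK Ifin) lte_fin -/M.
  rewrite -[X in _ < X]mulr_natl ltr_pdivlMr//.
  apply: (lt_le_trans (truncnS_gt _)); by rewrite ler_nat.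
exact: ge0_subset_integral.
Qed.

(* [ds_union] is what remains of the assumption that balls are open: the level sets
   of maximal functions are unions of balls. *)
Record doubling_space (R : realType) (d : measure_display)
    (T : measurableType d) (D : set T) (rho : T -> T -> R)
    (mu : {measure set T -> \bar R}) (K1 K2 : R) : Prop := DoublingSpace {
  ds_measurable : measurable D ;
  ds_K1 : 1 <= K1 ;
  ds_K2 : 1 <= K2 ;
  ds_self : forall x, D x -> rho x x = 0 ;
  ds_sym : forall x y, D x -> D y -> rho x y = rho y x ;
  ds_triangle : forall x y z, D x -> D y -> D z ->
    rho x y <= K1 * (rho x z + rho z y) ;
  ds_union : forall I : set (T * R), (forall i, I i -> D i.1 /\ 0 < i.2) ->
    measurable (\bigcup_(i in I) qball D rho i.1 i.2) ;
  ds_gt0 : forall x r, D x -> 0 < r -> (0 < mu (qball D rho x r))%E ;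
  ds_lty : forall x r, D x -> 0 < r -> (mu (qball D rho x r) < +oo)%E ;
  ds_double : forall x r, D x -> 0 < r ->
    (mu (qball D rho x (2 * r)) <= K2%:E * mu (qball D rho x r))%E }.

(** Maxima with 1 only weaken the inequalities. Finiteness of the measure of a ball comes from that
    of its product with [K2]: this product is positive, so an infinite measure would force [K2 > 0]
    and an infinite product. *)
Lemma homogeneous_doubling_space (R : realType) (d : measure_display)
    (T : measurableType d) (D : set T) (rho : T -> T -> R)
    (mu : {measure set T -> \bar R}) (K1 K2 : R) :
  homogeneous_type D rho mu K1 K2 ->
  doubling_space D rho mu (Num.max 1 K1) (Num.max 1 K2).
Proof.
move=> H; have [mD Q Bo Bm _ Hd _] := H; have [q0 qe qs qt] := Q.
have gt0 x r : D x -> 0 < r -> (0 < mu (qball D rho x r))%E.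
  move=> Dx r0; have r20 : 0 < r / 2 by rewrite divr_gt0.
  by have [+ _ _] := Hd x (r / 2) Dx r20; rewrite mulrC divfK.
split => //.
- by rewrite le_max lexx.
- by rewrite le_max lexx.
- by move=> x Dx; apply/(qe x x Dx Dx).
- move=> x y z Dx Dy Dz; apply: (le_trans (qt x y z Dx Dy Dz)).
  by apply: ler_wpM2r; [rewrite addr_ge0// q0|rewrite le_max lexx orbT].
- move=> I I0; apply: Bm; split => [x [i Ii []//]|x [i Ii ix]].
  have [Di i0] := I0 _ Ii; have [_ /(_ x ix)[r r0 rB]] := Bo _ _ Di i0.
  by exists r => // y /rB; exists i.
- move=> x r Dx r0; have [B2 h K2B] := Hd x r Dx r0.
  have B0 := gt0 x r Dx r0.
  have : (0 < K2%:E * mu (qball D rho x r))%E by exact: lt_le_trans h.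
  rewrite ltey; apply: contraPneq => Boo; move: K2B; rewrite Boo.
  have [K20|K20] := ltP 0 K2; first by rewrite gt0_muley ?lte_fin// ltxx.
  by move=> _; rewrite ltNge mule_le0_ge0// lee_fin.
- move=> x r Dx r0; have [_ h _] := Hd x r Dx r0; apply: (le_trans h).
  by apply: lee_wpmul2r; rewrite ?measure_ge0// lee_fin le_max lexx orbT.
Qed.

(** * Maximal functions of doubling weights *)

Section Covering.
Context (R : realType) (d : measure_display) (T : measurableType d).
Context (D : set T) (rho : T -> T -> R) (mu : {measure set T -> \bar R}).
Context (K1 K2 : R) (DS : doubling_space D rho mu K1 K2).

Local Notation B := (qball D rho).

Lemma measurable_qball x r : D x -> 0 < r -> measurable (B x r).
Proof.
move=> Dx r0; have := ds_union DS (I := [set (x, r)]).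
by rewrite bigcup_set1; apply => _ ->.
Qed.

Lemma qball_subset x r : B x r `<=` D. Proof. by move=> y []. Qed.

Lemma qball_center x r : D x -> 0 < r -> B x r x.
Proof. by move=> Dx r0; split=> //; rewrite (ds_self DS). Qed.

(** Zorn's lemma is applied to disjoint subfamilies [G] such that every ball meeting [G] meets a
    member of at least half its radius. If a maximal [G] missed some ball of [F], a missed ball of
    nearly maximal radius could be added; the bound [M] makes that supremum of radii finite. *)
Lemma vitali_covering (F : set (T * R)) (M : R) :
  (forall i, F i -> D i.1 /\ 0 < i.2 <= M) ->
  exists G : set (T * R), [/\ G `<=` F,
    trivIset G (fun i => B i.1 i.2) &
    forall i, F i -> exists2 j, G j & B i.1 i.2 `<=` B j.1 (5 * K1 ^+ 2 * j.2)].
Proof.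
move=> F0; pose Bi (i : T * R) := B i.1 i.2.
pose P (G : set (T * R)) := [/\ G `<=` F, trivIset G Bi &
  forall i, F i -> (exists2 j, G j & Bi i `&` Bi j !=set0) ->
   exists j, [/\ G j, Bi i `&` Bi j !=set0 & i.2 <= 2 * j.2]].
have [|G [[GF tG PG] maxG]] := @Zorn_bigcup _ P.
  move=> FF FP tot; split.
  - by move=> i [G FG Gi]; have [+ _ _] := FP G FG; apply.
  - move=> i j [G FG Gi] [G' FG' G'j].
    have [GG'|G'G] := tot _ _ FG FG'.
      by have [_ + _] := FP G' FG'; apply => //; exact: GG'.
    by have [_ + _] := FP G FG; apply => //; exact: G'G.
  - move=> i Fi [j [G FG Gj] ij]; have [_ _ PG] := FP G FG.
    have [|k [Gk ik ik2]] := PG i Fi; first by exists j.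
    by exists k; split => //; exists G.
have meets i : F i -> exists2 j, G j & Bi i `&` Bi j !=set0.
  move=> Fi; apply: contrapT => noj.
  pose F' := [set k | F k /\ ~ exists2 j, G j & Bi k `&` Bi j !=set0].
  have F'i : F' i by [].
  pose S := [set k.2 | k in F'].
  have hS : has_sup S.
    split; first by exists i.2, i.
    by exists M => _ [k [Fk _] <-]; have [_ /andP[]] := F0 _ Fk.
  have S0 : 0 < sup S.
    have [_ /andP[i0 _]] := F0 _ Fi; apply: (lt_le_trans i0).
    by apply: sup_upper_bound => //; exists i.
  (* The gap [sup S / 2] yields a missed ball whose radius is at least half of every missed
     radius. *)
  have [k2 [k F'k <-] Sk] := sup_adherent (divr_gt0 S0 (@ltr0Sn R 1)) hS.
  have kmax l : F' l -> l.2 <= 2 * k.2.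
    move=> F'l; apply: (@le_trans _ _ (sup S)).
      by apply: sup_upper_bound => //; exists l.
    by move: Sk; lra.
  have [Fk nk] := F'k.
  apply: (maxG (G `|` [set k])).
    split; first exact: subsetUl.
    move=> /(_ k (or_intror erefl)) Gk; apply: nk; exists k => //.
    have [Dk /andP[k0 _]] := F0 _ Fk.
    by exists k.1; split; exact: qball_center.
  split.
  - by move=> j [/GF//|->].
  - move=> a b [Ga|->] [Gb|->]//.
    + exact: tG.
    + by move=> ab; exfalso; apply: nk; exists a => //; rewrite setIC.
    + by move=> ab; exfalso; apply: nk; exists b.
  (* If [l] meets the old [G], its property serves; otherwise [l] is itself a missed ball, it meets
     [k], and [kmax] applies. *)
  - move=> l Fl [j Gj lj].
    have [[m Gm lm]|nl] := pselect (exists2 j, G j & Bi l `&` Bi j !=set0).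
      have [|m' [Gm' ? ?]] := PG l Fl; first by exists m.
      by exists m'; split => //; left.
    exists k; split; [by right| |exact: kmax].
    case: Gj lj => [Gj lj|->//]; exfalso; apply: nl; by exists j.
exists G; split => // i Fi.
have [j [Gj [v [[Dv iv] [_ jv]]] ij]] := PG i Fi (meets i Fi).
exists j => // u [Du iu]; split=> //.
have [Di _] := F0 _ Fi; have [Dj /andP[j0 _]] := F0 _ (GF _ Gj).
have K1' := ds_K1 DS.
(* Two quasi-triangle inequalities through the common point [v] give [K1 (r_j + 2 K1 r_i)]; with
   [r_i <= 2 r_j] and [K1 >= 1] this is at most [5 K1^2 r_j]. *)
have h1 := ds_triangle DS Dj Du Dv.
have h2 := ds_triangle DS Dv Du Di.
rewrite (ds_sym DS Dv Di) in h2.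
have h3 : K1 * (rho j.1 v + rho v u) < K1 * (j.2 + K1 * (2 * j.2 + 2 * j.2)).
  rewrite ltr_pM2l ?(lt_le_trans ltr01)// ltr_leD//.
  apply: (le_trans h2); rewrite ler_pM2l ?(lt_le_trans ltr01)//.
  by move: iv iu ij; lra.
apply: (le_lt_trans h1); apply: (lt_le_trans h3).
have : K1 * j.2 <= K1 ^+ 2 * j.2.
  by rewrite ler_pM2r// expr2 ler_peMl// (le_trans ler01).
by rewrite expr2; nra.
Qed.

End Covering.

(** The number of doublings that reach Vitali's dilation factor [5 K1^2]; a dilated ball then costs
    [C^m] in a weight of doubling constant [C]. *)
Definition covering_exponent (R : realType) (K1 : R) : nat :=
  (Num.truncn (5 * K1 ^+ 2)).+1.

Lemma covering_exponentP (R : realType) (K1 : R) :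
  5 * K1 ^+ 2 <= 2 ^+ covering_exponent K1.
Proof.
apply: ltW; apply: (lt_le_trans (truncnS_gt _)).
by rewrite -natrX ler_nat ltnW// ltn_expl.
Qed.

(** Monotone convergence in the form used for suprema of increasing approximations: cut-off maximal
    functions, the iterates of the majorant, the truncations of [G]. *)
Lemma integral_le_sup (d : measure_display) (T : measurableType d)
    (R : realType) (mu : {measure set T -> \bar R}) (D : set T)
    (u : nat -> T -> \bar R) (f : T -> \bar R) (M : \bar R) :
  measurable D -> (forall n, measurable_fun D (u n)) -> measurable_fun D f ->
  (forall n x, D x -> (0 <= u n x)%E) -> (forall x, D x -> (0 <= f x)%E) ->
  (forall n x, D x -> (u n x <= u n.+1 x)%E) ->
  (forall x, D x -> (f x <= ereal_sup (range (u ^~ x)))%E) ->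
  (forall n, (\int[mu]_(x in D) u n x <= M)%E) ->
  (\int[mu]_(x in D) f x <= M)%E.
Proof.
move=> mD mu_ mf u0 f0 uS fsup uM.
have und x : D x -> nondecreasing_seq (u ^~ x).
  by move=> Dx; apply/nondecreasing_seqP => n; exact: uS.
have ulim x : D x -> limn (u ^~ x) = ereal_sup (range (u ^~ x)).
  by move=> Dx; apply/cvg_lim => //; apply: ereal_nondecreasing_cvgn; exact: und.
apply: (@le_trans _ _ (\int[mu]_(x in D) limn (u ^~ x))%E).
  apply: ge0_le_integral => //.
  - apply: (emeasurable_fun_cvg u) => // x Dx.
    by apply: ereal_nondecreasing_is_cvgn; exact: und.
  - by move=> x Dx; rewrite ulim// fsup.
rewrite monotone_convergence//.
apply: lime_le; last by apply: nearW.
apply: ereal_nondecreasing_is_cvgn; apply/nondecreasing_seqP => n.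
by apply: ge0_le_integral => // x Dx; [exact: u0|exact: uS].
Qed.

(** * Dyadic sums in place of the layer-cake integral *)

Section DyadicSums.
Context (R : realType).

Lemma le_poweR (x y : \bar R) (r : R) : 0 <= r -> (0 <= x)%E -> (x <= y)%E ->
  (x `^ r <= y `^ r)%E.
Proof.
move=> r0 x0 xy; apply: gt0_ler_poweR => //; rewrite in_itv/= leey andbT//.
exact: le_trans xy.
Qed.

Lemma powR2_gt1 (r : R) : 0 < r -> 1 < 2 `^ r :> R.
Proof.
move=> r0; rewrite [ltLHS](_ : _ = 1 `^ r); last by rewrite powR1.
by rewrite gt0_ltr_powR// ?nnegrE// ltr1n.
Qed.

(** The highest level [2^k e] below [a] suffices alone, since the truncated [a] is at most
    [2^(k+1) e]. The cut at both ends keeps the number of levels finite. *)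
Lemma dyadic_lower (s e : R) (N : nat) (a : \bar R) : 0 < s -> 0 < e ->
  (0 <= a)%E ->
  ((if (a <= e%:E)%E then 0%E else mine a (2 ^+ N.+1 * e)%:E) `^ s <=
   \sum_(k < N.+1) (if ((2 ^+ k * e)%:E < a)%E then ((2 ^+ k.+1 * e) `^ s)%:E
                 else 0))%E.
Proof.
move=> s0 e0 a0; case: ifPn => [_|]; last rewrite -ltNge => ea.
  rewrite poweR0r ?gt_eqF// sume_ge0// => k _; case: ifPn => // _.
  by rewrite lee_fin powR_ge0.
have min0 n : (0 <= mine a (2 ^+ n * e)%:E)%E.
  by rewrite le_min a0 lee_fin mulr_ge0 ?exprn_ge0// ltW.
have last_step n : (mine a (2 ^+ n * e)%:E `^ s <= ((2 ^+ n * e) `^ s)%:E)%E.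
  rewrite -poweR_EFin; apply: le_poweR => //; first exact: ltW.
  by rewrite ge_min lexx orbT.
elim: N => [|N IH].
  by rewrite big_ord_recl big_ord0 adde0 expr0 mul1r ea.
rewrite big_ord_recr/=; case: ifPn => [aN|].
  apply: (le_trans (last_step _)); rewrite leeDr//.
  by apply: (le_trans _ IH); exact: poweR_ge0.
rewrite -leNgt adde0 => aN; apply: (le_trans _ IH).
rewrite (min_idPl aN) (min_idPl _)//; apply: (le_trans aN).
by rewrite lee_fin ler_pM2r// ler_eXn2l ?ltr1n.
Qed.

(** The sum of [2^(-j r)] over [j >= 0]. *)
Definition geometric_const (r : R) : R := 2 `^ r / (2 `^ r - 1).

Lemma geometric_const_ge0 (r : R) : 0 < r -> 0 <= geometric_const r.
Proof.
by move=> /powR2_gt1 r1; rewrite divr_ge0 ?powR_ge0// subr_ge0 ltW.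
Qed.

Lemma dyadic_geometric (r e : R) (N : nat) : 0 < r -> 0 < e ->
  \sum_(k < N.+1) (2 ^+ k * e) `^ r <= geometric_const r * (2 ^+ N * e) `^ r.
Proof.
move=> r0 e0; have b1 := powR2_gt1 r0.
have b0 : 2 `^ r - 1 != 0 :> R by rewrite subr_eq0 gt_eqF.
elim: N => [|N IH].
  rewrite big_ord_recl big_ord0 addr0 expr0 ler_peMl ?powR_ge0//.
  by rewrite /geometric_const ler_pdivlMr ?mul1r ?subr_gt0// gerBl.
rewrite big_ord_recr/=; apply: (le_trans (lerD IH (lexx _))).
set X := 2 ^+ N * e; rewrite (_ : 2 ^+ N.+1 * e = 2 * X); last first.
  by rewrite exprS mulrA.
have X0 : 0 <= X by rewrite mulr_ge0 ?exprn_ge0// ltW.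
rewrite powRM//; set A := X `^ r; rewrite le_eqVlt; apply/orP; left.
by apply/eqP; rewrite /geometric_const; field.
Qed.

(** The levels below [a] give a geometric progression whose largest term is at most [a^r]. The bound
    is free of [e] and [N], so the number of levels may later tend to infinity. *)
Lemma dyadic_upper (r e a : R) (N : nat) : 0 < r -> 0 < e -> 0 <= a ->
  \sum_(k < N) (if 2 ^+ k * e < a then (2 ^+ k * e) `^ r else 0) <=
  geometric_const r * a `^ r.
Proof.
move=> r0 e0 a0; elim: N => [|N IH].
  by rewrite big_ord0 mulr_ge0 ?powR_ge0// geometric_const_ge0.
rewrite big_ord_recr/=; case: ifPn => [aN|_]; last by rewrite addr0.
apply: (@le_trans _ _ (\sum_(k < N.+1) (2 ^+ k * e) `^ r)).
  rewrite big_ord_recr/= lerD2r; apply: ler_sum => k _.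
  by case: ifPn => // _; rewrite powR_ge0.
apply: (le_trans (dyadic_geometric _ r0 e0)).
rewrite ler_wpM2l ?geometric_const_ge0//.
by rewrite ge0_ler_powR ?nnegrE ?mulr_ge0 ?exprn_ge0// ltW.
Qed.

End DyadicSums.

(** * Weak and strong type of the maximal operator of a doubling weight *)

Section WeightedMaximal.
Context (R : realType) (d : measure_display) (T : measurableType d).
Context (D : set T) (rho : T -> T -> R) (mu : {measure set T -> \bar R}).
Context (K1 K2 : R) (DS : doubling_space D rho mu K1 K2).
Local Notation B := (qball D rho).

Record doubling_weight (C : R) (w : T -> R) : Prop := DoublingWeight {
  dw_gt0 : forall x, D x -> 0 < w x ;
  dw_measurable : measurable_fun D w ;
  dw_ge1 : 1 <= C ;
  dw_lty : forall x r, D x -> 0 < r ->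
    (\int[mu]_(y in B x r) (w y)%:E < +oo)%E ;
  dw_double : forall x r, D x -> 0 < r ->
    (\int[mu]_(y in B x (2 * r)) (w y)%:E <=
     C%:E * \int[mu]_(y in B x r) (w y)%:E)%E }.

(** [F] stands for a density [f w], so this is the maximal function of [f = F / w] for the measure
    [w dmu]. Accordingly the L^s(w) norm of [f] appears below as the integral of [F^s w^(1-s)]. *)
Definition wmax (w : T -> R) (F : T -> \bar R) (x : T) : \bar R :=
  ereal_sup [set a | exists y r, [/\ D y, 0 < r, B y r x &
    a = ((\int[mu]_(z in B y r) (w z)%:E)^-1 * \int[mu]_(z in B y r) F z)%E]].

Definition heavy_balls (w : T -> R) (F : T -> \bar R) (t : R) : set (T * R) :=
  [set i | [/\ D i.1, 0 < i.2 & (t%:E * \int[mu]_(y in B i.1 i.2) (w y)%:E <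
                                 \int[mu]_(y in B i.1 i.2) F y)%E]].

Let mD : measurable D. Proof. exact: ds_measurable DS. Qed.

Context (C : R) (w : T -> R) (dw : doubling_weight C w).

Lemma weight_EFin_measurable (A : set T) : measurable A -> A `<=` D ->
  measurable_fun A (EFin \o w).
Proof.
move=> mA AD; apply/measurable_EFinP.
by apply: measurable_funS (dw_measurable dw).
Qed.

Lemma weight_ge0 x : D x -> (0 <= (w x)%:E)%E.
Proof. by move=> Dx; rewrite lee_fin ltW// (dw_gt0 dw). Qed.

Lemma weight_ball_gt0 x r : D x -> 0 < r ->
  (0 < \int[mu]_(y in B x r) (w y)%:E)%E.
Proof.
move=> Dx r0; apply: ge0_integral_gt0 (ds_gt0 DS Dx r0).
- exact: (measurable_qball DS).
- by apply: weight_EFin_measurable; [exact: (measurable_qball DS)|exact: qball_subset].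
- by move=> y [Dy _]; rewrite lte_fin (dw_gt0 dw).
Qed.

Lemma weight_ball_fin x r : D x -> 0 < r ->
  (\int[mu]_(y in B x r) (w y)%:E)%E \is a fin_num.
Proof.
by move=> Dx r0; rewrite ge0_fin_numE ?(dw_lty dw)// ltW// weight_ball_gt0.
Qed.

Lemma doubling_iter m x r : D x -> 0 < r ->
  (\int[mu]_(y in B x (2 ^+ m * r)) (w y)%:E <=
   (C ^+ m)%:E * \int[mu]_(y in B x r) (w y)%:E)%E.
Proof.
move=> Dx r0; elim: m => [|m IH]; first by rewrite !expr0 mul1r mul1e.
rewrite exprS -mulrA; apply: (le_trans (dw_double dw Dx _)).
  by rewrite mulr_gt0// exprn_gt0.
rewrite exprS EFinM -muleA; apply: lee_wpmul2l => //.
by rewrite lee_fin (le_trans ler01)// (dw_ge1 dw).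
Qed.

Let m := covering_exponent K1.

(** The disjoint Vitali subfamily collects at most the integral of [F] over [D], while its dilations
    cover the union at the price [C^m] each. The subfamily is countable because every heavy ball has
    a positive integral of [F], whose total may be taken finite. *)
Lemma weak_type_bounded (F : T -> \bar R) (t N : R) :
  measurable_fun D F -> (forall x, D x -> (0 <= F x)%E) -> 0 < t ->
  (t%:E * \int[mu]_(x in
     \bigcup_(i in heavy_balls w F t `&` [set i | (i.2 <= N)%R]) B i.1 i.2) (w x)%:E
   <= (C ^+ m)%:E * \int[mu]_(x in D) F x)%E.
Proof.
move=> mF F0 t0; set FF := _ `&` _.
have C0 : 0 < C by rewrite (lt_le_trans ltr01)// (dw_ge1 dw).
have [/eqP->|] := boolP ((\int[mu]_(x in D) F x)%E == +oo%E).
  by rewrite gt0_muley ?leey// lte_fin exprn_gt0.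
rewrite -ltey => Foo.
have FFD i : FF i -> D i.1 /\ 0 < i.2 <= N by move=> [[? -> _] ->].
have [G [GF tG cov]] := vitali_covering DS FFD.
have GD i : G i -> D i.1 /\ 0 < i.2 by move=> /GF [[]].
have mB i : G i -> measurable (B i.1 i.2) /\ B i.1 i.2 `<=` D.
  by move=> /GD[? ?]; split; [exact: (measurable_qball DS)|exact: qball_subset].
have cG : countable G.
  apply: (countable_disjoint_pos mD mF F0 Foo mB tG) => i /GF [[Di i0 +] _].
  apply: le_lt_trans; apply: mule_ge0; first by rewrite lee_fin ltW.
  by apply: integral_ge0 => x [Dx _]; exact: weight_ge0.
have /countable_injP[f injf] := cG.
(* The ball of code [n] under the injection [f], or the empty set: this turns the countable
   subfamily into a sequence. [Bn'] holds the dilated balls. *)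
pose Bn n := \bigcup_(i in G `&` [set i | f i = n]) B i.1 i.2.
pose Bn' n := \bigcup_(i in G `&` [set i | f i = n]) B i.1 (2 ^+ m * i.2).
have mBn n : measurable (Bn n).
  by apply: (ds_union DS) => i [/GD].
have mBn' n : measurable (Bn' n).
  rewrite /Bn' (_ : bigcup _ _ = \bigcup_(i in
     (fun i => (i.1, 2 ^+ m * i.2)) @` (G `&` [set i | f i = n])) B i.1 i.2).
    apply: (ds_union DS) => _ [i [/GD[? ?] _] <-] /=; split=> //.
    by rewrite mulr_gt0// exprn_gt0.
  by rewrite bigcup_image.
have Bn_cases n : (Bn n = set0 /\ Bn' n = set0) \/ (exists i, [/\ G i,
     Bn n = B i.1 i.2 & Bn' n = B i.1 (2 ^+ m * i.2)]).
  have [[i [Gi fi]]|no] := pselect (exists i, G i /\ f i = n); [right|left].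
    have e : G `&` [set i | f i = n] = [set i].
      apply/seteqP; split=> [j [Gj fj]|_ ->//].
      by apply: injf; rewrite ?inE// fi.
    by exists i; split => //; rewrite /Bn /Bn' e bigcup_set1.
  have e : G `&` [set i | f i = n] = set0.
    by apply/seteqP; split=> // i Gi; apply: no; exists i.
  by rewrite /Bn /Bn' e !bigcup_set0.
have BnD n : Bn n `<=` D by move=> x [i _ []].
have Bn'D n : Bn' n `<=` D by move=> x [i _ []].
have UD : \bigcup_n Bn' n `<=` D by move=> x [n _ /Bn'D].
have UD0 : \bigcup_n Bn n `<=` D by move=> x [n _ /BnD].
have mU : measurable (\bigcup_n Bn' n) by exact: bigcup_measurable.
have step n : (t%:E * \int[mu]_(x in Bn' n) (w x)%:E <=
    (C ^+ m)%:E * \int[mu]_(x in Bn n) F x)%E.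
  have [[-> ->]|[i [Gi -> ->]]] := Bn_cases n.
    by rewrite !integral_set0 !mule0.
  have [Di i0] := GD _ Gi; have [[_ _ /ltW Fi] _] := GF _ Gi.
  apply: (@le_trans _ _ (t%:E * ((C ^+ m)%:E * \int[mu]_(y in B i.1 i.2) (w y)%:E))%E).
    by apply: lee_wpmul2l; [rewrite lee_fin ltW|exact: doubling_iter].
  rewrite muleCA; apply: lee_wpmul2l => //.
  by rewrite lee_fin exprn_ge0// ltW.
apply: (@le_trans _ _ (t%:E * \sum_(n <oo) \int[mu]_(x in Bn' n) (w x)%:E)%E).
  apply: lee_wpmul2l; first by rewrite lee_fin ltW.
  apply: (@le_trans _ _ (\int[mu]_(x in \bigcup_n Bn' n) (w x)%:E)%E).
    apply: ge0_subset_integral => //.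
    - by apply: (ds_union DS) => i /FFD [? /andP[]].
    - exact: weight_EFin_measurable.
    - by move=> x /UD; exact: weight_ge0.
    - move=> x [i FFi ix]; have [j Gj ij] := cov i FFi.
      exists (f j) => //; exists j => //.
      have [Dx jx] := ij x ix; split => //; apply: (lt_le_trans jx).
      by rewrite ler_pM2r ?covering_exponentP//; have [] := GD _ Gj.
  apply: ge0_integral_bigcup_le => //; first exact: weight_EFin_measurable.
  by move=> x /UD; exact: weight_ge0.
rewrite -nneseriesZl//; last first.
  move=> n _; apply: integral_ge0 => x /Bn'D; exact: weight_ge0.
apply: (@le_trans _ _ (\sum_(n <oo) (C ^+ m)%:E * \int[mu]_(x in Bn n) F x)%E).
  apply: lee_nneseries => // n _ _; apply: mule_ge0; first by rewrite lee_fin ltW.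
  by apply: integral_ge0 => x /Bn'D; exact: weight_ge0.
rewrite nneseriesZl//; last first.
  by move=> n _; apply: integral_ge0 => x /BnD; exact: F0.
apply: lee_wpmul2l; first by rewrite lee_fin exprn_ge0// ltW.
rewrite -ge0_integral_bigcup//.
- apply: ge0_subset_integral => //; exact: bigcup_measurable.
- by apply: measurable_funS mF.
- by move=> x /UD0; exact: F0.
- move=> i j _ _ [x [[k [Gk fk] kx] [l [Gl fl] lx]]].
  by rewrite -fk -fl (tG k l Gk Gl)//; exists x.
Qed.

(** The constant is independent of the bound on the radii, so continuity from below removes that
    bound. *)
Lemma weak_type (F : T -> \bar R) (t : R) :
  measurable_fun D F -> (forall x, D x -> (0 <= F x)%E) -> 0 < t ->
  (t%:E * \int[mu]_(x in \bigcup_(i in heavy_balls w F t) B i.1 i.2) (w x)%:E <=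
   (C ^+ m)%:E * \int[mu]_(x in D) F x)%E.
Proof.
move=> mF F0 t0.
pose Fn (n : nat) := heavy_balls w F t `&` [set i | i.2 <= n%:R].
pose E n := \bigcup_(i in Fn n) B i.1 i.2.
have -> : \bigcup_(i in heavy_balls w F t) B i.1 i.2 = \bigcup_n E n.
  apply/seteqP; split=> [x [i hi ix]|x [n _ [i [hi _] ix]]]; last by exists i.
  by exists (Num.truncn i.2).+1 => //; exists i => //; split => //; rewrite /= ltW// truncnS_gt.
have mE n : measurable (E n) by apply: (ds_union DS) => i [[]].
have ED n : E n `<=` D by move=> x [i _ []].
have ndE : nondecreasing_seq E.
  move=> n k nk; apply/subsetPset => x [i [hi iN] ix].
  by exists i => //; split => //; rewrite /= (le_trans iN)// ler_nat.
have mwE n : measurable_fun (E n) (EFin \o w) by exact: weight_EFin_measurable.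
have wE0 n x : E n x -> (0 <= (w x)%:E)%E by move=> /ED; exact: weight_ge0.
have cvgE := ge0_nondecreasing_set_cvg_integral (mu := mu) ndE mE mwE wE0.
rewrite -(cvg_lim _ cvgE)// -limeMl//; last first.
  by apply/cvg_ex; eexists; exact: cvgE.
apply: lime_le.
  apply: is_cvgeZl => //; by apply/cvg_ex; eexists; exact: cvgE.
by apply: nearW => n; exact: weak_type_bounded.
Qed.

Lemma lt_mean (W I : \bar R) (t : R) : (0 < W)%E -> W \is a fin_num ->
  (t%:E < W^-1 * I)%E = (t%:E * W < I)%E.
Proof.
case: W => // W W0 _; rewrite inver gt_eqF// lte_pdivlMl//.
by rewrite muleC.
Qed.

(** The supremum runs over uncentred balls, so it exceeds [t] at [x] exactly when some heavy ball
    contains [x]. Both measurability of [wmax] and the transfer of the weak type bound rest on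
    this. *)
Lemma wmax_level (F : T -> \bar R) (t : R) :
  D `&` [set x | (t%:E < wmax w F x)%E] =
  \bigcup_(i in heavy_balls w F t) B i.1 i.2.
Proof.
apply/seteqP; split => [x [Dx /= /ereal_sup_gt[_ [y [r [Dy r0 xB ->]]]]]|
    x [[y r] [/= Dy r0 h] xB]].
  rewrite lt_mean ?weight_ball_gt0 ?weight_ball_fin// => h.
  by exists (y, r).
split; first by case: xB.
rewrite -lt_mean ?weight_ball_gt0 ?weight_ball_fin// in h.
apply: (lt_le_trans h); apply: ereal_sup_ubound; by exists y, r.
Qed.

Lemma wmax_ge0 (v : T -> R) (F : T -> \bar R) x :
  (forall y, D y -> 0 <= v y) -> (forall y, D y -> (0 <= F y)%E) ->
  D x -> (0 <= wmax v F x)%E.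
Proof.
move=> v0 F0 Dx; apply: (@le_trans _ _
   ((\int[mu]_(z in B x 1) (v z)%:E)^-1 * \int[mu]_(z in B x 1) F z)%E).
  apply: mule_ge0.
    by rewrite inve_ge0; apply: integral_ge0 => y [Dy _]; rewrite lee_fin v0.
  by apply: integral_ge0 => y [Dy _]; exact: F0.
by apply: ereal_sup_ubound; exists x, 1; split => //; exact: (qball_center DS).
Qed.

Lemma measurable_wmax (F : T -> \bar R) : measurable_fun D (wmax w F).
Proof.
apply: (measurability _ (ErealGenOInfty.measurableE R)) => // _ [_ [t ->] <-].
rewrite (_ : _ `&` _ = D `&` [set x | (t%:E < wmax w F x)%E]).
  by rewrite wmax_level; apply: (ds_union DS) => i [].
by apply/seteqP; split=> x /=; rewrite in_itv/= andbT.
Qed.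

(* The part of F below the height t/2 cannot make a w-mean exceed t by itself. *)
Definition high_part (w : T -> R) (F : T -> \bar R) (t : R) (x : T) : \bar R :=
  if ((t * w x)%:E < F x)%E then F x else 0%E.

Lemma measurable_high_part (F : T -> \bar R) (t : R) :
  measurable_fun D F -> measurable_fun D (high_part w F t).
Proof.
move=> mF; apply: measurable_fun_if => //.
- apply: measurable_fun_lte => //; apply/measurable_EFinP.
  by apply: measurable_funM => //; exact: dw_measurable dw.
- apply: measurable_funS mF => //; exact: subIsetl.
Qed.

Lemma high_part_ge0 (F : T -> \bar R) (t : R) x :
  (0 <= F x)%E -> (0 <= high_part w F t x)%E.
Proof. by rewrite /high_part; case: ifP. Qed.

(** What the high part discards is at most [(t/2) w], so a ball with [w]-mean of [F] above [t] has
    [w]-mean of the high part above [t/2]. Only the high part on the right makes the sum over levels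
    converge. *)
Lemma weak_type_high (F : T -> \bar R) (t : R) :
  measurable_fun D F -> (forall x, D x -> (0 <= F x)%E) -> 0 < t ->
  (t%:E * \int[mu]_(x in D `&` [set x | (t%:E < wmax w F x)%E]) (w x)%:E <=
   (2 * C ^+ m)%:E * \int[mu]_(x in D) high_part w F (t / 2) x)%E.
Proof.
move=> mF F0 t0; have t20 : 0 < t / 2 by rewrite divr_gt0.
have mH := measurable_high_part (t / 2) mF.
have H0 x : D x -> (0 <= high_part w F (t / 2) x)%E.
  by move=> /F0; exact: high_part_ge0.
rewrite wmax_level EFinM -muleA.
apply: (@le_trans _ _ (2%:E * ((t / 2)%:E * \int[mu]_(x in
    \bigcup_(i in heavy_balls w (high_part w F (t / 2)) (t / 2)) B i.1 i.2) (w x)%:E))%E).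
  rewrite muleA -EFinM (_ : 2 * (t / 2) = t); last by rewrite mulrC divfK.
  apply: lee_wpmul2l; first by rewrite lee_fin ltW.
  apply: ge0_subset_integral.
  - by apply: (ds_union DS) => i [].
  - by apply: (ds_union DS) => i [].
  - apply: weight_EFin_measurable; first by apply: (ds_union DS) => i [].
    by move=> x [i _ []].
  - by move=> x [i _ [Dx _]]; exact: weight_ge0.
  - move=> x [i [Di i0 hi] ix]; exists i => //; split => //.
    have mB := measurable_qball DS Di i0.
    have BD : B i.1 i.2 `<=` D by exact: qball_subset.
    have Wfin := weight_ball_fin Di i0.
    have mwB : measurable_fun (B i.1 i.2) (EFin \o w) by exact: weight_EFin_measurable.
    have : (\int[mu]_(y in B i.1 i.2) F y <=
            \int[mu]_(y in B i.1 i.2) high_part w F (t / 2) y +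
            (t / 2)%:E * \int[mu]_(y in B i.1 i.2) (w y)%:E)%E.
      rewrite -ge0_integralZl_EFin//; last 2 first.
      - by move=> y /BD; exact: weight_ge0.
      - exact: ltW.
      rewrite -ge0_integralD//; last 4 first.
      - by move=> y /BD; exact: H0.
      - by apply: measurable_funS mH.
      - by move=> y /BD Dy; rewrite mule_ge0 ?weight_ge0// lee_fin ltW.
      - by apply: measurable_funeM.
      apply: ge0_le_integral => //.
      - by move=> y /BD; exact: F0.
      - by apply: measurable_funS mF.
      - apply: emeasurable_funD; first by apply: measurable_funS mH.
        exact: measurable_funeM.
      - move=> y /BD Dy; rewrite /high_part; case: ifPn => [_|].
          by rewrite leeDl// mule_ge0 ?weight_ge0// lee_fin ltW.
        by rewrite -leNgt add0e EFinM.
    move=> /(lt_le_trans hi).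
    rewrite {1}(splitr t) EFinD ge0_muleDl ?lee_fin ?ltW//.
    by rewrite lteD2rE// fin_numM.
by apply: lee_wpmul2l => //; exact: weak_type.
Qed.

(** Factor by factor: [2^s] for moving from a level to the next one up, [2 C^m] from the weak type
    bound, and the geometric sum over the levels below [2 F / w], that last 2 giving [2^(s-1)]. *)
Definition maximal_const (s : R) : R :=
  2 `^ s * (2 * C ^+ m) * (geometric_const (s - 1) * 2 `^ (s - 1)).

Lemma maximal_const_ge0 (s : R) : 0 <= C -> 1 < s -> 0 <= maximal_const s.
Proof.
move=> C0 s1.
have g0 : 0 <= geometric_const (s - 1) by rewrite geometric_const_ge0// subr_gt0.
apply: mulr_ge0; last by rewrite mulr_ge0 ?powR_ge0.
by rewrite !mulr_ge0 ?powR_ge0 ?exprn_ge0.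
Qed.

(** Where [F x = a] is finite, the level [t = 2^k e] contributes exactly when [t < 2 a / w x], and
    then a multiple of [a t^(s-1)]; [dyadic_upper] sums these to a multiple of
    [a (a / w x)^(s-1)]. *)
Lemma high_part_sum (F : T -> \bar R) (s e : R) (N : nat) x :
  1 < s -> 0 < e -> D x -> (0 <= F x)%E ->
  (\sum_(k < N) ((2 ^+ k.+1 * e) `^ s / (2 ^+ k * e) * (2 * C ^+ m))%:E *
      high_part w F (2 ^+ k * e / 2) x <=
   (maximal_const s)%:E * (F x `^ s * ((w x) `^ (1 - s))%:E))%E.
Proof.
move=> s1 e0 Dx F0; have w0 := dw_gt0 dw Dx.
have C0 : 0 < C by rewrite (lt_le_trans ltr01)// (dw_ge1 dw).
have s10 : 0 < s - 1 by rewrite subr_gt0.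
have K0 : 0 < maximal_const s.
  rewrite /maximal_const; do !apply: mulr_gt0 => //; rewrite ?powR_gt0 ?exprn_gt0//.
  by rewrite invr_gt0 subr_gt0 powR2_gt1.
case Fx : (F x) F0 => [a| |]//; last first.
  rewrite poweRyr ?gt_eqF ?(lt_trans ltr01)// gt0_mulye ?lte_fin ?powR_gt0//.
  by move=> _; rewrite gt0_muley ?lte_fin// leey.
rewrite lee_fin => a0.
have tk0 k : 0 < 2 ^+ k * e by rewrite mulr_gt0 ?exprn_gt0.
rewrite (eq_bigr (fun k : 'I_N => (2 `^ s * (2 * C ^+ m) * a *
    (if 2 ^+ k * e < 2 * a / w x then (2 ^+ k * e) `^ (s - 1) else 0))%:E)).
  rewrite sumEFin poweR_EFin -!EFinM lee_fin -mulr_sumr.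
  have a2 : 0 <= 2 * a / w x by rewrite divr_ge0 ?mulr_ge0// ltW.
  apply: (@le_trans _ _ (2 `^ s * (2 * C ^+ m) * a *
     (geometric_const (s - 1) * (2 * a / w x) `^ (s - 1)))).
    apply: ler_wpM2l; last exact: dyadic_upper.
    by rewrite !mulr_ge0 ?powR_ge0 ?exprn_ge0// ltW.
  rewrite powRM ?mulr_ge0 ?invr_ge0 ?(ltW w0)// (powRM (s - 1))//.
  rewrite -(mulr_powRB1 a0 (lt_trans ltr01 s1)) -(powR_inv1 (ltW w0)) -powRrM mulN1r opprB.
  by rewrite /maximal_const le_eqVlt; apply/orP; left; apply/eqP; ring.
move=> k _; rewrite /high_part Fx lte_fin.
rewrite (_ : (2 ^+ k * e / 2 * w x < a) = (2 ^+ k * e < 2 * a / w x)); last first.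
  by rewrite ltr_pdivlMr// (mulrC 2 a) -ltr_pdivrMr// mulrAC.
case: ifPn => _; last by rewrite mule0 mulr0.
rewrite -EFinM; congr (_%:E).
have := tk0 k; rewrite (_ : 2 ^+ k.+1 * e = 2 * (2 ^+ k * e)); last first.
  by rewrite exprS mulrA.
set X := 2 ^+ k * e => X0.
rewrite powRM ?(ltW X0)// -(mulr_powRB1 (ltW X0) (lt_trans ltr01 s1)).
by field; rewrite gt_eqF.
Qed.

(** Marcinkiewicz interpolation between the weak (1,1) bound and the trivial L^infinity bound, with
    dyadic sums for the integral over heights. [wmax] is first cut to heights between [2^-n] and
    [2^(n+1)], which leaves finitely many levels. *)
Theorem weighted_maximal_inequality (F : T -> \bar R) (s : R) : 1 < s ->
  measurable_fun D F -> (forall x, D x -> (0 <= F x)%E) ->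
  (\int[mu]_(x in D) (wmax w F x `^ s * (w x)%:E) <=
   (maximal_const s)%:E * \int[mu]_(x in D) (F x `^ s * ((w x) `^ (1 - s))%:E))%E.
Proof.
move=> s1 mF F0; have s0 : 0 < s by rewrite (lt_trans ltr01).
have C0 : 0 < C by rewrite (lt_le_trans ltr01)// (dw_ge1 dw).
have mM := measurable_wmax F.
have M0 x : D x -> (0 <= wmax w F x)%E.
  by apply: wmax_ge0 => // y Dy; rewrite ltW// (dw_gt0 dw).
pose e n : R := 2 ^- n.
have e0 n : 0 < e n by rewrite invr_gt0 exprn_gt0.
pose g n (a : \bar R) := if (a <= (e n)%:E)%E then 0%E else
  mine a (2 ^+ (n + n).+1 * e n)%:E.
have gE n : (2 ^+ (n + n).+1 * e n) = 2 ^+ n.+1.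
  by rewrite /e -addSn exprD mulfK// expf_neq0.
have g0 n a : (0 <= a)%E -> (0 <= g n a)%E.
  move=> a0; rewrite /g; case: ifPn => // _; rewrite le_min a0 lee_fin.
  by rewrite mulr_ge0 ?exprn_ge0// ltW.
have mg n : measurable_fun D (fun x => g n (wmax w F x)).
  apply: measurable_fun_if => //.
  - exact: measurable_fun_lee.
  - apply: measurable_mine => //; apply: measurable_funS mM => //; exact: subIsetl.
apply: (@integral_le_sup _ _ _ _ _ (fun n x => g n (wmax w F x) `^ s * (w x)%:E)%E) => //.
- move=> n; apply: emeasurable_funM; last exact: weight_EFin_measurable.
  exact: (measurableT_comp (measurable_poweR s)).
- apply: emeasurable_funM; last exact: weight_EFin_measurable.
  exact: (measurableT_comp (measurable_poweR s)).
- by move=> n x Dx; rewrite mule_ge0 ?poweR_ge0// weight_ge0.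
- by move=> x Dx; rewrite mule_ge0 ?poweR_ge0// weight_ge0.
- move=> n x Dx; apply: lee_wpmul2r; first exact: weight_ge0.
  apply: le_poweR; [exact: ltW|exact: g0 (M0 _ Dx)|].
  have een : ((e n.+1)%:E <= (e n)%:E)%E.
    by rewrite lee_fin lef_pV2 ?posrE ?exprn_gt0// ler_eXn2l ?ltr1n.
  have := g0 n.+1 _ (M0 _ Dx); rewrite /g !gE; case: ifPn => [en _|].
    by rewrite (le_trans en een).
  rewrite -ltNge => en gn0; case: ifPn => // _.
  by rewrite le_min !ge_min lexx/= lee_fin ler_eXn2l ?ltr1n// leqnSn orbT.
- move=> x Dx; have wx := dw_gt0 dw Dx.
  case Mx : (wmax w F x) (M0 _ Dx) => [a| |]// a0.
    apply: ereal_sup_ubound; have [->|an0] := eqVneq a 0.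
      by exists 0%N => //=; rewrite /g ifT// lee_fin ltW.
    have {}a0 : 0 < a by rewrite lt_def an0.
    (* Large enough for both ends of the cut: [2^-n < a] and [a <= 2^(n+1)]. *)
    pose n := (Num.truncn a + Num.truncn a^-1).+1.
    exists n => //=; rewrite /g ifF.
      rewrite (min_idPl _)// gE lee_fin ltW// (lt_le_trans (truncnS_gt _))//.
      rewrite -natrX ler_nat (leq_trans _ (ltnW (ltn_expl _ _)))//.
      by rewrite /n ltnS leqW// leq_addr.
    apply/negbTE; rewrite -ltNge lte_fin /e invf_plt ?posrE ?exprn_gt0//.
    rewrite (lt_le_trans (truncnS_gt _))// -natrX ler_nat.
    by rewrite (leq_trans _ (ltnW (ltn_expl _ _)))// /n ltnS leq_addl.
  (* Where [wmax] is infinite its cut is [2^(n+1)]; as [w x > 0] and [s > 1], the approximations are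
     unbounded. *)
  rewrite [leRHS](_ : _ = +oo%E) ?leey//.
  apply/eqyP => A A0; pose n := Num.truncn (A / w x).
  apply: (@le_trans _ _ (g n +oo%E `^ s * (w x)%:E)%E); last first.
    by apply: ereal_sup_ubound; exists n.
  have -> : g n +oo%E = (2 ^+ n.+1)%:E by rewrite /g leye_eq/= gE (min_idPr _) ?leey.
  rewrite poweR_EFin -EFinM lee_fin.
  rewrite -ler_pdivrMr//; apply: (@le_trans _ _ (2 ^+ n.+1)).
    rewrite ltW// (lt_le_trans (truncnS_gt _))// -natrX ler_nat.
    by rewrite ltnW// ltn_expl.
  apply: le1r_powR; last exact: ltW.
  by rewrite exprn_ege1// ler1n.
- move=> n.
  pose E k := [set x | ((2 ^+ k * e n)%:E < wmax w F x)%E].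
  pose a k := (2 ^+ k.+1 * e n) `^ s.
  have mE k : measurable (D `&` E k).
    by rewrite /E wmax_level; apply: (ds_union DS) => i [].
  have tk0 k : 0 < 2 ^+ k * e n by rewrite mulr_gt0 ?exprn_gt0.
  have wE0 k x : D x -> (0 <= ((EFin \o w) \_ (E k)) x)%E.
    by move=> Dx; rewrite patchE; case: ifPn => // _; exact: weight_ge0.
  have mEk k : measurable (E k `&` D) by rewrite setIC.
  have mwE k : measurable_fun D ((EFin \o w) \_ (E k)).
    rewrite [X in measurable_fun _ X](_ : _ = fun x =>
      if ((2 ^+ k * e n)%:E < wmax w F x)%E then (w x)%:E else 0%E).
      apply: measurable_fun_if => //.
      - exact: measurable_fun_lte.
      - by apply: weight_EFin_measurable => //; rewrite (_ : _ `&` _ = D `&` E k).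
    apply/funext => x; rewrite patchE/=; case: ifPn => [/set_mem -> //|].
    by rewrite notin_setE => /negP/negbTE ->.
  apply: (@le_trans _ _ (\int[mu]_(x in D) \sum_(k < (n + n).+1)
      (a k)%:E * ((EFin \o w) \_ (E k)) x)%E).
    apply: ge0_le_integral => //.
    - by move=> x Dx; rewrite mule_ge0 ?poweR_ge0// weight_ge0.
    - apply: emeasurable_funM; last exact: weight_EFin_measurable.
      exact: (measurableT_comp (measurable_poweR s)).
    - by apply: emeasurable_sum => k; exact: measurable_funeM.
    - move=> x Dx; have := dyadic_lower (n + n) s0 (e0 n) (M0 _ Dx).
      move=> /(lee_wpmul2r (weight_ge0 Dx)) /le_trans; apply.
      rewrite ge0_sume_distrl; last first.
        by move=> k _; case: ifPn => // _; rewrite lee_fin powR_ge0.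
      apply: lee_sum => k _; rewrite patchE /E.
      case: ifPn => Ek; first by rewrite mem_set.
      by rewrite memNset ?mul0e ?mule0//; exact/negP.
  rewrite ge0_integral_sum//; last 2 first.
  - by move=> k; exact: measurable_funeM.
  - by move=> k x Dx; rewrite mule_ge0 ?wE0// lee_fin powR_ge0.
  (* [b k] is [a k] divided by the level and multiplied by the weak type constant, so that the weak
     bound on the level set [E k] turns the sum over [a k] into one over high parts. *)
  pose b k := (2 ^+ k.+1 * e n) `^ s / (2 ^+ k * e n) * (2 * C ^+ m).
  have b0 k : 0 <= b k by rewrite mulr_ge0 ?divr_ge0 ?powR_ge0 ?mulr_ge0 ?exprn_ge0// ltW.
  have H0 k x : D x -> (0 <= high_part w F (2 ^+ k * e n / 2) x)%E.
    by move=> /F0; exact: high_part_ge0.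
  have mH k := measurable_high_part (2 ^+ k * e n / 2) mF.
  apply: (@le_trans _ _ (\int[mu]_(x in D) \sum_(k < (n + n).+1)
      (b k)%:E * high_part w F (2 ^+ k * e n / 2) x)%E).
    rewrite ge0_integral_sum//; last 2 first.
    - by move=> k; exact: measurable_funeM.
    - by move=> k x Dx; rewrite mule_ge0 ?H0// lee_fin b0.
    apply: lee_sum => k _.
    rewrite ge0_integralZl_EFin ?powR_ge0//; last by move=> x; exact: wE0.
    rewrite ge0_integralZl_EFin ?b0//; last by move=> x; exact: H0.
    have := weak_type_high mF F0 (tk0 k).
    have ab : a k = (2 ^+ k.+1 * e n) `^ s / (2 ^+ k * e n) * (2 ^+ k * e n).
      by rewrite divfK// gt_eqF.
    rewrite -integral_mkcondr ab /b !(EFinM (_ / _)) -!muleA.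
    by move=> h; apply: lee_wpmul2l => //; rewrite lee_fin divr_ge0 ?powR_ge0// ltW.
  have mR : measurable_fun D (fun x => (F x `^ s * ((w x) `^ (1 - s))%:E)%E).
    apply: emeasurable_funM; first exact: (measurableT_comp (measurable_poweR s)).
    apply/measurable_EFinP; apply: (measurableT_comp (measurable_powR (1 - s))).
    exact: dw_measurable dw.
  have R0 x : D x -> (0 <= F x `^ s * ((w x) `^ (1 - s))%:E)%E.
    by move=> Dx; rewrite mule_ge0 ?poweR_ge0// lee_fin powR_ge0.
  rewrite -ge0_integralZl_EFin//; last by rewrite maximal_const_ge0// ltW.
  apply: ge0_le_integral => //.
  - by move=> x Dx; apply: sume_ge0 => k _; rewrite mule_ge0 ?H0// lee_fin b0.
  - by apply: emeasurable_sum => k; exact: measurable_funeM.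
  - exact: measurable_funeM.
  - by move=> x Dx; apply: high_part_sum => //; exact: F0.
Qed.

End WeightedMaximal.

(** * Muckenhoupt weights *)

Lemma dual_exponent_gt1 (R : realType) (p : R) : 1 < p -> 1 < p / (p - 1).
Proof. by move=> p1; rewrite ltr_pdivlMr ?subr_gt0// mul1r gtrBl. Qed.

Section Muckenhoupt.
Context (R : realType) (d : measure_display) (T : measurableType d).
Context (D : set T) (rho : T -> T -> R) (mu : {measure set T -> \bar R}).
Context (K1 K2 : R) (DS : doubling_space D rho mu K1 K2).
Local Notation B := (qball D rho).

Definition dual_weight (p : R) (w : T -> R) (x : T) : R :=
  w x `^ (- (p - 1)^-1).

(** The A_p inequality multiplied through by [mu (B x r) ^ p], which avoids division in the extended
    reals; [K] is any upper bound. Strict positivity keeps the dual weight a true real power. *)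
Record muckenhoupt (p K : R) (w : T -> R) : Prop := MuckenhouptWeight {
  mw_gt0 : forall x, D x -> 0 < w x ;
  mw_measurable : measurable_fun D w ;
  mw_const_gt0 : 0 < K ;
  mw_bound : forall x r, D x -> 0 < r ->
    (\int[mu]_(y in B x r) (w y)%:E *
     (\int[mu]_(y in B x r) (dual_weight p w y)%:E) `^ (p - 1) <=
     K%:E * mu (B x r) `^ p)%E }.

Let mD : measurable D. Proof. exact: ds_measurable DS. Qed.

Lemma dual_weight_gt0 p w x : 0 < w x -> 0 < dual_weight p w x.
Proof. exact: powR_gt0. Qed.

Lemma measurable_dual_weight p w :
  measurable_fun D w -> measurable_fun D (dual_weight p w).
Proof. exact: (measurableT_comp (measurable_powR _)). Qed.

Lemma dual_weightK p w x : 1 < p -> 0 < w x ->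
  dual_weight (p / (p - 1)) (dual_weight p w) x = w x.
Proof.
move=> p1 w0; have p10 : p - 1 != 0 by rewrite subr_eq0 gt_eqF.
rewrite /dual_weight -powRrM (_ : _ * _ = 1) ?powRr1// ?ltW//.
rewrite (_ : p / (p - 1) - 1 = (p - 1)^-1); last by field.
by rewrite invrK mulrNN mulVf.
Qed.

Lemma pos_weight_ball_gt0 (v : T -> R) x r : (forall y, D y -> 0 < v y) ->
  measurable_fun D v -> D x -> 0 < r -> (0 < \int[mu]_(y in B x r) (v y)%:E)%E.
Proof.
move=> v0 mv Dx r0; apply: ge0_integral_gt0 (ds_gt0 DS Dx r0).
- exact: (measurable_qball DS).
- apply/measurable_EFinP; apply: measurable_funS mv => //; exact: qball_subset.
- by move=> y [Dy _]; rewrite lte_fin v0.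
Qed.

Lemma ball_fin x r : D x -> 0 < r -> exists2 a : R, 0 < a & mu (B x r) = a%:E.
Proof.
move=> Dx r0; have := ds_gt0 DS Dx r0; have := ds_lty DS Dx r0.
by case: (mu (B x r)) => // a _; rewrite lte_fin => a0; exists a.
Qed.

Section FixedWeight.
Context (p K : R) (w : T -> R) (p1 : 1 < p) (mw : muckenhoupt p K w).
Local Notation s := (dual_weight p w).

Let p10 : 0 < p - 1. Proof. by rewrite subr_gt0. Qed.
Let p0 : 0 < p. Proof. exact: lt_trans p1. Qed.

Let s0 x : D x -> 0 < s x.
Proof. by move=> Dx; rewrite dual_weight_gt0// (mw_gt0 mw). Qed.

Let ms : measurable_fun D s.
Proof. by apply: measurable_dual_weight; exact: mw_measurable mw. Qed.

(** Both integrals are positive, so the finite bound on the product forces each to be finite; ball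
    estimates can then be carried out in [R]. *)
Lemma muckenhoupt_ball x r : D x -> 0 < r -> exists a b m, [/\ 0 < a, 0 < b, 0 < m &
  [/\ (\int[mu]_(y in B x r) (w y)%:E)%E = a%:E,
      (\int[mu]_(y in B x r) (s y)%:E)%E = b%:E,
      mu (B x r) = m%:E & a * b `^ (p - 1) <= K * m `^ p]].
Proof.
move=> Dx r0; have [m m0 me] := ball_fin Dx r0.
have := mw_bound mw Dx r0; rewrite me poweR_EFin -EFinM.
have w0 := pos_weight_ball_gt0 (mw_gt0 mw) (mw_measurable mw) Dx r0.
have s0' := pos_weight_ball_gt0 s0 ms Dx r0.
move: w0 s0'; case: (\int[mu]_(y in B x r) (w y)%:E)%E => [a| |]//;
  case: (\int[mu]_(y in B x r) (s y)%:E)%E => [b| |]//; rewrite ?lte_fin => a0 b0.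
- by rewrite poweR_EFin -EFinM lee_fin => h; exists a, b, m; split.
- by rewrite poweRyr ?gt_eqF// gt0_muley ?lte_fin.
- by rewrite gt0_mulye ?poweR_gt0.
- by rewrite poweRyr ?gt_eqF// gt0_muley ?lte_fin.
Qed.

(** Raising the A_p inequality to the power [1/(p-1)] exchanges the two integrals, and the dual of
    [s] is [w] again. *)
Lemma muckenhoupt_dual :
  muckenhoupt (p / (p - 1)) (K `^ (p - 1)^-1) s.
Proof.
have p1n : p - 1 != 0 by rewrite gt_eqF.
split=> //; first by rewrite powR_gt0// (mw_const_gt0 mw).
move=> x r Dx r0; have [a [b [m [a0 b0 m0 [ae be me h]]]]] := muckenhoupt_ball Dx r0.
rewrite be me (_ : (\int[mu]_(y in B x r) _)%E = a%:E); last first.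
  rewrite -ae; apply: eq_integral => y /set_mem [Dy _].
  by rewrite dual_weightK// (mw_gt0 mw).
rewrite (_ : p / (p - 1) - 1 = (p - 1)^-1); last by field.
rewrite !poweR_EFin -!EFinM lee_fin.
have K0 := mw_const_gt0 mw.
rewrite (powRrM m) -powRM ?powR_ge0 ?(ltW K0)//.
apply: (@le_trans _ _ ((a * b `^ (p - 1)) `^ (p - 1)^-1)).
  rewrite (powRM _ (ltW a0)) ?powR_ge0// -powRrM mulfV// powRr1 ?(ltW b0)//.
  by rewrite mulrC.
by rewrite ge0_ler_powR ?nnegrE ?mulr_ge0 ?powR_ge0 ?invr_ge0// ltW.
Qed.

(** [K2^q] is the doubling of [mu], [2^q] the loss in [muckenhoupt_lower]; the maximum provides the
    normalisation [dw_ge1]. *)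
Definition weight_doubling_const (K2 q L : R) : R := Num.max 1 (L * (2 * K2) `^ q).

Lemma weight_doubling_const_ge0 (k t L : R) : 0 <= weight_doubling_const k t L.
Proof. by rewrite le_max ler01. Qed.

(** Hölder's inequality up to the factor [2^p], obtained by integrating
    [1 <= l w + (l w)^(-1/(p-1))], which holds because one of the two terms is at least 1. *)
Lemma muckenhoupt_lower x r (a b m : R) : D x -> 0 < r -> 0 < b -> 0 < m ->
  (\int[mu]_(y in B x r) (w y)%:E)%E = a%:E ->
  (\int[mu]_(y in B x r) (s y)%:E)%E = b%:E ->
  mu (B x r) = m%:E ->
  m `^ p <= 2 `^ p * b `^ (p - 1) * a.
Proof.
move=> Dx r0 b0 m0 ae be me; have p1n : p - 1 != 0 by rewrite gt_eqF.
have mB := measurable_qball DS Dx r0.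
have BD : B x r `<=` D by exact: qball_subset.
(* Chosen so that the second term integrates to exactly [m / 2] and can be subtracted from the left
   side. *)
pose l := (2 * b / m) `^ (p - 1).
have l0 : 0 < l by rewrite powR_gt0// divr_gt0// mulr_gt0.
pose l' := l `^ (- (p - 1)^-1).
have l'E : l' = m / (2 * b).
  rewrite /l' /l -powRrM mulrN mulfV// powR_inv1 ?invf_div//.
  by rewrite divr_ge0 ?mulr_ge0// ltW.
have mwB : measurable_fun (B x r) (EFin \o w).
  by apply/measurable_EFinP; apply: measurable_funS (mw_measurable mw).
have msB : measurable_fun (B x r) (EFin \o s).
  by apply/measurable_EFinP; apply: measurable_funS ms.
have : (m%:E <= l%:E * a%:E + l'%:E * b%:E)%E.
  rewrite -me -ae -be -(mul1e (mu (B x r))) -integral_cst//.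
  rewrite -ge0_integralZl_EFin//; last 2 first.
  - by move=> y [Dy _]; rewrite lee_fin ltW// (mw_gt0 mw).
  - exact: ltW.
  rewrite -ge0_integralZl_EFin//; last 2 first.
  - by move=> y [Dy _]; rewrite lee_fin ltW// s0.
  - exact: powR_ge0.
  rewrite -ge0_integralD//; last 4 first.
  - by move=> y [Dy _]; rewrite -EFinM lee_fin mulr_ge0// ltW// (mw_gt0 mw).
  - exact: measurable_funeM.
  - by move=> y [Dy _]; rewrite -EFinM lee_fin mulr_ge0 ?powR_ge0.
  - exact: measurable_funeM.
  apply: ge0_le_integral => //.
  - apply: emeasurable_funD; exact: measurable_funeM.
  - move=> y [Dy _]; have wy := mw_gt0 mw Dy.
    rewrite -!EFinM -EFinD lee_fin /= /dual_weight -powRM ?(ltW l0) ?(ltW wy)//.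
    have [lw|lw] := leP 1 (l * w y).
      by rewrite (le_trans lw)// lerDl powR_ge0.
    rewrite powRN; apply: (@le_trans _ _ ((l * w y) `^ (p - 1)^-1)^-1); last first.
      by rewrite lerDr mulr_ge0// ltW.
    rewrite invf_ge1 ?powR_gt0 ?mulr_gt0//.
    rewrite [leRHS](_ : _ = (l * w y) `^ 0); last by rewrite powRr0.
    by apply: ger_powR; rewrite ?mulr_gt0 ?(ltW lw)//= invr_ge0 ltW.
rewrite -!EFinM -EFinD lee_fin l'E => h.
have {}h : m / 2 <= l * a.
  move: h; rewrite (_ : m / (2 * b) * b = m / 2); last by field; rewrite gt_eqF.
  by lra.
have mp : m `^ p = m * m `^ (p - 1) by rewrite mulr_powRB1// ltW.
have tp : 2 `^ p = 2 * 2 `^ (p - 1) :> R by rewrite mulr_powRB1.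
have lE : l * m `^ (p - 1) = 2 `^ (p - 1) * b `^ (p - 1).
  by rewrite /l -!powRM ?divfK ?gt_eqF ?(ltW b0) ?(ltW m0)// divr_ge0 ?mulr_ge0// ltW.
rewrite mp tp; apply: (@le_trans _ _ (2 * (l * a) * m `^ (p - 1))).
  by rewrite ler_wpM2r ?powR_ge0//; lra.
by rewrite -mulrA (mulrAC l) lE le_eqVlt; apply/orP; left; apply/eqP; ring.
Qed.

(** The A_p bound on the large ball is compared with [muckenhoupt_lower] on the small one. The
    [s]-integral of the small ball is at most that of the large ball, and its power cancels. *)
Lemma muckenhoupt_doubling :
  doubling_weight D rho mu (weight_doubling_const K2 p K) w.
Proof.
split.
- exact: mw_gt0 mw.
- exact: mw_measurable mw.
- by rewrite le_max lexx.
- move=> x r Dx r0; have [a [b [m [_ _ _ [-> _ _ _]]]]] := muckenhoupt_ball Dx r0.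
  by rewrite ltry.
move=> x r Dx r0; have r20 : 0 < 2 * r by rewrite mulr_gt0.
have [a [b [m [a0 b0 m0 [ae be me h]]]]] := muckenhoupt_ball Dx r0.
have [A [S [M [A0 S0 M0 [Ae Se Me H]]]]] := muckenhoupt_ball Dx r20.
have low := muckenhoupt_lower Dx r0 b0 m0 ae be me.
have bS : b <= S.
  rewrite -lee_fin -be -Se; apply: ge0_subset_integral.
  - exact: (measurable_qball DS).
  - exact: (measurable_qball DS).
  - apply/measurable_EFinP; apply: measurable_funS ms => //; exact: qball_subset.
  - by move=> y [Dy _]; rewrite lee_fin ltW// s0.
  - by move=> y [Dy yr]; split => //; apply: (lt_le_trans yr); rewrite ler_peMl ?(ltW r0)// ler1n.
have Mm : M <= K2 * m by rewrite -lee_fin EFinM -me -Me (ds_double DS).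
have K0 := mw_const_gt0 mw.
have K20 : 0 < K2 by rewrite (lt_le_trans ltr01)// (ds_K2 DS).
rewrite ae Ae -EFinM lee_fin.
apply: (@le_trans _ _ (K * (2 * K2) `^ p * a)); last first.
  by rewrite ler_pM2r// le_max lexx orbT.
rewrite -(ler_pM2r (powR_gt0 (p - 1) S0)); apply: (le_trans H).
apply: (@le_trans _ _ (K * (K2 `^ p * m `^ p))).
  rewrite ler_pM2l// -powRM ?(ltW K20) ?(ltW m0)//.
  by rewrite ge0_ler_powR ?nnegrE ?mulr_ge0// ltW.
apply: (@le_trans _ _ (K * (K2 `^ p * (2 `^ p * b `^ (p - 1) * a)))).
  by rewrite ler_pM2l// ler_pM2l ?powR_gt0.
rewrite (powRM _ _ (ltW K20))//.
apply: (@le_trans _ _ (K * (K2 `^ p * (2 `^ p * S `^ (p - 1) * a)))).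
  rewrite ler_pM2l// ler_pM2l ?powR_gt0// ler_pM2r// ler_pM2l ?powR_gt0//.
  by rewrite ge0_ler_powR ?nnegrE// ltW.
by rewrite le_eqVlt; apply/orP; left; apply/eqP; ring.
Qed.


End FixedWeight.

Lemma le_poweR_inv (x y : \bar R) (r : R) : 0 < r -> (0 <= x)%E -> (0 <= y)%E ->
  (x `^ r <= y)%E = (x <= y `^ r^-1)%E.
Proof.
move=> r0 x0 y0; have rn : r != 0 by rewrite gt_eqF.
apply/idP/idP => h.
  rewrite -(poweRe1 x0) -(mulfV rn) poweRrM.
  by apply: le_poweR => //; rewrite ?poweR_ge0 ?invr_ge0 ?(ltW r0).
rewrite -(poweRe1 y0) -(mulVf rn) poweRrM.
by apply: le_poweR => //; rewrite ?poweR_ge0 ?(ltW r0).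
Qed.

Lemma powRV (x r : R) : 0 <= x -> x^-1 `^ r = (x `^ r)^-1.
Proof. by move=> x0; rewrite -powR_inv1// -powRrM mulN1r powRN. Qed.

Local Notation wmax := (wmax D rho mu).

Lemma integral_cst1 (A : set T) : measurable A ->
  (\int[mu]_(x in A) (cst 1 x : R)%:E = mu A)%E.
Proof. by move=> mA; have := integral_cst mu mA 1%E; rewrite mul1e. Qed.

Lemma doubling_weight1 : doubling_weight D rho mu K2 (cst 1).
Proof.
split=> //; first exact: ds_K2 DS.
- by move=> x r Dx r0; rewrite integral_cst1 ?(ds_lty DS)//; exact: (measurable_qball DS).
- move=> x r Dx r0; rewrite !integral_cst1 ?(ds_double DS)//;
    by apply: (measurable_qball DS) => //; rewrite mulr_gt0.
Qed.

(** * Lerner's proof of the Muckenhoupt inequality *)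

Section Lerner.
Context (p K : R) (w : T -> R) (p1 : 1 < p) (mw : muckenhoupt p K w).
Local Notation s := (dual_weight p w).
Local Notation q := (p / (p - 1)).

Let p10 : 0 < p - 1. Proof. by rewrite subr_gt0. Qed.
Let p0 : 0 < p. Proof. exact: lt_trans p1. Qed.
Let q1 : 1 < q. Proof. exact: dual_exponent_gt1. Qed.

Let dw := muckenhoupt_doubling p1 mw.
Let ds := muckenhoupt_doubling q1 (muckenhoupt_dual p1 mw).

Let w0 x : D x -> 0 < w x. Proof. by move=> Dx; exact: (mw_gt0 mw Dx). Qed.
Let s0 x : D x -> 0 < s x. Proof. by move=> /w0; exact: dual_weight_gt0. Qed.

(* From (mean F)^(p-1) <= K w(B)^-1 mu(B) (s(B)^-1 int_B F)^(p-1). *)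
Lemma lerner_pointwise (F : T -> \bar R) x :
  (forall x, D x -> (0 <= F x)%E) -> D x ->
  (wmax (cst 1%R) F x `^ (p - 1) <=
   K%:E * wmax w (fun y => wmax s F y `^ (p - 1)) x)%E.
Proof.
move=> F0 Dx; have K0 := mw_const_gt0 mw.
have s0F y : D y -> (0 <= wmax s F y)%E.
  by apply: (wmax_ge0 DS) => // z /s0 /ltW.
have KW0 : (0 <= K%:E * wmax w (fun y => wmax s F y `^ (p - 1)) x)%E.
  rewrite mule_ge0 ?lee_fin ?(ltW K0)//.
  by apply: (wmax_ge0 DS) => // [z /w0 /ltW//|z _]; exact: poweR_ge0.
rewrite le_poweR_inv//; last by apply: (wmax_ge0 DS).
apply: ge_ereal_sup => _ [y [r [Dy r0 yx ->]]].
have mB := measurable_qball DS Dy r0.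
have I0 : (0 <= \int[mu]_(z in B y r) F z)%E.
  by apply: integral_ge0 => z [Dz _]; exact: F0.
rewrite integral_cst1//.
have [a [b [m [a0 b0 m0 [ae be me h]]]]] := muckenhoupt_ball p1 mw Dy r0.
rewrite me inver gt_eqF// -le_poweR_inv//; last first.
  by rewrite mule_ge0// lee_fin invr_ge0 ltW.
set I := (\int[mu]_(z in B y r) F z)%E in I0 *.
apply: (@le_trans _ _ (K%:E * ((\int[mu]_(z in B y r) (w z)%:E)^-1 *
    \int[mu]_(z in B y r) (wmax s F z `^ (p - 1))))%E); last first.
  apply: lee_wpmul2l; first by rewrite lee_fin ltW.
  by apply: ereal_sup_ubound; exists y, r.
rewrite ae inver gt_eqF//.
(* At every point of the ball, the [s]-mean over this same ball is a lower bound for [wmax s F];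
   integrating the constant over the ball gives the factor [m]. *)
have : ((b^-1%:E * I) `^ (p - 1) * m%:E <=
    \int[mu]_(z in B y r) (wmax s F z `^ (p - 1)))%E.
  rewrite -me -integral_cst//; apply: ge0_le_integral => //.
  - by move=> z _; exact: poweR_ge0.
  - apply: (measurable_funS mD); first exact: qball_subset.
    apply: (measurableT_comp (measurable_poweR _)).
    exact: (measurable_wmax DS ds).
  - move=> z zB; have [Dz _] := zB; apply: le_poweR.
    + exact: ltW.
    + by rewrite mule_ge0// lee_fin invr_ge0 ltW.
    + by apply: ereal_sup_ubound; exists y, r; split => //; rewrite be inver gt_eqF.
set J := (\int[mu]_(z in B y r) (wmax s F z `^ (p - 1)))%E => hJ.
apply: (@le_trans _ _ (K%:E * (a^-1%:E * ((b^-1%:E * I) `^ (p - 1) * m%:E)))%E); last first.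
  apply: lee_wpmul2l; first by rewrite lee_fin ltW.
  by apply: lee_wpmul2l => //; rewrite lee_fin invr_ge0 ltW.
rewrite !poweRM ?lee_fin ?invr_ge0 ?(ltW m0) ?(ltW b0)// !poweR_EFin.
rewrite [leRHS](_ : _ = (K * a^-1 * b^-1 `^ (p - 1) * m)%:E * I `^ (p - 1))%E; last first.
  rewrite !EFinM -!muleA; congr (_ * (_ * (_ * _)))%E; exact: muleC.
apply: lee_wpmul2r; first exact: poweR_ge0.
(* With the common factor [I^(p-1)] removed, what remains is the A_p inequality on this ball. *)
rewrite lee_fin !powRV ?(ltW m0) ?(ltW b0)// -(ler_pM2r (powR_gt0 (p - 1) b0)).
rewrite -(ler_pM2r (powR_gt0 (p - 1) m0)) -(ler_pM2r a0).
have bn : b `^ (p - 1) != 0 by rewrite gt_eqF// powR_gt0.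
have mn : m `^ (p - 1) != 0 by rewrite gt_eqF// powR_gt0.
rewrite [leLHS](_ : _ = a * b `^ (p - 1)); last by field.
rewrite [leRHS](_ : _ = K * (m * m `^ (p - 1))); last first.
  by have an : a != 0; [rewrite gt_eqF|field; rewrite ?an ?bn].
by rewrite mulr_powRB1// ltW.
Qed.

(** With [r' = r/(r-1)]: the pointwise constant raised to [r'], then the L^r' bound for the operator
    of [w], then the L^r bound for that of the dual weight, whose A_r' constant is [L^(1/(r-1))]. *)
Definition muckenhoupt_const (k1 k2 r L : R) : R :=
  L `^ (r / (r - 1)) *
  maximal_const k1 (weight_doubling_const k2 r L) (r / (r - 1)) *
  maximal_const k1 (weight_doubling_const k2 (r / (r - 1)) (L `^ (r - 1)^-1)) r.

Lemma muckenhoupt_const_ge0 (k1 k2 r L : R) : 1 < r ->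
  0 <= muckenhoupt_const k1 k2 r L.
Proof.
move=> r1; have t1 := dual_exponent_gt1 r1.
apply: mulr_ge0; first apply: mulr_ge0; first exact: powR_ge0.
  by apply: maximal_const_ge0 => //; exact: weight_doubling_const_ge0.
by apply: maximal_const_ge0 => //; exact: weight_doubling_const_ge0.
Qed.

(** As [(p-1) q = p], the pointwise bound is raised to the power [q]. The bound for [w] at exponent
    [q] leaves the density [w^(1-q) = s], and the bound for [s] at exponent [p] leaves
    [s^(1-p) = w]: the two changes of weight cancel. *)
Theorem muckenhoupt_maximal (F : T -> \bar R) :
  measurable_fun D F -> (forall x, D x -> (0 <= F x)%E) ->
  (\int[mu]_(x in D) (wmax (cst 1%R) F x `^ p * (w x)%:E) <=
   (muckenhoupt_const K1 K2 p K)%:E * \int[mu]_(x in D) (F x `^ p * (w x)%:E))%E.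
Proof.
move=> mF F0; have K0 := mw_const_gt0 mw.
have p1n : p - 1 != 0 by rewrite gt_eqF.
have q0 : 0 < q by exact: lt_trans q1.
have mw_ := mw_measurable mw.
have mwE : measurable_fun D (EFin \o w) by apply/measurable_EFinP.
have m1 := measurable_wmax DS doubling_weight1 F.
have ms := measurable_wmax DS ds F.
pose H y := (wmax s F y `^ (p - 1))%E.
have mH : measurable_fun D H.
  exact: (measurableT_comp (measurable_poweR _)).
have H0 x : D x -> (0 <= H x)%E by move=> _; exact: poweR_ge0.
have mW := measurable_wmax DS dw H.
have W0 x : D x -> (0 <= wmax w H x)%E.
  by apply: (wmax_ge0 DS) => // z /w0 /ltW.
have M0 x : D x -> (0 <= wmax (cst 1%R) F x)%E by apply: (wmax_ge0 DS).
have S0 x : D x -> (0 <= wmax s F x)%E by apply: (wmax_ge0 DS) => // z /s0 /ltW.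
apply: (@le_trans _ _ ((K `^ q)%:E * \int[mu]_(x in D) (wmax w H x `^ q * (w x)%:E))%E).
  rewrite -ge0_integralZl_EFin ?powR_ge0//; last 2 first.
  - by move=> x Dx; rewrite mule_ge0 ?poweR_ge0// lee_fin ltW// w0.
  - by apply: emeasurable_funM; last exact: mwE; exact: (measurableT_comp (measurable_poweR _)).
  apply: ge0_le_integral => //.
  - by move=> x Dx; rewrite mule_ge0 ?poweR_ge0// lee_fin ltW// w0.
  - by apply: emeasurable_funM; last exact: mwE; exact: (measurableT_comp (measurable_poweR _)).
  - apply: measurable_funeM; apply: emeasurable_funM; last exact: mwE.
    exact: (measurableT_comp (measurable_poweR _)).
  - move=> x Dx; rewrite muleA; apply: lee_wpmul2r; first by rewrite lee_fin ltW// w0.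
    rewrite -poweR_EFin -poweRM ?lee_fin ?(ltW K0) ?W0//.
    rewrite [leLHS](_ : _ = (wmax (cst 1%R) F x `^ (p - 1)) `^ q)%E; last first.
      by rewrite -poweRrM; congr (_ `^ _)%E; field.
    apply: le_poweR; rewrite ?poweR_ge0 ?(ltW q0)//.
    exact: lerner_pointwise.
have C10 := maximal_const_ge0 K1 (weight_doubling_const_ge0 K2 p K) q1.
rewrite /muckenhoupt_const -mulrA EFinM -muleA.
apply: lee_wpmul2l; first by rewrite lee_fin powR_ge0.
have h := weighted_maximal_inequality DS dw q1 mH H0.
rewrite EFinM -muleA; apply: le_trans h _.
apply: lee_wpmul2l; first by rewrite lee_fin.
rewrite [leLHS](_ : _ = \int[mu]_(x in D) (wmax s F x `^ p * (s x)%:E))%E; last first.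
  apply: eq_integral => x _; congr (_ * _)%E.
    by rewrite /H -poweRrM; congr (_ `^ _)%E; field.
  by congr (_ `^ _)%:E; field.
apply: (le_trans (weighted_maximal_inequality DS ds p1 mF F0)).
rewrite le_eqVlt; apply/orP; left; apply/eqP; congr (_ * _)%E.
apply: eq_integral => x /set_mem Dx; congr (_ * _%:E)%E.
rewrite /dual_weight -powRrM (_ : _ * _ = 1) ?powRr1 ?ltW ?w0//.
by field.
Qed.

End Lerner.

End Muckenhoupt.

(** * A_1 majorants *)

Lemma ae_exists (d : measure_display) (T : measurableType d) (R : realType)
    (mu : {measure set T -> \bar R}) (A : set T) (P : T -> Prop) :
  measurable A -> (0 < mu A)%E -> {ae mu, forall x, A x -> P x} ->
  exists2 x, A x & P x.
Proof.
move=> mA A0 [N [mN N0 sN]]; apply: contrapT => noP.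
have : (mu A <= mu N)%E.
  apply: le_measure; rewrite ?inE//; apply: subset_trans sN => x Ax /= AP.
  by apply: noP; exists x => //; exact: AP.
by rewrite N0 leNgt A0.
Qed.

Section Majorant.
Context (R : realType) (d : measure_display) (T : measurableType d).
Context (D : set T) (rho : T -> T -> R) (mu : {measure set T -> \bar R}).
Context (K1 K2 : R) (DS : doubling_space D rho mu K1 K2).
Local Notation B := (qball D rho).
Local Notation M := (wmax D rho mu (cst 1)).

Let mD : measurable D. Proof. exact: ds_measurable DS. Qed.

Lemma ball_mean_le_max (F : T -> \bar R) x r y (m : R) : D x -> 0 < r ->
  mu (B x r) = m%:E -> 0 < m -> B x r y ->
  (\int[mu]_(z in B x r) F z <= m%:E * M F y)%E.
Proof.
move=> Dx r0 me m0 xy; rewrite -lee_pdivrMl//.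
apply: ereal_sup_ubound; exists x, r; split => //.
by rewrite integral_cst1 ?me ?inver ?gt_eqF//; exact: (measurable_qball DS).
Qed.

Lemma wmax1_le (F : T -> \bar R) y (Y : \bar R) :
  (forall x r m, D x -> 0 < r -> mu (B x r) = m%:E -> 0 < m -> B x r y ->
    (\int[mu]_(z in B x r) F z <= m%:E * Y)%E) -> (M F y <= Y)%E.
Proof.
move=> h; apply: ge_ereal_sup => _ [x [r [Dx r0 xy ->]]].
have [m m0 me] := ball_fin DS Dx r0.
rewrite integral_cst1 ?me ?inver ?gt_eqF ?lee_pdivrMl//; last exact: (measurable_qball DS).
exact: h.
Qed.

Lemma le_max_fun (F G : T -> \bar R) y : measurable_fun D F -> measurable_fun D G ->
  (forall x, D x -> (0 <= F x)%E) -> (forall x, D x -> (F x <= G x)%E) ->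
  (M F y <= M G y)%E.
Proof.
move=> mF mG F0 FG; apply: wmax1_le => x r m Dx r0 me m0 xy.
apply: (le_trans _ (ball_mean_le_max _ Dx r0 me m0 xy)).
have mB := measurable_qball DS Dx r0.
have BD : B x r `<=` D by exact: qball_subset.
apply: ge0_le_integral => //.
- by move=> z /BD; exact: F0.
- exact: measurable_funS mF.
- exact: measurable_funS mG.
- by move=> z /BD; exact: FG.
Qed.

Section FixedWeight.
Context (p K : R) (w : T -> R) (p1 : 1 < p) (mw : muckenhoupt D rho mu p K w).

Let p0 : 0 < p. Proof. exact: lt_trans p1. Qed.
Let w0 x : D x -> 0 < w x. Proof. by move=> Dx; exact: (mw_gt0 mw Dx). Qed.
Let mwE : measurable_fun D (EFin \o w).
Proof. by apply/measurable_EFinP; exact: mw_measurable mw. Qed.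

(** Makes [c^q N <= 1/2]; the form [|N| + 1] keeps the scale positive for every real [N]. *)
Definition majorant_scale (N q : R) : R := (2 * (`|N| + 1))^-1 `^ q^-1.

Let N := muckenhoupt_const K1 K2 p K.
Let c := majorant_scale N p.

Lemma majorant_scale_gt0 (L q : R) : 0 < majorant_scale L q.
Proof. by rewrite powR_gt0// invr_gt0 mulr_gt0// ltr_pwDr. Qed.

Let c0 : 0 < c. Proof. exact: majorant_scale_gt0. Qed.

Let cN : c `^ p * N <= 2^-1.
Proof.
rewrite /c /majorant_scale -powRrM mulVf ?gt_eqF// powRr1 ?invr_ge0 ?mulr_ge0 ?addr_ge0//.
have N1 : 0 < `|N| + 1 by rewrite ltr_pwDr.
rewrite invfM -mulrA ler_piMr// mulrC ler_pdivrMr// mul1r.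
by rewrite (le_trans (ler_norm N))// lerDl.
Qed.

(* The Rubio de Francia algorithm with suprema in place of sums: H = sup_n H_n
   satisfies c M H <= H. *)
Fixpoint majorant_iter (h : T -> \bar R) (n : nat) (x : T) : \bar R :=
  if n is k.+1 then maxe (h x) (c%:E * M (majorant_iter h k) x)%E else h x.

Context (h : T -> \bar R) (mh : measurable_fun D h).
Context (h0 : forall x, D x -> (0 <= h x)%E).
Local Notation H := (majorant_iter h).

Lemma measurable_majorant_iter n : measurable_fun D (H n).
Proof.
case: n => [//|n]; apply: measurable_maxe => //; apply: measurable_funeM.
exact: (measurable_wmax DS (doubling_weight1 DS)).
Qed.

Lemma majorant_iter_ge n x : (h x <= H n x)%E.
Proof. by case: n => [//|n] /=; rewrite le_max lexx. Qed.

Lemma majorant_iter_ge0 n x : D x -> (0 <= H n x)%E.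
Proof. by move=> Dx; apply: le_trans (h0 Dx) (majorant_iter_ge n x). Qed.

Lemma majorant_iterS n x : D x -> (H n x <= H n.+1 x)%E.
Proof.
elim: n x => [|n IH] x Dx; first by rewrite /= le_max lexx.
rewrite [leLHS]/= [leRHS]/=; rewrite ge_max !le_max lexx/=.
apply/orP; right; apply: lee_wpmul2l; first by rewrite lee_fin ltW.
apply: (@le_max_fun (H n) (H n.+1)) => //; [exact: measurable_majorant_iter|
  exact: measurable_majorant_iter|move=> z; exact: majorant_iter_ge0].
Qed.

Lemma measurable_pow_weight (f : T -> \bar R) : measurable_fun D f ->
  measurable_fun D (fun x => (f x `^ p * (w x)%:E)%E).
Proof.
move=> mf; apply: emeasurable_funM; last exact: mwE.
exact: (measurableT_comp (measurable_poweR _)).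
Qed.

Lemma pow_weight_ge0 (f : T -> \bar R) x : D x -> (0 <= f x `^ p * (w x)%:E)%E.
Proof. by move=> Dx; rewrite mule_ge0 ?poweR_ge0// lee_fin ltW// w0. Qed.

(** A maximum to the power [p] is at most the sum of the powers. With [X] the integral for [h], the
    recursion gives [X + c^p N (2 X) <= 2 X], so the bound [2 X] reproduces itself and does not grow
    with [n]. *)
Lemma majorant_iter_norm n :
  (\int[mu]_(x in D) (H n x `^ p * (w x)%:E) <=
   2%:E * \int[mu]_(x in D) (h x `^ p * (w x)%:E))%E.
Proof.
have X0 : (0 <= \int[mu]_(x in D) (h x `^ p * (w x)%:E))%E.
  by apply: integral_ge0 => x; exact: pow_weight_ge0.
elim: n => [|n IH].
  by rewrite lee_pemull// lee_fin ler1n.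
set X := (\int[mu]_(x in D) (h x `^ p * (w x)%:E))%E in X0 IH *.
have mHn := measurable_majorant_iter n.
have mMn : measurable_fun D (M (H n)) by exact: (measurable_wmax DS (doubling_weight1 DS)).
have := muckenhoupt_maximal DS p1 mw mHn (@majorant_iter_ge0 n); rewrite -/N => hM.
apply: (@le_trans _ _ (X + (c `^ p)%:E * \int[mu]_(x in D) (M (H n) x `^ p * (w x)%:E))%E).
  rewrite -ge0_integralZl_EFin ?powR_ge0//; last 2 first.
  - by move=> x; exact: pow_weight_ge0.
  - exact: measurable_pow_weight.
  rewrite /X -ge0_integralD//; last 4 first.
  - by move=> x; exact: pow_weight_ge0.
  - exact: measurable_pow_weight.
  - by move=> x Dx; rewrite mule_ge0 ?pow_weight_ge0// lee_fin powR_ge0.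
  - by apply: measurable_funeM; exact: measurable_pow_weight.
  apply: ge0_le_integral => //.
  - by move=> x; exact: pow_weight_ge0.
  - by apply: measurable_pow_weight; exact: (measurable_majorant_iter n.+1).
  - apply: emeasurable_funD; first exact: measurable_pow_weight.
    by apply: measurable_funeM; exact: measurable_pow_weight.
  - move=> x Dx; have M0 : (0 <= M (H n) x)%E.
      by apply: (wmax_ge0 DS) => // y; exact: majorant_iter_ge0.
    rewrite /= [X in (_ + X)%E]muleA -(poweR_EFin c) -poweRM ?lee_fin ?(ltW c0)//.
    rewrite -ge0_muleDl ?poweR_ge0//; apply: lee_wpmul2r.
      by rewrite lee_fin ltW// w0.
    by case: (leP (h x)) => _; [rewrite leeDr ?poweR_ge0|rewrite leeDl ?poweR_ge0].
apply: (@le_trans _ _ (X + (c `^ p)%:E * (N%:E * (2%:E * X)))%E).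
  apply: leeD => //; apply: lee_wpmul2l; first by rewrite lee_fin powR_ge0.
  apply: (le_trans hM); apply: lee_wpmul2l => //.
  by rewrite lee_fin muckenhoupt_const_ge0.
have -> : ((c `^ p)%:E * (N%:E * (2%:E * X)) = (c `^ p * N * 2)%:E * X)%E.
  by rewrite !EFinM !muleA.
rewrite (_ : 2%:E * X = X + X)%E; last first.
  by rewrite -[2]/(1 + 1) EFinD ge0_muleDl// mul1e.
apply: leeD => //; rewrite -[leRHS]mul1e; apply: lee_wpmul2r => //.
rewrite lee_fin; have := cN; lra.
Qed.

Let Hsup x := ereal_sup (range (H ^~ x)).

Let measurable_Hsup : measurable_fun D Hsup.
Proof.
apply: (emeasurable_fun_cvg H) => [n|x Dx]; first exact: measurable_majorant_iter.
apply: ereal_nondecreasing_cvgn; apply/nondecreasing_seqP => n.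
exact: majorant_iterS.
Qed.

Let Hsup_ub n x : (H n x <= Hsup x)%E.
Proof. by apply: ereal_sup_ubound; exists n. Qed.

Let Hsup_ge0 x : D x -> (0 <= Hsup x)%E.
Proof. by move=> Dx; apply: (le_trans (h0 Dx)); exact: (Hsup_ub 0). Qed.

Let Hsup_norm : (\int[mu]_(x in D) (Hsup x `^ p * (w x)%:E) <=
   2%:E * \int[mu]_(x in D) (h x `^ p * (w x)%:E))%E.
Proof.
apply: (@integral_le_sup _ _ _ _ _ (fun n x => H n x `^ p * (w x)%:E)%E) => //.
- by move=> n; apply: measurable_pow_weight; exact: measurable_majorant_iter.
- exact: measurable_pow_weight.
- by move=> n x; exact: pow_weight_ge0.
- by move=> x; exact: pow_weight_ge0.
- move=> n x Dx; apply: lee_wpmul2r; first by rewrite lee_fin ltW// w0.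
  by apply: le_poweR; [exact: ltW|exact: majorant_iter_ge0|exact: majorant_iterS].
- move=> x Dx; set S := ereal_sup _; have wx := w0 Dx.
  rewrite -lee_pdivlMr//.
  have S0 : (0 <= S * ((w x)^-1)%:E)%E.
    rewrite mule_ge0 ?lee_fin ?invr_ge0 ?(ltW wx)//.
    by apply: le_ereal_sup_tmp; exists (H 0%N x `^ p * (w x)%:E)%E; [exists 0%N|exact: pow_weight_ge0].
  rewrite le_poweR_inv ?Hsup_ge0//; apply: ge_ereal_sup => _ [n _ <-].
  rewrite -le_poweR_inv ?majorant_iter_ge0// lee_pdivlMr//.
  by apply: ereal_sup_ubound; exists n.
- exact: majorant_iter_norm.
Qed.

(** On a ball containing [y], the mean of [H n] is at most [c^-1 H n.+1 y], hence at most
    [c^-1 Hsup y]; monotone convergence passes to the mean of [Hsup]. *)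
Let Hsup_mean y : D y -> (c%:E * M Hsup y <= Hsup y)%E.
Proof.
move=> Dy; rewrite -lee_pdivlMl//; apply: wmax1_le => x r m Dx r0 me m0 xy.
have mB := measurable_qball DS Dx r0.
have BD : B x r `<=` D by exact: qball_subset.
apply: (@integral_le_sup _ _ _ _ _ H) => //.
- by move=> n; apply: (measurable_funS mD BD); exact: measurable_majorant_iter.
- exact: (measurable_funS mD BD).
- by move=> n z /BD; exact: majorant_iter_ge0.
- by move=> z /BD; exact: Hsup_ge0.
- by move=> n z /BD; exact: majorant_iterS.
- move=> n; apply: (le_trans (ball_mean_le_max _ Dx r0 me m0 xy)).
  apply: lee_wpmul2l; first by rewrite lee_fin ltW.
  rewrite lee_pdivlMl//; apply: le_trans (Hsup_ub n.+1 y).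
  by rewrite /= le_max lexx orbT.
Qed.

(** [U] is a real, everywhere positive version of [Hsup]. Its last property is the A_1 condition
    with constant [c^-1], stated together with finiteness of the ball integral. *)
Lemma A1_majorant x0 : D x0 -> (forall x, B x0 1 x -> (0 < h x)%E) ->
  (\int[mu]_(x in D) (h x `^ p * (w x)%:E) < +oo)%E ->
  exists U : T -> R, [/\ measurable_fun D U, forall x, D x -> 0 < U x,
    (\int[mu]_(x in D) ((U x `^ p)%:E * (w x)%:E) <=
     2%:E * \int[mu]_(x in D) (h x `^ p * (w x)%:E))%E,
    {ae mu, forall x, D x -> (h x <= (U x)%:E)%E} &
    forall y r m, D y -> 0 < r -> mu (B y r) = m%:E -> exists a, [/\ 0 < a,
      (\int[mu]_(x in B y r) (U x)%:E)%E = a%:E &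
      {ae mu, forall x, B y r x -> c * a / m <= U x}]].
Proof.
move=> Dx0 hpos hfin.
have Hpos y : D y -> (0 < Hsup y)%E.
  move=> Dy; apply: lt_le_trans (Hsup_mean Dy).
  apply: mule_gt0; first by rewrite lte_fin.
  (* This ball about [x0] contains both [y] and the unit ball where [h > 0], so the mean of [Hsup]
     over it is positive, and with it [Hsup y]. *)
  pose r := 1 + `|rho x0 y|; have r0 : 0 < r by rewrite ltr_pwDl.
  have [m m0 me] := ball_fin DS Dx0 r0.
  have xy : B x0 r y.
    by split => //; rewrite /r (le_lt_trans (ler_norm _))// ltrDr.
  have := ball_mean_le_max Hsup Dx0 r0 me m0 xy.
  rewrite -lee_pdivrMl//; apply: lt_le_trans.
  apply: mule_gt0; first by rewrite lte_fin invr_gt0.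
  have mB1 := measurable_qball DS Dx0 (@ltr01 R).
  apply: (@lt_le_trans _ _ (\int[mu]_(x in B x0 1) Hsup x)%E).
    apply: ge0_integral_gt0 (ds_gt0 DS Dx0 ltr01) => //.
    - by apply: (measurable_funS mD) => //; exact: qball_subset.
    - by move=> x /hpos hx; apply: (lt_le_trans hx); exact: (Hsup_ub 0).
  apply: ge0_subset_integral => //.
  - exact: (measurable_qball DS).
  - by apply: (measurable_funS mD) => //; exact: qball_subset.
  - by move=> x [Dx _]; exact: Hsup_ge0.
  - by move=> x [Dx x1]; split=> //; rewrite (lt_le_trans x1)// /r lerDl.
have Hfin : {ae mu, forall x, D x -> Hsup x \is a fin_num}.
  have mi : mu.-integrable D (fun x => Hsup x `^ p * (w x)%:E)%E.
    apply/integrableP; split; first exact: measurable_pow_weight.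
    under eq_integral.
      move=> x /set_mem Dx; rewrite gee0_abs; last exact: pow_weight_ge0.
      over.
    by apply: (le_lt_trans Hsup_norm); rewrite lte_mul_pinfty.
  have := integrable_ae mD mi.
  apply: filterS => x + Dx => /(_ Dx).
  have := Hsup_ge0 Dx; case: (Hsup x) => // _.
  by rewrite poweRyr ?gt_eqF// gt0_mulye// lte_fin w0.
(* The default 1 on the null set where [Hsup] is infinite keeps [U] real and positive. *)
pose U x := fine (if (Hsup x < +oo)%E then Hsup x else 1%E).
have mU : measurable_fun D U.
  apply: (measurableT_comp (fine_measurable measurableT)).
  apply: measurable_fun_if => //; first exact: measurable_fun_lte.
  by apply: measurable_funS measurable_Hsup => //; exact: subIsetl.
have U0 x : D x -> 0 < U x.
  move=> Dx; rewrite /U; case: ifPn => // f.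
  by rewrite fine_gt0// Hpos.
have UH : {ae mu, forall x, D x -> (U x)%:E = Hsup x}.
  apply: filterS Hfin => x + Dx => /(_ Dx) f.
  by rewrite /U -ge0_fin_numE ?Hsup_ge0// f fineK.
have mUE : measurable_fun D (EFin \o U) by apply/measurable_EFinP.
exists U; split => //.
- apply: le_trans Hsup_norm; apply: ae_ge0_le_integral => //.
  + by move=> x Dx; rewrite -EFinM lee_fin mulr_ge0 ?powR_ge0// ltW// w0.
  + apply: emeasurable_funM; last exact: mwE.
    by apply/measurable_EFinP; exact: (measurableT_comp (measurable_powR _)).
  + by move=> x; exact: pow_weight_ge0.
  + exact: measurable_pow_weight.
  + by apply: filterS UH => x + Dx => /(_ Dx) <-; rewrite poweR_EFin.
- by apply: filterS UH => x + Dx => /(_ Dx) ->; exact: (Hsup_ub 0).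
move=> y r m Dy r0 me.
have m0 : 0 < m by rewrite -lte_fin -me (ds_gt0 DS).
have mB := measurable_qball DS Dy r0.
have BD : B y r `<=` D by exact: qball_subset.
have UHB : {ae mu, forall x, B y r x -> (U x)%:E = Hsup x}.
  by apply: filterS UH => x + /BD.
have IE : (\int[mu]_(x in B y r) (U x)%:E = \int[mu]_(x in B y r) Hsup x)%E.
  apply: ge0_ae_eq_integral => //.
  - exact: (measurable_funS mD BD).
  - exact: (measurable_funS mD BD).
  - by move=> x /BD /U0 /ltW; rewrite lee_fin.
  - by move=> x /BD; exact: Hsup_ge0.
have I0 : (0 < \int[mu]_(x in B y r) (U x)%:E)%E.
  apply: ge0_integral_gt0 (ds_gt0 DS Dy r0) => //.
  - exact: (measurable_funS mD BD).
  - by move=> x /BD /U0; rewrite lte_fin.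
have mean x : B y r x -> (c%:E * ((m^-1)%:E * \int[mu]_(z in B y r) (U z)%:E) <= Hsup x)%E.
  move=> yx; apply: le_trans (Hsup_mean (BD _ yx)).
  apply: lee_wpmul2l; first by rewrite lee_fin ltW.
  by rewrite IE lee_pdivrMl//; exact: ball_mean_le_max me m0 yx.
(* One point of the ball where [Hsup] is finite suffices to make the ball integral finite. *)
have [z yz Uz] := ae_exists mB (ds_gt0 DS Dy r0) UHB.
move: I0 mean; case: (\int[mu]_(x in B y r) (U x)%:E)%E => [a| |]//.
  rewrite lte_fin => a0 mean; exists a; split => //.
  apply: filterS UHB => x + yx => /(_ yx) Ux.
  by have := mean x yx; rewrite -Ux -!EFinM lee_fin mulrA -[c / m * a]mulrA (mulrC _ a) mulrA.
by move=> _ /(_ _ yz); rewrite !gt0_muley ?lte_fin ?invr_gt0// -Uz leye_eq.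
Qed.

End FixedWeight.

End Majorant.

(** * Extrapolation *)

Section Extrapolation.
Context (R : realType) (d : measure_display) (T : measurableType d).
Context (D : set T) (rho : T -> T -> R) (mu : {measure set T -> \bar R}).
Context (K1 K2 : R) (DS : doubling_space D rho mu K1 K2).
Local Notation B := (qball D rho).

Let mD : measurable D. Proof. exact: ds_measurable DS. Qed.

Lemma le_powRN (x y r : R) : 0 <= r -> 0 < x -> x <= y -> y `^ (- r) <= x `^ (- r).
Proof.
move=> r0 x0 xy; have y0 : 0 < y by exact: lt_le_trans xy.
rewrite !powRN lef_pV2 ?posrE ?powR_gt0//.
by rewrite ge0_ler_powR ?nnegrE// ltW.
Qed.

(** On a ball, the A_1 conditions bound [U1] and [U2] below by [e1 = c1 a1 / m] and
    [e2 = c2 a2 / m], hence their negative powers above. In [e2^(1-p) a1 (e1^(-1/(p-1)) a2)^(p-1)]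
    the factors [a1], [a2] cancel and [c1^-1 c2^(1-p) m^p] is left. *)
Lemma reverse_factorization (p c1 c2 : R) (U1 U2 : T -> R) :
  1 < p -> 0 < c1 -> 0 < c2 ->
  measurable_fun D U1 -> measurable_fun D U2 ->
  (forall x, D x -> 0 < U1 x) -> (forall x, D x -> 0 < U2 x) ->
  (forall y r m, D y -> 0 < r -> mu (B y r) = m%:E -> exists a, [/\ 0 < a,
     (\int[mu]_(x in B y r) (U1 x)%:E)%E = a%:E &
     {ae mu, forall x, B y r x -> c1 * a / m <= U1 x}]) ->
  (forall y r m, D y -> 0 < r -> mu (B y r) = m%:E -> exists a, [/\ 0 < a,
     (\int[mu]_(x in B y r) (U2 x)%:E)%E = a%:E &
     {ae mu, forall x, B y r x -> c2 * a / m <= U2 x}]) ->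
  muckenhoupt D rho mu p (c1^-1 * c2 `^ (1 - p)) (fun x => U1 x * U2 x `^ (1 - p)).
Proof.
move=> p1 c10 c20 mU1 mU2 U10 U20 A1 A2.
have p10 : 0 < p - 1 by rewrite subr_gt0.
have pN : 1 - p = - (p - 1) by rewrite opprB.
set v := fun x => _; have v0 x : D x -> 0 < v x.
  by move=> Dx; rewrite mulr_gt0 ?powR_gt0 ?U10 ?U20.
have mv : measurable_fun D v.
  by apply: measurable_funM => //; exact: (measurableT_comp (measurable_powR _)).
split=> //; first by rewrite mulr_gt0 ?powR_gt0 ?invr_gt0.
move=> y r Dy r0; have [m m0 me] := ball_fin DS Dy r0.
have [a1 [a10 I1 ae1]] := A1 y r m Dy r0 me.
have [a2 [a20 I2 ae2]] := A2 y r m Dy r0 me.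
have mB := measurable_qball DS Dy r0.
have BD : B y r `<=` D by exact: qball_subset.
pose e1 := c1 * a1 / m; pose e2 := c2 * a2 / m.
have e10 : 0 < e1 by rewrite divr_gt0 ?mulr_gt0.
have e20 : 0 < e2 by rewrite divr_gt0 ?mulr_gt0.
have mvB : measurable_fun (B y r) (EFin \o v).
  by apply/measurable_EFinP; exact: (measurable_funS mD BD).
have mU1B : measurable_fun (B y r) (EFin \o U1).
  by apply/measurable_EFinP; exact: (measurable_funS mD BD).
have mU2B : measurable_fun (B y r) (EFin \o U2).
  by apply/measurable_EFinP; exact: (measurable_funS mD BD).
have h1 : (\int[mu]_(x in B y r) (v x)%:E <= (e2 `^ (1 - p) * a1)%:E)%E.
  rewrite EFinM -I1 -ge0_integralZl_EFin ?powR_ge0//; last first.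
    by move=> x /BD /U10 /ltW; rewrite lee_fin.
  apply: ae_ge0_le_integral => //.
  - by move=> x /BD /v0 /ltW; rewrite lee_fin.
  - by move=> x /BD /U10 /ltW ?; rewrite -EFinM lee_fin mulr_ge0 ?powR_ge0.
  - exact: measurable_funeM.
  - apply: filterS ae2 => x + yx => /(_ yx) le2.
    rewrite -EFinM lee_fin /v mulrC; apply: ler_wpM2r; first by rewrite ltW// U10//; exact: BD.
    by rewrite pN; apply: le_powRN => //; exact: ltW.
have dE x : B y r x -> dual_weight p v x = U1 x `^ (- (p - 1)^-1) * U2 x.
  move=> /BD Dx; rewrite /dual_weight powRM ?powR_ge0 ?ltW ?U10//.
  rewrite -powRrM (_ : (1 - p) * _ = 1) ?powRr1 ?ltW ?U20//.
  by field; rewrite gt_eqF.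
have mdB : measurable_fun (B y r) (EFin \o dual_weight p v).
  by apply/measurable_EFinP; apply: (measurable_funS mD BD); exact: measurable_dual_weight.
have h2 : (\int[mu]_(x in B y r) (dual_weight p v x)%:E <=
    (e1 `^ (- (p - 1)^-1) * a2)%:E)%E.
  rewrite EFinM -I2 -ge0_integralZl_EFin ?powR_ge0//; last first.
    by move=> x /BD /U20 /ltW; rewrite lee_fin.
  apply: ae_ge0_le_integral => //.
  - by move=> x _; rewrite lee_fin powR_ge0.
  - by move=> x /BD /U20 /ltW ?; rewrite -EFinM lee_fin mulr_ge0 ?powR_ge0.
  - exact: measurable_funeM.
  - apply: filterS ae1 => x + yx => /(_ yx) le1.
    rewrite -EFinM lee_fin dE//; apply: ler_wpM2r; first by rewrite ltW// U20//; exact: BD.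
    by apply: le_powRN => //; rewrite invr_ge0 ltW.
apply: (@le_trans _ _ ((e2 `^ (1 - p) * a1)%:E *
    (e1 `^ (- (p - 1)^-1) * a2)%:E `^ (p - 1))%E).
  apply: lee_pmul => //.
  - by apply: integral_ge0 => x /BD /v0 /ltW; rewrite lee_fin.
  - exact: poweR_ge0.
  - apply: le_poweR; rewrite ?(ltW p10)//.
    by apply: integral_ge0 => x _; rewrite lee_fin powR_ge0.
rewrite me !poweR_EFin -!EFinM lee_fin le_eqVlt; apply/orP; left; apply/eqP.
rewrite powRM ?powR_ge0 ?(ltW a20)// -powRrM mulNr mulVf ?gt_eqF// powR_inv1 ?(ltW e10)//.
rewrite /e2 powRM ?mulr_ge0 ?invr_ge0 ?ltW// powRM ?ltW// /e1.
rewrite (powRV _ (ltW m0)) -(mulr_powRB1 (ltW m0) (lt_trans ltr01 p1)).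
rewrite pN !powRN; field.
by rewrite !gt_eqF ?powR_gt0.
Qed.

(** If [g = G^(1/p)] exceeds [u], then [g = g^p g^(1-p) <= G u^(1-p)]. The gain is that [G] enters
    to the first power, as it does in the one-weight hypothesis. *)
Lemma young_split (p : R) (G : \bar R) (u : R) : 1 < p -> 0 < u -> (0 <= G)%E ->
  (G `^ p^-1 <= u%:E + G * (u `^ (1 - p))%:E)%E.
Proof.
move=> p1 u0; have p0 : 0 < p by exact: lt_trans p1.
case: G => [G| |]//; last first.
  by move=> _; rewrite gt0_mulye ?lte_fin ?powR_gt0// addey// leey.
rewrite lee_fin => G0; rewrite poweR_EFin -EFinM -EFinD lee_fin.
set g := G `^ p^-1; have g0 : 0 <= g by exact: powR_ge0.
have GE : G = g `^ p by rewrite /g -powRrM mulVf ?gt_eqF// powRr1.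
have [gu|ug] := leP g u; first by rewrite (le_trans gu)// lerDl mulr_ge0 ?powR_ge0.
rewrite GE; apply: (@le_trans _ _ (g `^ p * u `^ (1 - p))); last first.
  by rewrite lerDr ltW.
have gpos : 0 < g by exact: lt_trans ug.
have gE : g `^ p * g `^ (1 - p) = g.
  rewrite -powRD; first by rewrite addrCA subrr addr0 powRr1.
  by rewrite (gt_eqF gpos) implybT.
rewrite -[leLHS]gE.
apply: ler_wpM2l; first exact: powR_ge0.
by rewrite -opprB; apply: le_powRN => //; rewrite ?subr_ge0 ltW.
Qed.

(** Young's inequality with a parameter, by cases on [b <= e (a/w)^(1/(q-1))]: each time one term
    alone suffices. The terms are the densities of the L^q'(s) norm of [U1] and of the L^q(w) norm
    of [U2]. *)
Lemma young_weight (q e w a b : R) : 1 < q -> 0 < e -> 0 < w -> 0 < a -> 0 < b ->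
  a * b <= e * (a `^ (q / (q - 1)) * w `^ (- (q - 1)^-1)) +
           e `^ (1 - q) * (b `^ q * w).
Proof.
move=> q1 e0 w0 a0 b0; have q10 : 0 < q - 1 by rewrite subr_gt0.
pose r := (q - 1)^-1; have r0 : 0 < r by rewrite invr_gt0.
have qE : q / (q - 1) = 1 + r by rewrite /r; field; rewrite gt_eqF.
pose t := a / w; have t0 : 0 < t by rewrite divr_gt0.
have tr : t `^ r = a `^ r * w `^ (- r).
  by rewrite /t powRM ?invr_ge0 ?ltW// powRV ?ltW// powRN.
have [h|h] := leP b (e * t `^ r).
  apply: (@le_trans _ _ (e * (a `^ (q / (q - 1)) * w `^ (- (q - 1)^-1)))); last first.
    by rewrite lerDl !mulr_ge0 ?powR_ge0// ltW.
  have -> : a `^ (q / (q - 1)) = a * a `^ r.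
    by rewrite qE powRD ?(gt_eqF a0) ?implybT// powRr1// ltW.
  rewrite -/r -(mulrA a) -tr.
  by rewrite mulrCA ler_pM2l.
apply: (@le_trans _ _ (e `^ (1 - q) * (b `^ q * w))); last first.
  by rewrite lerDr !mulr_ge0 ?powR_ge0// ltW.
have tb : t <= (b / e) `^ (q - 1).
  have -> : t = (t `^ r) `^ (q - 1).
    by rewrite -powRrM mulVf ?gt_eqF// powRr1 ?ltW.
  apply: ge0_ler_powR; rewrite ?nnegrE ?powR_ge0 ?divr_ge0 ?(ltW q10) ?(ltW b0) ?(ltW e0)//.
  by rewrite ler_pdivlMr// mulrC ltW.
rewrite (_ : a * b = t * (b * w)); last by rewrite /t mulrCA mulrC divfK ?gt_eqF// mulrC.
apply: (@le_trans _ _ ((b / e) `^ (q - 1) * (b * w))).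
  by rewrite ler_pM2r ?mulr_gt0.
rewrite powRM ?invr_ge0 ?(ltW b0) ?(ltW e0)// powRV ?(ltW e0)// -(mulr_powRB1 (ltW b0) (lt_trans ltr01 q1)).
rewrite -(opprB q 1) powRN le_eqVlt; apply/orP; left; apply/eqP; ring.
Qed.

Section FixedWeight.
Context (p q K : R) (w : T -> R) (p1 : 1 < p) (q1 : 1 < q).
Context (mw : muckenhoupt D rho mu q K w).
Local Notation q' := (q / (q - 1)).
Local Notation s := (dual_weight q w).

(** The constant [c1^-1 c2^(1-p)] of [reverse_factorization], with [c1] the scale for L^q'(s) and
    [c2] that for L^q(w). It depends on [w] only through its A_q bound, so it is known before [v] is
    built. *)
Definition extrapolation_weight_const (k1 k2 r t L : R) : R :=
  (majorant_scale (muckenhoupt_const k1 k2 (t / (t - 1)) (L `^ (t - 1)^-1))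
    (t / (t - 1)))^-1 *
  majorant_scale (muckenhoupt_const k1 k2 t L) t `^ (1 - r).

Local Notation L := (extrapolation_weight_const K1 K2 p q K).

Let p0 : 0 < p. Proof. exact: lt_trans p1. Qed.
Let q0 : 0 < q. Proof. exact: lt_trans q1. Qed.
Let q10 : 0 < q - 1. Proof. by rewrite subr_gt0. Qed.
Let w0 x : D x -> 0 < w x. Proof. by move=> Dx; exact: (mw_gt0 mw Dx). Qed.
Let mw_ : measurable_fun D w. Proof. exact: mw_measurable mw. Qed.
Let mwE : measurable_fun D (EFin \o w). Proof. exact/measurable_EFinP. Qed.

Let mpow (f : T -> \bar R) (r : R) : measurable_fun D f ->
  measurable_fun D (fun x => f x `^ r)%E.
Proof. exact: (measurableT_comp (measurable_poweR _)). Qed.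

Let mpowR (f : T -> R) (r : R) : measurable_fun D f ->
  measurable_fun D (fun x => f x `^ r).
Proof. exact: (measurableT_comp (measurable_powR _)). Qed.

(** Positivity of [F] and [G] on a ball makes the majorants positive, and finiteness of the left
    integral allows it to be absorbed. The powers in [h1], [h2] are such that [h1^q' s = G^(q/p) w]
    and [h2^q w = F^(q/p) w]. *)
Lemma extrapolation_core (C : R) (F G : T -> \bar R) x0 : 0 <= C -> D x0 ->
  measurable_fun D F -> measurable_fun D G ->
  (forall x, D x -> (0 <= F x)%E) -> (forall x, D x -> (0 <= G x)%E) ->
  (forall x, B x0 1 x -> (0 < F x)%E) -> (forall x, B x0 1 x -> (0 < G x)%E) ->
  (forall v, muckenhoupt D rho mu p L v ->
    (\int[mu]_(x in D) (G x * (v x)%:E) <=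
     C%:E * \int[mu]_(x in D) (F x * (v x)%:E))%E) ->
  (\int[mu]_(x in D) (F x `^ (q / p) * (w x)%:E) < +oo)%E ->
  (\int[mu]_(x in D) (G x `^ (q / p) * (w x)%:E) < +oo)%E ->
  (\int[mu]_(x in D) (G x `^ (q / p) * (w x)%:E) <=
   ((4 * (1 + C)) `^ q)%:E * \int[mu]_(x in D) (F x `^ (q / p) * (w x)%:E))%E.
Proof.
move=> C0 Dx0 mF mG F0 G0 Fpos Gpos hyp Zfin Yfin.
pose h1 x := (G x `^ ((q - 1) / p) * (w x)%:E)%E.
pose h2 x := (F x `^ p^-1)%E.
have q'1 := dual_exponent_gt1 q1.
have ms := muckenhoupt_dual DS q1 mw.
have s0 x : D x -> 0 < s x by move=> /w0; exact: dual_weight_gt0.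
have h1E x : D x -> (h1 x `^ q' * (s x)%:E = G x `^ (q / p) * (w x)%:E)%E.
  move=> Dx; rewrite /h1 poweRM ?poweR_ge0 ?lee_fin ?(ltW (w0 Dx))//.
  rewrite -poweRrM poweR_EFin -muleA -EFinM; congr (_ `^ _ * _%:E)%E.
    by field; rewrite !gt_eqF.
  rewrite /dual_weight -powRD; last by rewrite (gt_eqF (w0 Dx)) implybT.
  rewrite (_ : _ - _ = 1) ?powRr1 ?(ltW (w0 Dx))//.
  by field; rewrite gt_eqF.
have h2E x : (h2 x `^ q * (w x)%:E = F x `^ (q / p) * (w x)%:E)%E.
  by rewrite /h2 -poweRrM mulrC.
have mh1 : measurable_fun D h1 by apply: emeasurable_funM; [exact: mpow|exact: mwE].
have mh2 : measurable_fun D h2 by exact: mpow.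
have I1 : (\int[mu]_(x in D) (h1 x `^ q' * (s x)%:E) =
           \int[mu]_(x in D) (G x `^ (q / p) * (w x)%:E))%E.
  by apply: eq_integral => x /set_mem; exact: h1E.
have I2 : (\int[mu]_(x in D) (h2 x `^ q * (w x)%:E) =
           \int[mu]_(x in D) (F x `^ (q / p) * (w x)%:E))%E.
  by apply: eq_integral => x _; exact: h2E.
have h10 x : D x -> (0 <= h1 x)%E.
  by move=> Dx; rewrite mule_ge0 ?poweR_ge0// lee_fin ltW// w0.
have h20 x : D x -> (0 <= h2 x)%E by move=> Dx; exact: poweR_ge0.
have h1p x : B x0 1 x -> (0 < h1 x)%E.
  move=> /[dup] xB /Gpos Gx.
  by rewrite mule_gt0 ?poweR_gt0// lte_fin w0//; case: xB.
have h2p x : B x0 1 x -> (0 < h2 x)%E by move=> /Fpos Fx; exact: poweR_gt0.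
have h1f : (\int[mu]_(x in D) (h1 x `^ q' * (s x)%:E) < +oo)%E by rewrite I1.
have h2f : (\int[mu]_(x in D) (h2 x `^ q * (w x)%:E) < +oo)%E by rewrite I2.
have [U1 [mU1 U10 nU1 dU1 aU1]] := A1_majorant DS q'1 ms mh1 h10 Dx0 h1p h1f.
have [U2 [mU2 U20 nU2 dU2 aU2]] := A1_majorant DS q1 mw mh2 h20 Dx0 h2p h2f.
rewrite I1 in nU1; rewrite I2 in nU2.
have mv := reverse_factorization p1 (majorant_scale_gt0 _ _) (majorant_scale_gt0 _ _)
  mU1 mU2 U10 U20 aU1 aU2.
move: mv; set v := fun x => _ => mv.
have {hyp} hyp := hyp v mv.
have v0 x : D x -> 0 < v x by move=> Dx; exact: (mw_gt0 mv Dx).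
have mvE : measurable_fun D (EFin \o v).
  by apply/measurable_EFinP; exact: mw_measurable mv.
have mU1E : measurable_fun D (EFin \o U1) by exact/measurable_EFinP.
have mU2E : measurable_fun D (EFin \o U2) by exact/measurable_EFinP.
pose P x := (U1 x * U2 x)%:E.
have mP : measurable_fun D P by apply/measurable_EFinP; exact: measurable_funM.
have P0 x : D x -> (0 <= P x)%E.
  by move=> Dx; rewrite lee_fin mulr_ge0// ltW ?U10 ?U20.
have mGv : measurable_fun D (fun x => G x * (v x)%:E)%E by exact: emeasurable_funM.
have mFv : measurable_fun D (fun x => F x * (v x)%:E)%E by exact: emeasurable_funM.
have Gv0 x : D x -> (0 <= G x * (v x)%:E)%E.
  by move=> Dx; rewrite mule_ge0 ?G0// lee_fin ltW// v0.
have Fv0 x : D x -> (0 <= F x * (v x)%:E)%E.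
  by move=> Dx; rewrite mule_ge0 ?F0// lee_fin ltW// v0.
set Y := (\int[mu]_(x in D) (G x `^ (q / p) * (w x)%:E))%E in Yfin nU1 *.
set Z := (\int[mu]_(x in D) (F x `^ (q / p) * (w x)%:E))%E in Zfin nU2 *.
pose I := (\int[mu]_(x in D) P x)%E.
have I0 : (0 <= I)%E by apply: integral_ge0.
(* [F <= U2^p] almost everywhere, and [U2^p v = U1 U2] by the choice of [v]. *)
have FvI : (\int[mu]_(x in D) (F x * (v x)%:E) <= I)%E.
  apply: ae_ge0_le_integral => //.
  apply: filterS dU2 => x + Dx => /(_ Dx).
  rewrite /h2 le_poweR_inv ?invr_gt0 ?F0//; last by rewrite lee_fin ltW ?U20.
  rewrite invrK poweR_EFin => Fle.
  apply: (@le_trans _ _ ((U2 x `^ p)%:E * (v x)%:E)%E).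
    by apply: lee_wpmul2r => //; rewrite lee_fin ltW// v0.
  rewrite -EFinM lee_fin /v mulrCA -powRD; last by rewrite (gt_eqF (U20 _ Dx)) implybT.
  by rewrite addrCA subrr addr0 powRr1// ltW// U20.
(* [G^(q/p) w = G^(1/p) h1 <= G^(1/p) U1], which [young_split] separates into [U1 U2] and [G v]. *)
have Y1 : (Y <= I + C%:E * I)%E.
  apply: (@le_trans _ _ (I + \int[mu]_(x in D) (G x * (v x)%:E))%E); last first.
    by apply: leeD => //; apply: (le_trans hyp); apply: lee_wpmul2l.
  rewrite -ge0_integralD//; apply: ae_ge0_le_integral => //.
  - by move=> x Dx; rewrite mule_ge0 ?poweR_ge0// lee_fin ltW// w0.
  - by apply: emeasurable_funM; [exact: mpow|exact: mwE].
  - by move=> x Dx; rewrite adde_ge0 ?P0 ?Gv0.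
  - exact: emeasurable_funD.
  apply: filterS dU1 => x + Dx => /(_ Dx) hU1.
  have -> : (G x `^ (q / p) * (w x)%:E = G x `^ p^-1 * h1 x)%E.
    have expE : p^-1 + (q - 1) / p = q / p by field; rewrite gt_eqF.
    rewrite /h1 muleA -expE (@poweRD _ (G x) p^-1 ((q - 1) / p))//.
    apply: add_neq0_poweRD_def.
    by rewrite expE mulf_neq0 ?invr_eq0 ?gt_eqF.
  apply: (@le_trans _ _ (G x `^ p^-1 * (U1 x)%:E)%E).
    by apply: lee_wpmul2l => //; exact: poweR_ge0.
  have := young_split p1 (U20 _ Dx) (G0 _ Dx).
  move=> /(lee_wpmul2r (_ : (0 <= (U1 x)%:E)%E)) h.
  apply: (le_trans (h _)); first by rewrite lee_fin ltW// U10.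
  rewrite ge0_muleDl; last 2 first.
  - by rewrite lee_fin ltW// U20.
  - by rewrite mule_ge0 ?G0// lee_fin powR_ge0.
  by rewrite -EFinM -muleA -EFinM /P /v (mulrC (U2 x)) (mulrC (U1 x) (_ `^ _)).
(* Then [(1 + C) e (2 Y) = Y / 2] is absorbed, and the remaining factor [4 (1 + C) e^(1-q)] equals
   [(4 (1 + C))^q]. *)
pose e := (4 * (1 + C))^-1.
have C10 : 0 < 1 + C by rewrite ltr_pwDl.
have e0 : 0 < e by rewrite invr_gt0 mulr_gt0.
have I3 : (I <= e%:E * (2%:E * Y) + (e `^ (1 - q))%:E * (2%:E * Z))%E.
  apply: (@le_trans _ _ (e%:E * \int[mu]_(x in D) ((U1 x `^ q')%:E * (s x)%:E) +
     (e `^ (1 - q))%:E * \int[mu]_(x in D) ((U2 x `^ q)%:E * (w x)%:E))%E); last first.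
    apply: leeD; apply: lee_wpmul2l => //; rewrite lee_fin ?powR_ge0//; exact: ltW.
  have m1 : measurable_fun D (fun x => (U1 x `^ q')%:E * (s x)%:E)%E.
    apply: emeasurable_funM; apply/measurable_EFinP; first exact: mpowR.
    exact: measurable_dual_weight.
  have m2 : measurable_fun D (fun x => (U2 x `^ q)%:E * (w x)%:E)%E.
    by apply: emeasurable_funM; [apply/measurable_EFinP; exact: mpowR|exact: mwE].
  have n1 x : D x -> (0 <= (U1 x `^ q')%:E * (s x)%:E)%E.
    by move=> Dx; rewrite -EFinM lee_fin mulr_ge0 ?powR_ge0.
  have n2 x : D x -> (0 <= (U2 x `^ q)%:E * (w x)%:E)%E.
    by move=> Dx; rewrite -EFinM lee_fin mulr_ge0 ?powR_ge0// ltW// w0.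
  rewrite -ge0_integralZl_EFin ?(ltW e0)// -ge0_integralZl_EFin ?powR_ge0//.
  rewrite -ge0_integralD//; last 4 first.
  - by move=> x Dx; rewrite mule_ge0 ?n1// lee_fin ltW.
  - exact: measurable_funeM.
  - by move=> x Dx; rewrite mule_ge0 ?n2// lee_fin powR_ge0.
  - exact: measurable_funeM.
  apply: ge0_le_integral => //.
  - by apply: emeasurable_funD; exact: measurable_funeM.
  - move=> x Dx; rewrite -!EFinM -EFinD lee_fin.
    by apply: young_weight => //; rewrite ?w0 ?U10 ?U20.
have Y0 : (0 <= Y)%E.
  by apply: integral_ge0 => x Dx; rewrite mule_ge0 ?poweR_ge0// lee_fin ltW// w0.
have Z0 : (0 <= Z)%E.
  by apply: integral_ge0 => x Dx; rewrite mule_ge0 ?poweR_ge0// lee_fin ltW// w0.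
move: Y1 I3; clearbody Y Z I; move: Y Z I Y0 Z0 I0 Yfin Zfin {nU1 nU2 FvI hyp I1 I2}.
move=> [y| |] [z| |] [i| |]//; rewrite ?lee_fin => y0 z0 i0 _ _.
- move=> Y1 I3.
  have h : y <= (1 + C) * (e * (2 * y) + e `^ (1 - q) * (2 * z)).
    apply: (le_trans Y1); rewrite -{1}(mul1r i) -mulrDl.
    by rewrite ler_pM2l.
  have -> : (4 * (1 + C)) `^ q = 4 * (1 + C) * e `^ (1 - q).
    rewrite /e powRV ?mulr_ge0 ?(ltW C10)// -powRN opprB.
    by rewrite mulr_powRB1// mulr_ge0 ?(ltW C10).
  have h' : (1 + C) * (e * (2 * y)) = y / 2.
    by rewrite /e; field; rewrite !gt_eqF.
  by move: h; rewrite mulrDr h'; set E := e `^ _; lra.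
Qed.

Lemma weight_ball_lty x r : D x -> 0 < r -> (\int[mu]_(y in B x r) (w y)%:E < +oo)%E.
Proof. exact: (dw_lty (muckenhoupt_doubling DS q1 mw)). Qed.

(* F and the truncations of G are raised to at least e on a fixed ball, so that
   the A_1 majorants do not vanish; then e tends to 0. *)
Theorem extrapolation (C : R) (F G : T -> \bar R) : 0 <= C ->
  measurable_fun D F -> measurable_fun D G ->
  (forall x, D x -> (0 <= F x)%E) -> (forall x, D x -> (0 <= G x)%E) ->
  (forall v, muckenhoupt D rho mu p L v ->
    (\int[mu]_(x in D) (G x * (v x)%:E) <=
     C%:E * \int[mu]_(x in D) (F x * (v x)%:E))%E) ->
  (\int[mu]_(x in D) (G x `^ (q / p) * (w x)%:E) <=
   ((4 * (2 + C)) `^ q)%:E * \int[mu]_(x in D) (F x `^ (q / p) * (w x)%:E))%E.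
Proof.
move=> C0 mF mG F0 G0 hyp.
have [D0|/set0P[x0 Dx0]] := eqVneq D set0.
  by rewrite D0 !integral_set0 mule0.
have qp0 : 0 < q / p by rewrite divr_gt0.
set Z := (\int[mu]_(x in D) (F x `^ (q / p) * (w x)%:E))%E.
pose A : R := (4 * (2 + C)) `^ q.
have A0 : 0 < A by rewrite powR_gt0// mulr_gt0// ltr_pwDl.
have wE0 x : D x -> (0 <= (w x)%:E)%E by move=> /w0 /ltW; rewrite lee_fin.
have mpw (f : T -> \bar R) : measurable_fun D f ->
    measurable_fun D (fun x => f x `^ (q / p) * (w x)%:E)%E.
  by move=> mf; apply: emeasurable_funM; [exact: mpow|exact: mwE].
have pw0 (f : T -> \bar R) x : D x -> (0 <= f x `^ (q / p) * (w x)%:E)%E.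
  by move=> Dx; rewrite mule_ge0 ?poweR_ge0 ?wE0.
have Z0 : (0 <= Z)%E by apply: integral_ge0 => x; exact: pw0.
have [/eqP Zoo|] := boolP (Z == +oo%E); first by rewrite Zoo gt0_muley ?leey// lte_fin.
rewrite -ltey => Zfin.
have mB0 := measurable_qball DS Dx0 (@ltr01 R).
set b := (\int[mu]_(y in B x0 1) (w y)%:E)%E.
have b0 : (0 < b)%E by apply: (weight_ball_gt0 DS (muckenhoupt_doubling DS q1 mw)).
have bfin : (b < +oo)%E by exact: weight_ball_lty.
have key (e : R) : 0 < e ->
    (\int[mu]_(x in D) (G x `^ (q / p) * (w x)%:E) <=
     A%:E * (Z + (e `^ (q / p))%:E * b))%E.
  move=> e0; pose P : T -> \bar R := (cst e%:E) \_ (B x0 1).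
  have restr (f : T -> \bar R) r : 0 < r -> measurable_fun D f ->
      measurable_fun D (f \_ (B x0 r)).
    move=> r0 mf; apply/measurable_restrict => //; first exact: (measurable_qball DS).
    by apply: measurable_funS mf => //; exact: subIsetl.
  have restrE (f : T -> \bar R) r : 0 < r ->
      (\int[mu]_(x in D) (f \_ (B x0 r)) x = \int[mu]_(x in B x0 r) f x)%E.
    by move=> r0; rewrite -integral_mkcondr setIidr//; exact: qball_subset.
  have mP : measurable_fun D P by exact: restr.
  have P0 x : (0 <= P x)%E by rewrite /P patchE; case: ifPn => // _; rewrite lee_fin ltW.
  have PB x : B x0 1 x -> P x = e%:E by move=> xB; rewrite /P patchE mem_set.
  have Pe x : (P x <= e%:E)%E.
    by rewrite /P patchE; case: ifPn => // _; rewrite lee_fin ltW.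
  pose F' x := maxe (F x) (P x).
  (* Truncated in height and in space, so that the integral to be absorbed is finite. The radius
     [n+1] makes the support contain the unit ball already for [n = 0]. *)
  pose G' n : T -> \bar R :=
    (fun x => maxe (mine (G x) n%:R%:E) (P x)) \_ (B x0 n.+1%:R).
  have mF' : measurable_fun D F' by exact: measurable_maxe.
  have mG' n : measurable_fun D (G' n).
    by apply: restr => //; apply: measurable_maxe => //; exact: measurable_mine.
  have F'0 x : D x -> (0 <= F' x)%E by move=> Dx; rewrite le_max F0.
  have G'0 n x : (0 <= G' n x)%E.
    by rewrite /G' patchE; case: ifPn => // _; rewrite le_max P0 orbT.
  have F'Z : (\int[mu]_(x in D) (F' x `^ (q / p) * (w x)%:E) <=
      Z + (e `^ (q / p))%:E * b)%E.
    have -> : ((e `^ (q / p))%:E * b = \int[mu]_(x in D) (P x `^ (q / p) * (w x)%:E))%E.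
      rewrite -ge0_integralZl_EFin ?powR_ge0//; last 2 first.
      - by move=> x [Dx _]; exact: wE0.
      - by apply: measurable_funS mwE => //; exact: qball_subset.
      rewrite -restrE//; apply: eq_integral => x _.
      rewrite patchE; case: ifPn => [/set_mem xB|xB]; first by rewrite PB// poweR_EFin.
      by rewrite /P patchE (negbTE xB) poweR0r ?mul0e// gt_eqF.
    rewrite -ge0_integralD//; [|by move=> x; exact: pw0|exact: mpw|
      by move=> x; exact: pw0|exact: mpw].
    apply: ge0_le_integral => //.
    - by move=> x; exact: pw0.
    - exact: mpw.
    - by apply: emeasurable_funD; exact: mpw.
    - move=> x Dx; rewrite -ge0_muleDl ?poweR_ge0//; apply: lee_wpmul2r; first exact: wE0.
      rewrite /F'; case: (leP (F x)) => _.
        by rewrite leeDr ?poweR_ge0.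
      by rewrite leeDl ?poweR_ge0.
  have C1 : 0 <= 1 + C by rewrite addr_ge0.
  have G'bound n : (\int[mu]_(x in D) (G' n x `^ (q / p) * (w x)%:E) <=
      A%:E * (Z + (e `^ (q / p))%:E * b))%E.
    apply: (@le_trans _ _ (A%:E * \int[mu]_(x in D) (F' x `^ (q / p) * (w x)%:E))%E); last first.
      by apply: lee_wpmul2l => //; rewrite lee_fin ltW.
    (* Since [P <= F'], raising [G] adds 1 to the constant of the hypothesis: the core is applied
       with [1 + C], whence [2 + C]. *)
    rewrite /A -[2]/(1 + 1) -addrA.
    apply: (extrapolation_core C1 Dx0 mF' (mG' n) F'0) => //.
    - by move=> x xB; rewrite lt_max PB// lte_fin e0 orbT.
    - move=> x xB; rewrite /G' patchE mem_set.
        by rewrite lt_max PB// lte_fin e0 orbT.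
      case: xB => Dx x1; split => //; apply: (lt_le_trans x1).
      by rewrite -[leLHS]/(1%:R) ler_nat.
    - move=> v mv; have v0 x : D x -> (0 <= (v x)%:E)%E.
        by move=> Dx; rewrite lee_fin ltW// (mw_gt0 mv).
      have mvE : measurable_fun D (EFin \o v).
        by apply/measurable_EFinP; exact: mw_measurable mv.
      have mm (f : T -> \bar R) : measurable_fun D f ->
        measurable_fun D (fun x => f x * (v x)%:E)%E by move=> mf; exact: emeasurable_funM.
      have m0 (f : T -> \bar R) : (forall x, D x -> 0 <= f x)%E ->
        (forall x, D x -> 0 <= f x * (v x)%:E)%E.
        by move=> f0 x Dx; rewrite mule_ge0 ?f0 ?v0.
      have Fv0 : (0 <= \int[mu]_(x in D) (F' x * (v x)%:E))%E.
        by apply: integral_ge0; exact: m0.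
      apply: (@le_trans _ _ (\int[mu]_(x in D) (P x * (v x)%:E) +
          \int[mu]_(x in D) (G x * (v x)%:E))%E).
        rewrite -ge0_integralD//; [|by apply: m0|exact: mm|exact: m0|exact: mm].
        apply: ge0_le_integral => //.
        - by apply: m0.
        - exact: mm.
        - by apply: emeasurable_funD; exact: mm.
        - move=> x Dx; rewrite -ge0_muleDl ?G0//; apply: lee_wpmul2r; first exact: v0.
          rewrite /G' patchE; case: ifPn => _; last by rewrite adde_ge0 ?G0.
          by rewrite ge_max ge_min leeDl ?leeDr ?G0.
      rewrite EFinD ge0_muleDl// mul1e; apply: leeD.
        apply: ge0_le_integral => //; [by apply: m0|exact: mm|exact: mm|].
        by move=> x Dx; apply: lee_wpmul2r; [exact: v0|rewrite /F' le_max lexx orbT].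
      apply: (le_trans (hyp v mv)); apply: lee_wpmul2l => //.
      apply: ge0_le_integral => //; [exact: m0|exact: mm|exact: mm|].
      by move=> x Dx; apply: lee_wpmul2r; [exact: v0|rewrite /F' le_max lexx].
    - apply: (le_lt_trans F'Z); rewrite lte_add_pinfty// lte_mul_pinfty//.
      by rewrite lee_fin powR_ge0.
    - pose k := Num.max n%:R e; have k0 : 0 <= k by rewrite le_max ler0n.
      apply: (@le_lt_trans _ _ (\int[mu]_(x in D)
          ((fun x => (k `^ (q / p))%:E * (w x)%:E) \_ (B x0 n.+1%:R)) x)%E).
        apply: ge0_le_integral => //.
        - by move=> x; exact: pw0.
        - exact: mpw.
        - by apply: restr => //; exact: measurable_funeM.
        - move=> x Dx; rewrite /G' !patchE; case: ifPn => _; last first.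
            by rewrite poweR0r ?mul0e// gt_eqF.
          rewrite -poweR_EFin; apply: lee_wpmul2r; first exact: wE0.
          apply: le_poweR; rewrite ?(ltW qp0)//; first by rewrite le_max P0 orbT.
          by rewrite ge_max ge_min /k EFin_max !le_max lexx Pe !orbT.
      rewrite restrE// ge0_integralZl_EFin ?powR_ge0//.
      + by rewrite lte_mul_pinfty// ?lee_fin ?powR_ge0// weight_ball_lty.
      + exact: (measurable_qball DS).
      + by move=> x [Dx _]; exact: wE0.
      + by apply: measurable_funS mwE => //; exact: qball_subset.
  apply: (@integral_le_sup _ _ _ _ _ (fun n x => G' n x `^ (q / p) * (w x)%:E)%E) => //.
  - by move=> n; exact: mpw.
  - exact: mpw.
  - by move=> n x; exact: pw0.
  - by move=> x; exact: pw0.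
  - move=> n x Dx; apply: lee_wpmul2r; first exact: wE0.
    apply: le_poweR => //; first exact: ltW.
    rewrite {1}/G' patchE; case: ifPn => [/set_mem[_ xn]|]; last by [].
    rewrite /G' patchE mem_set; last first.
      by split => //; rewrite (lt_le_trans xn)// ler_nat.
    rewrite ge_max !le_max lexx orbT andbT le_min !ge_min lexx/=.
    by rewrite lee_fin ler_nat leqnSn orbT.
  - move=> x Dx; set S := ereal_sup _; have wx := w0 Dx.
    rewrite -lee_pdivlMr//.
    have S0 : (0 <= S * ((w x)^-1)%:E)%E.
      rewrite mule_ge0 ?lee_fin ?invr_ge0 ?(ltW wx)//.
      apply: le_ereal_sup_tmp; exists (G' 0%N x `^ (q / p) * (w x)%:E)%E; first by exists 0%N.
      exact: pw0.
    rewrite le_poweR_inv ?G0//; set Y := (_ `^ _)%E.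
    have Gn n : rho x0 x < n.+1%:R -> (mine (G x) n%:R%:E <= Y)%E.
      move=> xn; apply: (@le_trans _ _ (G' n x)).
        by rewrite /G' patchE mem_set// le_max lexx.
      rewrite -le_poweR_inv// lee_pdivlMr//.
      by apply: ereal_sup_ubound; exists n.
    have : (0 <= Y)%E by exact: poweR_ge0.
    move: Gn; case: Y => [y| |]//; last by move=> _ _; rewrite leey.
    move=> Gn _; pose n := (Num.truncn (rho x0 x) + Num.truncn y).+1.
    have xn : rho x0 x < n.+1%:R.
      by rewrite (lt_le_trans (truncnS_gt _))// ler_nat /n ltnS leqW// leq_addr.
    have yn : y < n%:R.
      by rewrite (lt_le_trans (truncnS_gt _))// ler_nat /n ltnS leq_addl.
    by have := Gn n xn; rewrite ge_min => /orP[//|]; rewrite lee_fin leNgt yn.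
apply/lee_addgt0Pr => e e0; have bf : b \is a fin_num by rewrite ge0_fin_numE ?ltW.
have bE : b = (fine b)%:E by rewrite fineK.
have fb0 : 0 < fine b by rewrite fine_gt0// b0 bfin.
(* Raising to the height [t^(p/q)] makes the error [A t b] equal to the prescribed [e]. *)
pose t := e / (A * fine b); have t0 : 0 < t by rewrite divr_gt0 ?mulr_gt0.
apply: (le_trans (key (t `^ (q / p)^-1) (powR_gt0 _ t0))).
rewrite -powRrM mulVf ?gt_eqF// powRr1 ?(ltW t0)//.
rewrite ge0_muleDr//; last by rewrite mule_ge0 ?(ltW b0)// lee_fin ltW.
apply: leeD => //; rewrite bE -!EFinM lee_fin /t.
by rewrite le_eqVlt; apply/orP; left; apply/eqP; field; rewrite !gt_eqF.
Qed.

End FixedWeight.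

End Extrapolation.

(** * A_p weights in the extended-real form *)

Section ApWeights.
Context (R : realType) (d : measure_display) (T : measurableType d).
Context (D : set T) (rho : T -> T -> R) (mu : {measure set T -> \bar R}).
Context (K1 K2 : R) (DS : doubling_space D rho mu K1 K2).
Local Notation B := (qball D rho).

Let mD : measurable D. Proof. exact: ds_measurable DS. Qed.

Lemma muckenhoupt_Ap (p K : R) (v : T -> R) : 1 < p ->
  muckenhoupt D rho mu p K v ->
  Ap_weight D rho mu p v /\ (Ap_const D rho mu p v <= K%:E)%E.
Proof.
move=> p1 mv; have p10 : 0 < p - 1 by rewrite subr_gt0.
have le : (Ap_const D rho mu p v <= K%:E)%E.
  apply: ge_ereal_sup => _ [x [r [Dx r0 ->]]].
  have [a [b [m [a0 b0 m0 [ae be me h]]]]] := muckenhoupt_ball DS p1 mv Dx r0.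
  rewrite /average me ae (_ : (\int[mu]_(y in B x r) _)%E = b%:E); last first.
    rewrite -be; apply: eq_integral => y /set_mem [Dy _].
    by rewrite poweR_EFin inver gt_eqF ?powR_gt0 ?(mw_gt0 mv)// -powRN.
  rewrite inver gt_eqF// -(EFinM m^-1 b) poweR_EFin -!EFinM lee_fin.
  rewrite powRM ?invr_ge0 ?(ltW m0) ?(ltW b0)// powRV ?(ltW m0)//.
  rewrite (_ : _ * _ = a * b `^ (p - 1) / (m * m `^ (p - 1))); last first.
    by field; rewrite !gt_eqF ?powR_gt0.
  by rewrite mulr_powRB1 ?(ltW m0) ?(lt_trans ltr01)// ler_pdivrMr ?powR_gt0.
split => //; split; last exact: (le_lt_trans le (ltry _)).
- by move=> x Dx; rewrite ltW// (mw_gt0 mv).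
- exact: mw_measurable mv.
Qed.

(** The balls about [x0] exhaust [D]. Having all larger radii as well lets one ball charge two sets
    at once. *)
Lemma exists_charged_ball (E : set T) x0 : D x0 -> measurable E -> E `<=` D ->
  (0 < mu E)%E ->
  exists n, forall k, (n <= k)%N -> (0 < mu (E `&` B x0 k.+1%:R))%E.
Proof.
move=> Dx0 mE ED E0; apply: contrapT => no.
have mB n : measurable (B x0 n.+1%:R) by apply: (measurable_qball DS).
have null n : mu (E `&` B x0 n.+1%:R) = 0%E.
  apply: contrapT => /eqP nz; apply: no; exists n => k nk.
  have pos : (0 < mu (E `&` B x0 n.+1%:R))%E by rewrite lt_def nz measure_ge0.
  apply: (lt_le_trans pos); apply: le_measure; rewrite ?inE; try exact: measurableI.
  by apply: setIS => y [Dy yn]; split => //; rewrite (lt_le_trans yn)// ler_nat.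
have : mu.-negligible E.
  apply: (@negligibleS _ _ _ mu (\bigcup_n (E `&` B x0 n.+1%:R))).
    move=> x Ex; exists (Num.truncn (rho x0 x)) => //; split => //.
    by split; [exact: ED|exact: truncnS_gt].
  apply: negligible_bigcup => n; apply/negligibleP; [exact: measurableI|exact: null].
by move/negligibleP => /(_ mE) E0'; rewrite E0' ltxx in E0.
Qed.

Definition positive_part_weight (w : T -> R) (x : T) : R :=
  if 0 < w x then w x else 1.

(* As w^(-1/(p-1)) = +oo where w = 0, an A_p weight vanishing on a set of positive
   measure vanishes almost everywhere; otherwise it may be changed to 1 on its null
   set of zeros. *)
Lemma Ap_muckenhoupt (p K : R) (w : T -> R) : 1 < p ->
  Ap_weight D rho mu p w -> (Ap_const D rho mu p w <= K%:E)%E ->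
  {ae mu, forall x, D x -> w x = 0} \/
  ({ae mu, forall x, D x -> w x = positive_part_weight w x} /\
   muckenhoupt D rho mu p (Num.max 1 K) (positive_part_weight w)).
Proof.
move=> p1 [w0 mw _] wK; have p10 : 0 < p - 1 by rewrite subr_gt0.
have [D0|/set0P[x0 Dx0]] := eqVneq D set0.
  by left; apply: aeW => x; rewrite D0.
have mwE : measurable_fun D (EFin \o w) by exact/measurable_EFinP.
pose E1 := D `&` [set x | (0 < (w x)%:E)%E].
pose E0 := D `&` [set x | ((w x)%:E <= 0)%E].
have mE1 : measurable E1 by exact: emeasurable_fun_o_infty.
have mE0 : measurable E0 by exact: emeasurable_fun_infty_c.
(* The dual weight with its value [+oo] at the zeros of [w]; [hE] identifies its integrals with
   those in [Ap_const]. *)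
pose h y : \bar R := if (0 < (w y)%:E)%E then (w y `^ (- (p - 1)^-1))%:E else +oo%E.
have mh : measurable_fun D h.
  apply: measurable_fun_if => //; first exact: measurable_fun_lte.
  apply/measurable_EFinP; apply: (measurableT_comp (measurable_powR _)).
  by apply: measurable_funS mw => //; exact: subIsetl.
have h0 y : (0 <= h y)%E by rewrite /h; case: ifPn; rewrite ?leey// lee_fin powR_ge0.
have hE x r : (\int[mu]_(y in B x r) ((w y)%:E `^ (p - 1)^-1)^-1 =
               \int[mu]_(y in B x r) h y)%E.
  apply: eq_integral => y /set_mem [Dy _]; rewrite /h poweR_EFin lte_fin.
  case: ifPn => wy; first by rewrite inver gt_eqF ?powR_gt0// -powRN.
  have -> : w y = 0 by apply/eqP; move: wy; rewrite lt_def w0// andbT negbK.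
  by rewrite powR0 ?inve0// invr_eq0 gt_eqF.
have [E10|E1n] := eqVneq (mu E1) 0%E.
  left; exists E1; split => // x /= /not_implyP[Dx wx]; split => //=.
  by rewrite lte_fin lt_def w0// andbT; apply/eqP.
have ae_eqw : mu E0 = 0%E ->
    {ae mu, forall x, D x -> w x = positive_part_weight w x}.
  move=> E00; exists E0; split => // x /= /not_implyP[Dx].
  rewrite /positive_part_weight; case: ifPn => // wx _; split => //=.
  by rewrite lee_fin leNgt.
have [E00|E0n] := eqVneq (mu E0) 0%E; last first.
  have [||n1 c1] := @exists_charged_ball E1 x0 Dx0 mE1; first by move=> x [].
    by rewrite lt_def E1n measure_ge0.
  have [||n0 c0] := @exists_charged_ball E0 x0 Dx0 mE0; first by move=> x [].
    by rewrite lt_def E0n measure_ge0.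
  (* On a ball charging both [w > 0] and [w = 0], the mean of [w] is positive and that of the dual
     weight is [+oo], which would make [Ap_const] infinite. *)
  pose k := maxn n0 n1; set r : R := k.+1%:R.
  have r0 : 0 < r by rewrite ltr0n.
  have {}c1 := c1 k (leq_maxr _ _); have {}c0 := c0 k (leq_maxl _ _).
  have mB := measurable_qball DS Dx0 r0.
  have BD : B x0 r `<=` D by exact: qball_subset.
  have [m m0 me] := ball_fin DS Dx0 r0.
  exfalso; have : (+oo <= K%:E :> \bar R)%E; last by rewrite leye_eq.
  apply: le_trans wK; rewrite le_eqVlt; apply/orP; left; apply/eqP/esym.
  apply: ereal_supy; exists x0, r; split => //.
  rewrite /average me inver gt_eqF//.
  rewrite hE (_ : \int[mu]_(y in B x0 r) h y = +oo)%E; last first.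
    apply/eqP; rewrite -leye_eq.
    apply: (@le_trans _ _ (\int[mu]_(y in E0 `&` B x0 r) (cst +oo%E) y)%E).
      by rewrite integral_cst ?gt0_mulye//; exact: measurableI.
    rewrite (eq_integral h); last first.
      move=> y /set_mem [[Dy wy] _]; rewrite /h ifF//.
      by apply/negbTE; rewrite -leNgt.
    apply: ge0_subset_integral => //; first exact: measurableI.
    exact: (measurable_funS mD BD).
  rewrite gt0_muley ?lte_fin ?invr_gt0// poweRyr ?gt_eqF// gt0_muley//.
  apply: mule_gt0; first by rewrite lte_fin invr_gt0.
  apply: (@lt_le_trans _ _ (\int[mu]_(y in E1 `&` B x0 r) (w y)%:E)%E).
    apply: ge0_integral_gt0 c1 => //; first exact: measurableI.
      by apply: measurable_funS mwE => // y [[]].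
    by move=> y [[_ wy] _].
  apply: ge0_subset_integral => //; first exact: measurableI.
    exact: (measurable_funS mD BD).
  by move=> y /BD; rewrite lee_fin; exact: w0.
have aew := ae_eqw E00; right; split => //.
set v := positive_part_weight w.
have v0 x : D x -> 0 < v x by move=> _; rewrite /v /positive_part_weight; case: ifPn.
have mv : measurable_fun D v.
  apply: measurable_fun_if => //; first exact: measurable_fun_ltr.
  by apply: measurable_funS mw => //; exact: subIsetl.
split => //; first by rewrite lt_max ltr01.
move=> x r Dx r0; have mB := measurable_qball DS Dx r0.
have BD : B x r `<=` D by exact: qball_subset.
have [m m0 me] := ball_fin DS Dx r0.
have aeB (P : T -> Prop) : {ae mu, forall y, D y -> P y} -> {ae mu, forall y, B x r y -> P y}.
  by apply: filterS => y + /BD.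
have mvB : measurable_fun (B x r) (EFin \o v).
  by apply/measurable_EFinP; exact: (measurable_funS mD BD).
have -> : (\int[mu]_(y in B x r) (v y)%:E = \int[mu]_(y in B x r) (w y)%:E)%E.
  apply: ge0_ae_eq_integral => //.
  - exact: (measurable_funS mD BD).
  - by move=> y /BD /v0 /ltW; rewrite lee_fin.
  - by move=> y /BD /w0; rewrite lee_fin.
  - by apply: filterS (aeB _ aew) => y + By => /(_ By) ->.
have -> : (\int[mu]_(y in B x r) (dual_weight p v y)%:E = \int[mu]_(y in B x r) h y)%E.
  apply: ge0_ae_eq_integral => //.
  - apply/measurable_EFinP; apply: (measurable_funS mD BD).
    exact: measurable_dual_weight.
  - exact: (measurable_funS mD BD).
  - by move=> y _; rewrite lee_fin powR_ge0.
  - apply: filterS (aeB _ aew) => y + By => /(_ By) wv.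
    by rewrite /h lte_fin wv v0//; exact: BD.
have : (average mu (B x r) (fun y => (w y)%:E) *
    average mu (B x r) (fun y => ((w y)%:E `^ (p - 1)^-1)^-1) `^ (p - 1) <= K%:E)%E.
  by apply: le_trans wK; apply: ereal_sup_ubound; exists x, r.
rewrite /average hE me inver gt_eqF//.
set a := (\int[mu]_(y in B x r) (w y)%:E)%E; set b := (\int[mu]_(y in B x r) h y)%E.
have a0 : (0 <= a)%E by apply: integral_ge0 => y /BD /w0; rewrite lee_fin.
have b0 : (0 <= b)%E by apply: integral_ge0 => y _; exact: h0.
rewrite poweRM ?lee_fin ?invr_ge0 ?(ltW m0)// !poweR_EFin powRV ?(ltW m0)//.
rewrite muleACA -EFinM -invfM mulr_powRB1 ?(ltW m0) ?(lt_trans ltr01)//.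
rewrite lee_pdivrMl ?powR_gt0// => h1; apply: (le_trans h1).
rewrite muleC; apply: lee_wpmul2r; first by rewrite lee_fin powR_ge0.
by rewrite lee_fin le_max lexx orbT.
Qed.

Lemma maximal_functionE (f : T -> R) x :
  maximal_function D rho mu f x = wmax D rho mu (cst 1) (fun z => `|f z|%:E) x.
Proof.
rewrite /maximal_function /wmax; congr ereal_sup; apply/seteqP; split => a.
  move=> [y [r [Dy r0 xy ->]]]; exists y, r; split => //.
  by rewrite integral_cst1//; exact: (measurable_qball DS).
move=> [y [r [Dy r0 xy ->]]]; exists y, r; split => //.
by rewrite integral_cst1//; exact: (measurable_qball DS).
Qed.

Lemma maximal_function_ge0 (f : T -> R) x : D x ->
  (0 <= maximal_function D rho mu f x)%E.
Proof.
move=> Dx; rewrite maximal_functionE; exact: (wmax_ge0 DS).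
Qed.

Lemma measurable_maximal_function (f : T -> R) :
  measurable_fun D (maximal_function D rho mu f).
Proof.
rewrite (_ : maximal_function D rho mu f = wmax D rho mu (cst 1) (fun z => `|f z|%:E)).
  exact: (measurable_wmax DS (doubling_weight1 DS)).
by apply/funext => x; exact: maximal_functionE.
Qed.

(** If [w] vanishes almost everywhere, the left side is zero; otherwise a positive representative
    changes neither integral. [max 1 K] supplies the positive constant that [muckenhoupt]
    demands. *)
Theorem maximal_function_Ap (p K : R) (w : T -> R) (f : T -> R) : 1 < p ->
  Ap_weight D rho mu p w -> (Ap_const D rho mu p w <= K%:E)%E ->
  measurable_fun D f ->
  (\int[mu]_(x in D) (maximal_function D rho mu f x `^ p * (w x)%:E) <=
   (muckenhoupt_const K1 K2 p (Num.max 1 K))%:E *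
   \int[mu]_(x in D) (`|f x|%:E `^ p * (w x)%:E))%E.
Proof.
move=> p1 wAp wK mf; have [w0 mw _] := wAp.
have mwE : measurable_fun D (EFin \o w) by exact/measurable_EFinP.
have mfE : measurable_fun D (fun x => `|f x|%:E).
  by apply/measurable_EFinP; exact: measurableT_comp.
have mM := measurable_maximal_function f.
have N0 := muckenhoupt_const_ge0 K1 K2 (Num.max 1 K) p1.
have mpw (g : T -> \bar R) (v : T -> R) : measurable_fun D g -> measurable_fun D v ->
    measurable_fun D (fun x => g x `^ p * (v x)%:E)%E.
  move=> mg mv; apply: emeasurable_funM; last exact/measurable_EFinP.
  exact: (measurableT_comp (measurable_poweR _)).
have pw0 (g : T -> \bar R) (v : T -> R) : (forall x, D x -> 0 <= v x) ->
    forall x, D x -> (0 <= g x `^ p * (v x)%:E)%E.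
  by move=> v0 x Dx; rewrite mule_ge0 ?poweR_ge0// lee_fin v0.
have [ae0|[aew mv]] := Ap_muckenhoupt p1 wAp wK.
  rewrite (@ge0_ae_eq_integral _ _ _ _ D _ (cst 0%E)) ?integral0//; last 3 first.
  - exact: mpw.
  - exact: pw0.
  - by apply: filterS ae0 => x + Dx => /(_ Dx) ->; rewrite mule0.
  by rewrite mule_ge0 ?lee_fin// integral_ge0//; exact: pw0.
have v0 x : D x -> 0 <= positive_part_weight w x by move=> Dx; rewrite ltW// (mw_gt0 mv).
have mv' := mw_measurable mv.
have sw (g : T -> \bar R) : measurable_fun D g ->
    (\int[mu]_(x in D) (g x `^ p * (w x)%:E) =
     \int[mu]_(x in D) (g x `^ p * (positive_part_weight w x)%:E))%E.
  move=> mg; apply: ge0_ae_eq_integral => //; [exact: mpw|exact: mpw|exact: pw0|exact: pw0|].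
  by apply: filterS aew => x + Dx => /(_ Dx) <-.
rewrite sw// sw//.
have f0 x : D x -> (0 <= `|f x|%:E)%E by rewrite lee_fin.
apply: le_trans (muckenhoupt_maximal DS p1 mv mfE f0).
rewrite le_eqVlt; apply/orP; left; apply/eqP; apply: eq_integral => x _.
by rewrite maximal_functionE.
Qed.

End ApWeights.

(** * Fubini's theorem for the completed product *)

Section Completion.
Context (R : realType) (d : measure_display) (T : measurableType d).
Context (mu : {measure set T -> \bar R}).
Local Notation CT := (caratheodory_type (mu^*)%mu).

(** Countable covers of measure within [1/(n+1)] of the outer measure, intersected over [n]. *)
Lemma measurable_hull (E : set T) : ((mu^*)%mu E < +oo)%E ->
  exists G, [/\ measurable G, E `<=` G & mu G = (mu^*)%mu E].
Proof.
move=> Eoo; have E0 : (0 <= (mu^*)%mu E)%E by exact: mu_ext_ge0.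
have Ef : (mu^*)%mu E \is a fin_num by rewrite ge0_fin_numE.
have ex n : exists G, [/\ measurable G, E `<=` G &
    (mu G <= (mu^*)%mu E + (n.+1%:R^-1)%:E)%E].
  have n0 : 0 < n.+1%:R^-1 :> R by rewrite invr_gt0.
  have [_ [A [mA EA] <-] lt] := lb_ereal_inf_adherent n0 Ef.
  exists (\bigcup_k A k); split => //; first exact: bigcup_measurable.
  apply: le_trans (ltW lt).
  apply: (@measure_sigma_subadditive _ _ _ mu) => //; exact: bigcup_measurable.
have [G hG] := choice ex.
exists (\bigcap_n G n); split.
- by apply: bigcap_measurable => // n _; have [] := hG n.
- by move=> x Ex n _; have [_ + _] := hG n; apply.
- have mG : measurable (\bigcap_n G n).
    by apply: bigcap_measurable => // n _; have [] := hG n.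
  apply/eqP; rewrite eq_le; apply/andP; split; last first.
    rewrite -(measurable_mu_extE mu mG); apply: le_mu_ext => x Ex n _.
    by have [_ + _] := hG n; apply.
  apply/lee_addgt0Pr => e e0.
  pose n := Num.truncn e^-1.
  have [mGn _ h] := hG n.
  apply: (@le_trans _ _ (mu (G n))).
    by apply: le_measure; rewrite ?inE//; exact: bigcap_inf.
  apply: (le_trans h); apply: leeD => //; rewrite lee_fin.
  by rewrite invf_ple ?posrE// ltW// truncnS_gt.
Qed.

(** On each piece [F k] of finite measure, a measurable hull exceeds [A] by an outer null set, which
    has a null hull in turn; sigma-finiteness glues the pieces. *)
Lemma completed_set_approx (A : set CT) : sigma_finite [set: T] mu ->
  measurable A -> exists A' N : set T, [/\ measurable A', measurable N, mu N = 0%E,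
    A `<=` A' & A' `\` A `<=` N].
Proof.
move=> [F FT mF] mA.
have ex k : exists P : set T * set T, [/\ measurable P.1, measurable P.2,
    mu P.2 = 0%E, A `&` F k `<=` P.1 & P.1 `\` (A `&` F k) `<=` P.2].
  have [mFk Fkoo] := mF k.
  have mAk : (mu^*)%mu.-cara.-measurable (A `&` F k).
    by apply: caratheodory_measurable_setI => //; exact: caratheodory_measurable_mu_ext.
  have Akoo : ((mu^*)%mu (A `&` F k) < +oo)%E.
    apply: le_lt_trans Fkoo; rewrite -(measurable_mu_extE mu mFk).
    by apply: le_mu_ext; exact: subIsetr.
  have Akf : (mu^*)%mu (A `&` F k) \is a fin_num by rewrite ge0_fin_numE ?mu_ext_ge0.
  have [G [mG AG Ge]] := measurable_hull Akoo.
  (* Caratheodory's condition is tested on the hull [G]: its measure is already the finite outer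
     measure of the piece, so the difference gets zero. *)
  have D0 : (mu^*)%mu (G `\` (A `&` F k)) = 0%E.
    have := mAk G; rewrite /= (measurable_mu_extE mu mG) Ge (setIidr AG) -setDE.
    move: Akf; case: ((mu^*)%mu (A `&` F k)) => // a _.
    case: ((mu^*)%mu (G `\` (A `&` F k))) => // b [].
    by move=> /eqP; rewrite -subr_eq0 opprD addNKr oppr_eq0 => /eqP ->.
  have Doo : ((mu^*)%mu (G `\` (A `&` F k)) < +oo)%E by rewrite D0.
  have [N [mN DN N0]] := measurable_hull Doo.
  exists (G, N); split => //=; by rewrite N0 D0.
have [P hP] := choice ex.
exists (\bigcup_k (P k).1), (\bigcup_k (P k).2); split.
- by apply: bigcup_measurable => k _; have [] := hP k.
- by apply: bigcup_measurable => k _; have [] := hP k.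
- apply/negligibleP; first by apply: bigcup_measurable => k _; have [] := hP k.
  apply: negligible_bigcup => k; have [_ m2 z _ _] := hP k.
  by apply/negligibleP.
- move=> x Ax; have [k _ Fx] : (\bigcup_k F k) x by rewrite -FT.
  by exists k => //; have [_ _ _ + _] := hP k; apply.
- move=> x [[k _ Px] nA]; exists k => //; have [_ _ _ _] := hP k; apply.
  by split => // -[].
Qed.

Lemma measurable_to_completed (f : T -> \bar R) : measurable_fun setT f ->
  measurable_fun setT (f : CT -> \bar R).
Proof.
move=> mf _ Y mY; rewrite setTI; apply: caratheodory_measurable_mu_ext.
by rewrite -[_ @^-1` _]setTI; exact: mf.
Qed.

(** A nonnegative function is the supremum of the rational levels below it. Each superlevel set is
    replaced by a measurable superset with null excess, and [g'] can differ from [g] only on the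
    union of the null sets holding the excesses. *)
Lemma completed_fun_approx (g : CT -> \bar R) : sigma_finite [set: T] mu ->
  measurable_fun setT g -> (forall x, (0 <= g x)%E) ->
  exists (g' : T -> \bar R) (N : set T), [/\ measurable_fun setT g',
    forall x, (0 <= g' x)%E, measurable N, mu N = 0%E &
    forall x, ~ N x -> g x = g' x].
Proof.
move=> sf mg g0.
pose qn n : R := ratr (odflt (0 : rat) (unpickle n)).
have qnE (q : rat) : exists n, qn n = ratr q.
  by exists (pickle q); rewrite /qn pickleK.
have ex n : exists P : set T * set T, [/\ measurable P.1, measurable P.2,
    mu P.2 = 0%E, [set x | (qn n)%:E < g x]%E `<=` P.1 &
    P.1 `\` [set x | (qn n)%:E < g x]%E `<=` P.2].
  have mq : measurable ([set x | (qn n)%:E < g x]%E : set CT).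
    by rewrite -[X in measurable X]setTI; exact: emeasurable_fun_o_infty.
  by have [A [N [? ? ? ? ?]]] := completed_set_approx sf mq; exists (A, N).
have [P hP] := choice ex.
(* The added 0 keeps the supremum nonnegative at points above no level. *)
pose S x := [set (qn n)%:E | n in [set n | 0 <= qn n /\ (P n).1 x]] `|` [set 0%E : \bar R].
pose g' x := ereal_sup (S x).
have g'0 x : (0 <= g' x)%E by apply: ereal_sup_ubound; right.
exists g', (\bigcup_n (P n).2); split => //.
- apply: (measurability _ (ErealGenOInfty.measurableE R)) => // _ [_ [t ->] <-].
  rewrite setTI; have [t0|t0] := ltP t 0.
    rewrite (_ : _ @^-1` _ = setT)//; apply/seteqP; split => x //= _.
    by rewrite in_itv/= andbT; apply: lt_le_trans (g'0 x); rewrite lte_fin.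
  rewrite (_ : _ @^-1` _ = \bigcup_(n in [set n | 0 <= qn n /\ t < qn n]) (P n).1).
    by apply: bigcup_measurable => n _; have [] := hP n.
  apply/seteqP; split => x /=.
    rewrite in_itv/= andbT => /ereal_sup_gt[_ [[n [qn0 Pn] <-]|->]].
      by rewrite lte_fin => tq; exists n.
    by rewrite lte_fin ltNge t0.
  move=> [n [qn0 tq] Pn]; rewrite in_itv/= andbT.
  apply: (@lt_le_trans _ _ (qn n)%:E); first by rewrite lte_fin.
  by apply: ereal_sup_ubound; left; exists n.
- by apply: bigcup_measurable => n _; have [] := hP n.
- apply/negligibleP; first by apply: bigcup_measurable => n _; have [] := hP n.
  apply: negligible_bigcup => n; have [_ m2 z _ _] := hP n.
  by apply/negligibleP.
- move=> x nN; apply/eqP; rewrite eq_le; apply/andP; split; last first.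
    apply: ge_ereal_sup => _ [[n [q0 Pn] <-]|->//].
    rewrite leNgt; apply/negP => gq; apply: nN; exists n => //.
    have [_ _ _ _] := hP n; apply; split => //= h.
    by have := lt_trans h gq; rewrite ltxx.
  rewrite leNgt; apply/negP => g'g.
  have [r g'r] : exists r, g' x = r%:E.
    by move: g'g (g'0 x); case: (g' x) => [r| |]//; [exists r|rewrite ltNge leey].
  have r0 : 0 <= r by rewrite -lee_fin -g'r.
  have [q rq qg] : exists2 q : rat, r < ratr q & ((ratr q)%:E < g x)%E.
    rewrite g'r in g'g; move: g'g; case: (g x) => // [s|_].
      rewrite lte_fin => /rat_in_itvoo[q]; rewrite in_itv/= => /andP[rq qs].
      by exists q => //; rewrite lte_fin.
    have /rat_in_itvoo[q] : r < r + 1 by rewrite ltrDl.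
    by rewrite in_itv/= => /andP[rq _]; exists q => //; exact: ltry.
  have [n qnq] := qnE q.
  suff : ((qn n)%:E <= g' x)%E by rewrite g'r lee_fin qnq leNgt rq.
  apply: ereal_sup_ubound; left; exists n => //; split.
    by rewrite qnq (le_trans r0)// ltW.
  by have [_ _ _ + _] := hP n; apply => /=; rewrite qnq.
Qed.

Local Notation cmu := (completed_measure_extension (mu := mu)).

(** The identity out of the completed space is measurable and pushes the completed measure forward
    to [mu]. *)
Lemma integral_completed (f : T -> \bar R) : measurable_fun setT f ->
  (forall x, (0 <= f x)%E) -> (\int[cmu]_x f x = \int[mu]_x f x)%E.
Proof.
move=> mf f0.
have mid : measurable_fun setT (id : CT -> T).
  move=> _ Y mY; rewrite setTI preimage_id; exact: caratheodory_measurable_mu_ext.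
have := ge0_integral_pushforward mid cmu measurableT mf.
rewrite preimage_setT => <-; last by move=> x _; exact: f0.
apply: eq_measure_integral => A mA _.
by rewrite -[RHS](measurable_mu_extE mu mA).
Qed.

Lemma completed_null (N : set T) : measurable N -> mu N = 0%E -> cmu N = 0%E.
Proof. by move=> mN N0; rewrite /completed_measure_extension measurable_mu_extE. Qed.

End Completion.

Section CompletedFubini.
Context (R : realType) (d1 d2 : measure_display).
Context (T1 : measurableType d1) (T2 : measurableType d2).
Context (mu1 : {sigma_finite_measure set T1 -> \bar R}).
Context (mu2 : {sigma_finite_measure set T2 -> \bar R}).
Context (c1 : measure_is_complete mu1) (c2 : measure_is_complete mu2).
Local Notation mu := (product_measure mu1 mu2).
Local Notation cmu := (completed_product_measure mu1 mu2).

Lemma product_sigma_finite : sigma_finite [set: T1 * T2] mu.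
Proof.
have /sigma_finiteP[F [FT Fnd mF]] := sigma_finiteT mu1.
have /sigma_finiteP[G [GT Gnd mG]] := sigma_finiteT mu2.
exists (fun n => F n `*` G n).
  apply/seteqP; split => // -[x y] _.
  have [i _ Fx] : (\bigcup_n F n) x by rewrite -FT.
  have [j _ Gy] : (\bigcup_n G n) y by rewrite -GT.
  exists (maxn i j) => //; split => /=.
    by move/subsetPset: (Fnd _ _ (leq_maxl i j)); apply.
  by move/subsetPset: (Gnd _ _ (leq_maxr i j)); apply.
move=> n; have [mFn Fn] := mF n; have [mGn Gn] := mG n.
split; first exact: measurableX.
by rewrite /= product_measure1E// lte_mul_pinfty// ge0_fin_numE.
Qed.

Lemma measurable_section (N : set (T1 * T2)) y : measurable N ->
  measurable [set x | N (x, y)].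
Proof.
move=> mN; have := pair2_measurable (T1 := T1) y measurableT mN.
by rewrite setTI.
Qed.

(** Tonelli for the indicator of [N]: the measures of its sections form a nonnegative function of
    integral zero. *)
Lemma ae_section_null (N : set (T1 * T2)) : measurable N -> mu N = 0%E ->
  {ae mu2, forall y, mu1 [set x | N (x, y)] = 0%E}.
Proof.
move=> mN N0.
have mf : measurable_fun setT (EFin \o (\1_N : T1 * T2 -> R)).
  by apply/measurable_EFinP; exact: measurable_indic.
have f0 z : (0 <= (EFin \o (\1_N : T1 * T2 -> R)) z)%E by rewrite lee_fin.
have I0 : (\int[mu2]_y fubini_G mu1 (EFin \o (\1_N : T1 * T2 -> R)) y = 0)%E.
  rewrite -(fubini_tonelli2 (m1 := mu1) (m2 := mu2) _ mf f0).
  rewrite /comp integral_indic ?setIT//; exact: N0.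
have mG := measurable_fun_fubini_tonelli_G (m1 := mu1) _ mf f0.
have G0 y : (0 <= fubini_G mu1 (EFin \o (\1_N : T1 * T2 -> R)) y)%E.
  by apply: integral_ge0.
have : (\int[mu2]_y `|fubini_G mu1 (EFin \o (\1_N : T1 * T2 -> R)) y| = 0)%E.
  by rewrite -I0; apply: eq_integral => y _; rewrite gee0_abs.
move/(ae_eq_integral_abs _ measurableT mG); apply: filterS => y /(_ Logic.I).
rewrite /= /fubini_G => <-; rewrite (_ : (fun x => _) = EFin \o (\1_[set x | N (x, y)] : T1 -> R)).
  by rewrite integral_indic ?setIT//; exact: measurable_section.
by apply/funext => x /=; rewrite !indicE; congr (_%:R%:E); apply/idP/idP; rewrite !inE.
Qed.

(** Off a null measurable [N], [g] agrees with a product-measurable [g'], to which Tonelli applies.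
    For almost every [y] the section of [N] is null; completeness of [mu1] then makes the section of
    [g] measurable, and completeness of [mu2] the inner integral. *)
Theorem completed_fubini (g : completed_prod mu1 mu2 -> \bar R) :
  measurable_fun setT g -> (forall x, (0 <= g x)%E) ->
  [/\ {ae mu2, forall y, measurable_fun setT (fun x => g (x, y))},
      measurable_fun setT (fun y => \int[mu1]_x g (x, y))%E &
      (\int[cmu]_z g z = \int[mu2]_y \int[mu1]_x g (x, y))%E].
Proof.
move=> mg g0.
have [g' [N [mg' g'0 mN N0 gg']]] := completed_fun_approx product_sigma_finite mg g0.
have aeN := ae_section_null mN N0.
have sec y : measurable [set x | N (x, y)] by exact: measurable_section.
have secf y : measurable_fun setT (fun x => g' (x, y)).
  exact: (measurableT_comp mg' (pair2_measurable y)).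
have aey y : mu1 [set x | N (x, y)] = 0%E ->
    ae_eq mu1 setT (fun x => g' (x, y)) (fun x => g (x, y)).
  move=> Ny; exists [set x | N (x, y)]; split => // x /= h.
  by apply: contrapT => nN; apply: h => _; rewrite gg'.
have ms y : mu1 [set x | N (x, y)] = 0%E -> measurable_fun setT (fun x => g (x, y)).
  by move=> /aey /(ae_measurable_fun c1); apply.
have ie y : mu1 [set x | N (x, y)] = 0%E ->
    (\int[mu1]_x g' (x, y) = \int[mu1]_x g (x, y))%E.
  move=> Ny; apply: ge0_ae_eq_integral => //; [exact: ms|exact: aey].
have mG' := measurable_fun_fubini_tonelli_G (m1 := mu1) _ mg' g'0.
have aeG : ae_eq mu2 setT (fun y => \int[mu1]_x g' (x, y))%E
                          (fun y => \int[mu1]_x g (x, y))%E.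
  by apply: filterS aeN => y Ny _; exact: ie.
have mG : measurable_fun setT (fun y => \int[mu1]_x g (x, y))%E.
  exact: (ae_measurable_fun c2 aeG).
split => //; first by apply: filterS aeN => y; exact: ms.
transitivity (\int[cmu]_z g' z)%E.
  apply: ge0_ae_eq_integral => //.
    exact: measurable_to_completed.
  exists N; split; [exact: caratheodory_measurable_mu_ext|exact: completed_null|].
  by move=> z /= h; apply: contrapT => nN; apply: h => _; exact: gg'.
rewrite integral_completed// (fubini_tonelli2 (m1 := mu1) (m2 := mu2) _ mg' g'0).
by apply: ge0_ae_eq_integral => //; move=> y _; apply: integral_ge0.
Qed.

End CompletedFubini.

(** * Mixed norms *)

(** The inner integral of [mixed_norm], spelled identically so that [mixed_normE] holds by
    conversion. *)
Definition slice_integral (R : realType) (d1 d2 : measure_display)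
    (T1 : measurableType d1) (T2 : measurableType d2)
    (mu1 : {measure set T1 -> \bar R}) (X : set (T1 * T2)) (p : R)
    (w1 : T1 -> R) (h : T1 * T2 -> \bar R) (y : T2) : \bar R :=
  (\int[mu1]_x (`|h (x, y)| `^ p * (\1_X (x, y) * w1 x)%:E))%E.

Section Slices.
Context (R : realType) (d1 d2 : measure_display).
Context (T1 : measurableType d1) (T2 : measurableType d2).
Context (mu1 : {sigma_finite_measure set T1 -> \bar R}).
Context (mu2 : {sigma_finite_measure set T2 -> \bar R}).
Context (c1 : measure_is_complete mu1) (c2 : measure_is_complete mu2).
Context (X : set (completed_prod mu1 mu2)) (mX : measurable X).
Context (p : R) (w1 : T1 -> R) (w10 : forall x, 0 <= w1 x).
Context (mw1 : measurable_fun setT w1).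
Context (h : T1 * T2 -> \bar R).
Context (mh : measurable_fun X (h : completed_prod mu1 mu2 -> \bar R)).
Local Notation cmu := (completed_product_measure mu1 mu2).
Local Notation S := (slice_integral mu1 X p w1 h).

Lemma slice_integral_ge0 y : (0 <= S y)%E.
Proof.
apply: integral_ge0 => x _; rewrite mule_ge0 ?poweR_ge0//.
by rewrite lee_fin mulr_ge0.
Qed.

Let slices (v : T2 -> R) (v0 : forall y, 0 <= v y) (mv : measurable_fun setT v) :=
  let g (z : completed_prod mu1 mu2) :=
    (`|h z| `^ p * (\1_X z * product_weight w1 v z)%:E)%E in
  [/\ measurable_fun setT g, forall z, (0 <= g z)%E &
      (\int[cmu]_(z in X) (`|h z| `^ p * (product_weight w1 v z)%:E) =
       \int[cmu]_z g z)%E].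

Let slicesP v v0 mv : @slices v v0 mv.
Proof.
rewrite /slices.
pose k (z : completed_prod mu1 mu2) := (`|h z| `^ p * (product_weight w1 v z)%:E)%E.
have -> : (fun z : completed_prod mu1 mu2 =>
    `|h z| `^ p * (\1_X z * product_weight w1 v z)%:E)%E = k \_ X.
  apply/funext => z; rewrite patchE indicE /k; case: (z \in X); first by rewrite mul1r.
  by rewrite mul0r mule0.
split; last exact: integral_mkcond.
  apply/(measurable_restrict k mX measurableT); rewrite setTI.
  apply: emeasurable_funM.
    apply: (measurableT_comp (measurable_poweR p)).
    exact: (measurableT_comp (abse_measurable (D := setT)) mh).
  apply: measurable_funTS; apply: (measurable_to_completed (f := EFin \o product_weight w1 v)).
  apply/measurable_EFinP; apply: measurable_funM.
    exact: (measurableT_comp mw1).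
  exact: (measurableT_comp mv).
move=> z; rewrite mule_ge0 ?poweR_ge0// lee_fin mulr_ge0//.
exact: mulr_ge0.
Qed.

Lemma measurable_slice_integral : measurable_fun setT S.
Proof.
have [mg g0 _] := @slicesP (cst 1) (fun=> ler01) (measurable_cst _).
have [_ + _] := completed_fubini c1 c2 mg g0.
apply: eq_measurable_fun => y _; apply: eq_integral => x _.
by rewrite /product_weight/= mulr1.
Qed.

(** This exchange turns a weighted L^p bound on [X] into an inequality between two functions of [y]
    tested against [v]. *)
Lemma integral_slices (v : T2 -> R) : (forall y, 0 <= v y) ->
  measurable_fun setT v ->
  (\int[cmu]_(z in X) (`|h z| `^ p * (product_weight w1 v z)%:E) =
   \int[mu2]_y (S y * (v y)%:E))%E.
Proof.
move=> v0 mv; have [mg g0 ->] := slicesP v0 mv.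
have [_ mG ->] := completed_fubini c1 c2 mg g0.
(* With weight 1 this shows, for almost every [y], that the inner integrand is measurable before the
   factor [v y] is pulled out. *)
have [m1 m10 _] := @slicesP (cst 1) (fun=> ler01) (measurable_cst _).
have [ms _ _] := completed_fubini c1 c2 m1 m10.
apply: ge0_ae_eq_integral => //.
- apply: emeasurable_funM; first exact: measurable_slice_integral.
  exact/measurable_EFinP.
- by move=> y _; apply: integral_ge0.
- by move=> y _; rewrite mule_ge0 ?slice_integral_ge0// lee_fin.
apply: filterS ms => y msy _.
rewrite /slice_integral -ge0_integralZr//; last 3 first.
- move: msy; apply: eq_measurable_fun => x _.
  by rewrite /product_weight/= mulr1.
- by move=> x _; rewrite mule_ge0 ?poweR_ge0// lee_fin mulr_ge0.
- by rewrite lee_fin.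
apply: eq_integral => x _; rewrite /product_weight/=.
by rewrite -muleA -EFinM mulrA.
Qed.

Lemma mixed_normE (q : R) (w2 : T2 -> R) :
  mixed_norm mu1 mu2 X p q w1 w2 h =
  ((\int[mu2]_y (S y `^ (q / p) * (w2 y)%:E)) `^ q^-1)%E.
Proof. by []. Qed.

End Slices.

(** * The mixed-norm bound *)

Theorem corollary2p6 (R : realType) (K1 K2 p q K0 : R) (Phi : R -> R -> R) :
  1 < p -> 1 < q -> 1 <= K0 ->
  exists2 N : R, 0 < N &
  forall (d1 d2 : measure_display)
    (T1 : measurableType d1) (T2 : measurableType d2)
    (rho1 : T1 -> T1 -> R) (rho2 : T2 -> T2 -> R)
    (mu1 : {sigma_finite_measure set T1 -> \bar R})
    (mu2 : {sigma_finite_measure set T2 -> \bar R})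
    (X : set (completed_prod mu1 mu2)),
  homogeneous_type setT rho1 mu1 K1 K2 ->
  homogeneous_type setT rho2 mu2 K1 K2 ->
  homogeneous_type X (sum_metric rho1 rho2)
    (completed_product_measure mu1 mu2) K1 K2 ->
  product_Ap rho1 rho2 X Phi ->
  forall (w1 : T1 -> R) (w2 : T2 -> R),
  Ap_weight setT rho1 mu1 p w1 ->
  Ap_weight setT rho2 mu2 q w2 ->
  (Ap_const setT rho1 mu1 p w1 <= K0%:E)%E ->
  (Ap_const setT rho2 mu2 q w2 <= K0%:E)%E ->
  forall f : completed_prod mu1 mu2 -> R,
  mixed_Lpq X p q w1 w2 f ->
  (mixed_norm mu1 mu2 X p q w1 w2
     (maximal_function X (sum_metric rho1 rho2)
        (completed_product_measure mu1 mu2) f)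
   <= N%:E * mixed_norm mu1 mu2 X p q w1 w2 (EFin \o f))%E.
Proof.
move=> p1 q1 K01.
pose L := extrapolation_weight_const (Num.max 1 K1) (Num.max 1 K2) p q (Num.max 1 K0).
(* [max K0 L] bounds the A_p constants of both factors, [w1] by [K0] and the extrapolation weight by
   [L], so [Phi] controls their product on [X]. *)
pose C := muckenhoupt_const (Num.max 1 K1) (Num.max 1 K2) p
  (Num.max 1 (Phi p (Num.max K0 L))).
have C0 : 0 <= C by exact: muckenhoupt_const_ge0.
have N0 : 0 < 4 * (2 + C) by rewrite mulr_gt0// ltr_pwDl.
have q0 : 0 < q by exact: lt_trans q1.
have p0 : 0 < p by exact: lt_trans p1.
exists (4 * (2 + C)) => // d1 d2 T1 T2 rho1 rho2 mu1 mu2 X H1 H2 HX PA.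
move=> w1 w2 w1A w2A w1K w2K f [mf _].
have DS2 := homogeneous_doubling_space H2.
have DSX := homogeneous_doubling_space HX.
have mX := ds_measurable DSX.
have c1 : measure_is_complete mu1.
  by move=> A nA; exact: (homogeneous_complete H1).
have c2 : measure_is_complete mu2.
  by move=> A nA; exact: (homogeneous_complete H2).
have [w10 mw1 _] := w1A; have [w20 mw2 _] := w2A.
set cmu := completed_product_measure mu1 mu2.
set M : T1 * T2 -> \bar R := maximal_function X (sum_metric rho1 rho2) cmu f.
have mM : measurable_fun X (M : completed_prod mu1 mu2 -> \bar R).
  exact: (measurable_maximal_function DSX f).
have mfE : measurable_fun X ((EFin \o f) : completed_prod mu1 mu2 -> \bar R).
  exact/measurable_EFinP.
rewrite !mixed_normE.
pose G := slice_integral mu1 X p w1 M.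
pose F := slice_integral mu1 X p w1 (EFin \o f).
have w10' x : 0 <= w1 x by exact: w10.
have mG : measurable_fun setT G by exact: (measurable_slice_integral c1 c2 mX p w10' mw1 mM).
have mF : measurable_fun setT F by exact: (measurable_slice_integral c1 c2 mX p w10' mw1 mfE).
have G0 y : (0 <= G y)%E by exact: slice_integral_ge0.
have F0 y : (0 <= F y)%E by exact: slice_integral_ge0.
have pw0 (E : T2 -> \bar R) w y : 0 <= w y -> (0 <= E y `^ (q / p) * (w y)%:E)%E.
  by move=> wy; rewrite mule_ge0 ?poweR_ge0// lee_fin.
have mpw (E : T2 -> \bar R) (w : T2 -> R) : measurable_fun setT E ->
    measurable_fun setT w -> measurable_fun setT (fun y => E y `^ (q / p) * (w y)%:E)%E.
  move=> mE mw; apply: emeasurable_funM; last exact/measurable_EFinP.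
  exact: (measurableT_comp (measurable_poweR _)).
(* [v] is taken in A_p rather than A_q, the same class as [w1], so that condition (b) applies to
   [w1 v]. *)
have one_weight v : muckenhoupt setT rho2 mu2 p L v ->
    (\int[mu2]_y (G y * (v y)%:E) <= C%:E * \int[mu2]_y (F y * (v y)%:E))%E.
  move=> mv; have [vA vK] := muckenhoupt_Ap DS2 p1 mv; have [v0 mv' _] := vA.
  have v0' y : 0 <= v y by exact: v0.
  have [||wA wK] := PA p (Num.max K0 L) w1 v p1 w1A vA.
  - by apply: (le_trans w1K); rewrite lee_fin le_max lexx.
  - by apply: (le_trans vK); rewrite lee_fin le_max lexx orbT.
  have := maximal_function_Ap DSX p1 wA wK mf.
  rewrite -(integral_slices c1 c2 mX p w10' mw1 mM v0' mv').
  rewrite -(integral_slices c1 c2 mX p w10' mw1 mfE v0' mv').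
  apply: le_trans; rewrite le_eqVlt; apply/orP; left; apply/eqP.
  apply: eq_integral => z /set_mem Xz.
  by rewrite gee0_abs//; exact: (maximal_function_ge0 DSX).
have [w2z|[w2e mw2m]] := Ap_muckenhoupt DS2 q1 w2A w2K.
  rewrite (_ : (\int[mu2]_y _)%E = 0%E); last first.
    rewrite -(integral0 mu2 setT); apply: ge0_ae_eq_integral => //.
    - exact: mpw.
    - by move=> y _; apply: pw0; exact: w20.
    - by apply: filterS w2z => y /(_ Logic.I) -> _; rewrite mule0.
  rewrite poweR0r ?invr_eq0 ?gt_eqF// mule_ge0 ?poweR_ge0// lee_fin.
  exact: ltW.
have mw2p := mw_measurable mw2m.
have eI (E : T2 -> \bar R) : measurable_fun setT E ->
    (\int[mu2]_y (E y `^ (q / p) * (w2 y)%:E) =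
     \int[mu2]_y (E y `^ (q / p) * (positive_part_weight w2 y)%:E))%E.
  move=> mE; apply: ge0_ae_eq_integral => //.
  - exact: mpw.
  - exact: mpw.
  - by move=> y _; apply: pw0; exact: w20.
  - by move=> y _; apply: pw0; rewrite ltW// (mw_gt0 mw2m).
  - by apply: filterS w2e => y /(_ Logic.I) -> _.
rewrite (eI G mG) (eI F mF).
have := extrapolation DS2 p1 q1 mw2m C0 mF mG (fun x _ => F0 x) (fun x _ => G0 x) one_weight.
set IG := (\int[mu2]_y (G y `^ _ * _))%E; set IF := (\int[mu2]_y (F y `^ _ * _))%E.
have IG0 : (0 <= IG)%E.
  by apply: integral_ge0 => y _; apply: pw0; rewrite ltW// (mw_gt0 mw2m).
have IF0 : (0 <= IF)%E.
  by apply: integral_ge0 => y _; apply: pw0; rewrite ltW// (mw_gt0 mw2m).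
(* The [q]-th root turns the constant [(4 (2 + C))^q] into [N]. *)
move=> le; apply: (le_trans (le_poweR _ IG0 le)); first by rewrite invr_ge0 ltW.
rewrite poweRM ?lee_fin ?powR_ge0// poweR_EFin -powRrM divff ?gt_eqF// powRr1//.
exact: ltW.
Qed.
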